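(* Let $p\mathscr P$ be the class of all pointed proper quantum metric spaces, where $\mathbb A$ and $\mathbb B$ are identified when $\mathsf D(\mathbb A,\mathbb B)=0$ ($\mathsf D$ being the quantum metametric), endowed with the hypertopology of Gromov-Hausdorff convergence, i.e. the topology whose closure operator is $\mathrm{cl}(\emptyset)=\emptyset$ and $\mathrm{cl}(\mathcal A)=\{\mathbb B\in p\mathscr P:\inf_{\mathbb A\in\mathcal A}\mathsf D(\mathbb B,\mathbb A)=0\}$ for nonempty $\mathcal A\subseteq p\mathscr P$. Then this topology is metrizable; the open balls $\{\mathbb B:\mathsf D(\mathbb A,\mathbb B)<r\}$, for $\mathbb A\in p\mathscr P$ and $r>0$, form a topological basis for it; a sequence $(\mathbb A_n)_{n\in\mathbb N}$ converges to $\mathbb A$ in this topology if and only if $\lim_{n\to\infty}\mathsf D(\mathbb A_n,\mathbb A)=0$; and the function $\mathsf D$ is continuous for this topology, which is the smallest topology making $\mathsf D$ continuous.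
   Context: **Basics.** For a C*-algebra $A$: $\mathrm{sa}(A)$ is its self-adjoint part, $S(A)$ its state space, $Q(A)$ the set of positive linear functionals of norm at most $1$; $\mathfrak uA=A$ if $A$ is unital and otherwise $\mathfrak uA=A\oplus\mathbb C$ is the minimal unitization; $1_A$ is the unit of $\mathfrak uA$. An element $h\in\mathrm{sa}(A)$ is strictly positive when $\varphi(h)>0$ for all $\varphi\in S(A)$. A seminorm $L$ on a subspace $\mathrm{dom}(L)\subseteq A$ is hermitian when $a\in\mathrm{dom}(L)$ implies $a^*\in\mathrm{dom}(L)$ and $L(a^* )=L(a)$; then $\mathrm{dom}_{sa}(L)=\mathrm{dom}(L)\cap\mathrm{sa}(A)$. It is a norm modulo constants when it is a norm if $A$ has no unit, and $\{a:L(a)=0\}=\mathbb C1_A$ if $A$ is unital. It is Leibniz when $\mathrm{dom}(L)$ is a subalgebra and $L(ab)\le\|a\|L(b)+L(a)\|b\|$. For $M\ge1$, $\|a\|_{L,M}=\max\{\frac1M\|a\|_A,L(a)\}$. For positive linear functionals $\varphi,\psi$, $\mathsf{bl}_{L,M}(\varphi,\psi)=\sup\{|\varphi(a)-\psi(a)|:a\in\mathrm{dom}_{sa}(L),\|a\|_{L,M}\le1\}$, and $\mathsf{bl}_L=\mathsf{bl}_{L,1}$. For states, $\mathsf{mk}_L(\varphi,\psi)=\sup\{|\varphi(a)-\psi(a)|:a\in\mathrm{dom}_{sa}(L),L(a)\le1\}\in[0,\infty]$, and $\mathrm{qdiam}(A,L)=\sup_{\varphi,\psi\in S(A)}\mathsf{mk}_L(\varphi,\psi)$.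 **Spaces.** A separable quantum locally compact metric space (sqlcms) $(A,L)$ is a separable C*-algebra $A$ with a Leibniz hermitian norm modulo constants $L$ on a dense *-subalgebra $\mathrm{dom}(L)$ of $A$ such that: (i) $\mathsf{bl}_L$ induces the weak* topology on $S(A)$; (ii) $\{a\in\mathrm{dom}_{sa}(L):L(a)\le1\}$ is norm closed in $\mathrm{sa}(A)$; (iii) there are a strictly positive $h\in\mathrm{sa}(A)$ and $\mu\in S(A)$ with $\mu(h)=1$ such that $\{hah\in\mathfrak uA:a=b+t1_A,\ t\in\mathbb R,\ b\in\mathrm{dom}_{sa}(L),\ L(b)\le1,\ \mu(b)=-t\}$ is bounded. A pin of $(A,L)$ is a state $\mu$ such that $\{\varphi\in S(A):\mathsf{mk}_L(\varphi,\mu)<\infty\}$ is weak* dense in $S(A)$; then $(A,L,\mu)$ is called pinned. An $L$-Lipschitz $\mu$-pinned exhaustive sequence is a sequence $(h_n)$ in $\mathrm{dom}_{sa}(L)$ with $L(h_n)\to0$, $\mu(h_n)\to1$, $\|h_n\|_A\to1$. A topography of $(A,L)$ is an Abelian C*-subalgebra $\mathfrak M$ of $A$ containing some $h\in\mathrm{dom}(L)$ strictly positive in $A$ such that $\{hah\in\mathfrak uA:a=b+t1_A,\ t\in\mathbb R,\ b\in\mathrm{dom}_{sa}(L),\ L(b)\le1,\ \mu(b)=-t\}$ is bounded for some state $\mu$ of $A$ restricting to a character of $\mathfrak M$; $(A,L,\mathfrak M)$ is then a topographic sqlcms. A pointed proper quantum metric space $(A,L,\mathfrak M,\mu)$ is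 a pinned sqlcms $(A,L,\mu)$ with a topography $\mathfrak M$ such that $\mu$ restricts to a character of $\mathfrak M$ and there is an $L$-Lipschitz $\mu$-pinned exhaustive sequence contained in $\mathfrak M$. **Isometries.** A quantum $M$-isometry $\pi:(D,L_D)\to(A,L_A)$ between sqlcms is a surjective *-morphism, proper (mapping an approximate unit to an approximate unit), with $\pi(\mathrm{dom}(L_D))=\mathrm{dom}(L_A)$, $\|a\|_{L_A,M}=\inf\{\|d\|_{L_D,M}:d\in\mathrm{dom}_{sa}(L_D),\pi(d)=a\}$ for all $a\in\mathrm{dom}_{sa}(L_A)$, and $L_A(\pi(d))\le L_D(d)$ for all $d\in\mathrm{dom}_{sa}(L_D)$. It is topographic from $(D,L_D,\mathfrak M_D)$ to $(A,L_A,\mathfrak M_A)$ when $\pi(\mathfrak M_D)\subseteq\mathfrak M_A$ and for all $a\in\mathrm{dom}_{sa}(L_A)\cap\mathfrak M_A$, $\varepsilon>0$ there is $d\in\mathfrak M_D\cap\mathrm{dom}_{sa}(L_D)$ with $\pi(d)=a$, $\|d\|_D\le e^\varepsilon\|a\|_A$, $L_D(d)\le e^{\varepsilon}L_A(a)$. **Tunnels.** An $M$-tunnel $\tau=(D,L_D,\mathfrak M_D,\pi_A,\pi_B,e)$ from $(A,L_A,\mathfrak M_A,\mu_A)$ to $(B,L_B,\mathfrak M_B,\mu_B)$ consists of a topographic sqlcms $(D,L_D,\mathfrak M_D)$, an element $e\in\mathrm{dom}_{sa}(L_D)\cap\mathfrak M_D$, and topographic quantum $M$-isometries $\pi_A:(D,L_D,\mathfrak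 M_D)\to(A,L_A,\mathfrak M_A)$, $\pi_B:(D,L_D,\mathfrak M_D)\to(B,L_B,\mathfrak M_B)$, such that $\mu_A\circ\pi_A$ is a pin of $(D,L_D)$. Write $eQ(D)e=\{\varphi(e\cdot e):\varphi\in Q(D)\}$, $\pi^*(\varphi)=\varphi\circ\pi$, and $X\subseteq_\varepsilon^{d}Y$ when every $x\in X$ satisfies $\inf_{y\in Y}d(x,y)\le\varepsilon$. The extent $\chi(\tau)$ is the maximum of: $\inf\{\varepsilon>0:eQ(D)e\subseteq_\varepsilon^{\mathsf{bl}_{L_D,M}}\pi_A^*(Q(A))\text{ and }eQ(D)e\subseteq_\varepsilon^{\mathsf{bl}_{L_D,M}}\pi_B^*(Q(B))\}$; $\mathsf{mk}_{L_D}(\mu_A\circ\pi_A,\mu_B\circ\pi_B)$; and $\max\{2M L_D(e),|1-\mu_A(\pi_A(e))|,|1-\mu_B(\pi_B(e))|\}$. The $M$-local quantum metametric is $\eth_M(\mathbb A,\mathbb B)=\inf\{\chi(\tau):\tau\text{ an }M\text{-tunnel from }\mathbb A\text{ to }\mathbb B\}$. **Quantum metametric.** With $e^{-\infty}=0$ and $\sup\emptyset=0$, $$\mathsf D(\mathbb A,\mathbb B)=\max\Bigl\{\inf\bigl\{\varepsilon>0:\sup_{r\in[1,1/\varepsilon]}\eth_r(\mathbb A,\mathbb B)<\varepsilon\bigr\},\ \bigl|e^{-\mathrm{qdiam}(A,L_A)}-e^{-\mathrm{qdiam}(B,L_B)}\bigr|\Bigr\}.$$ *)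

(* Defs.v *)
(* MathComp / MathComp-Analysis development over an arbitrary R : realType;
   the complex numbers are R[i]. *)
From HB Require Import structures.
From mathcomp Require Import all_boot all_order all_algebra.
From mathcomp Require Import complex.
From mathcomp Require Import all_classical all_reals all_analysis.

Set Implicit Arguments.
Unset Strict Implicit.
Unset Printing Implicit Defensive.

Import Order.TTheory GRing.Theory Num.Theory.
Import numFieldNormedType.Exports.

Local Open Scope classical_set_scope.
Local Open Scope ring_scope.

(* Norms over R[i] take their values in R[i], where they are real and
   nonnegative; rnorm is the same norm as an element of R. *)
Definition rnorm (R : realType) (V : normedZmodType R[i]) (x : V) : R :=
  complex.Re `|x|.

(* C*-algebras are not assumed to be unital, so the product cannot be that of
   a MathComp ring and is part of the structure. *)
HB.mixin Record isCStarAlgebra (R : realType) (A : Type)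
    & CompleteNormedModule R[i] A := {
  cmul : A -> A -> A ;
  star : A -> A ;
  cmulA : associative cmul ;
  cmulDl : left_distributive cmul +%R ;
  cmulDr : right_distributive cmul +%R ;
  cmulZl : forall (k : R[i]) a b, cmul (k *: a) b = k *: cmul a b ;
  cmulZr : forall (k : R[i]) a b, cmul a (k *: b) = k *: cmul a b ;
  starK : involutive star ;
  starD : {morph star : a b / a + b} ;
  starZ : forall (k : R[i]) a, star (k *: a) = k^* *: star a ;
  starM : forall a b, star (cmul a b) = cmul (star b) (star a) ;
  cmul_norm : forall a b, `|cmul a b| <= `|a| * `|b| ;
  cstar_norm : forall a, `|cmul (star a) a| = `|a| ^+ 2
}.

#[short(type="cstarAlgebra")]
HB.structure Definition CStarAlgebra (R : realType) :=
  { A of CompleteNormedModule R[i] A & isCStarAlgebra R A }.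

Notation "a ** b" := (cmul a b) (at level 40, left associativity) : ring_scope.

(* Functionals on A; the topology carried by this type is that of pointwise
   convergence, which induces the weak* topology on sets of bounded linear
   functionals. *)
Notation functional R A := {ptws A -> R[i]^o}.

Section CStarNotions.
Context (R : realType) (A : cstarAlgebra R).
Implicit Types (a b h : A) (phi psi : functional R A).

Definition selfadjoint : set A := [set a | star a = a].

Definition is_unit (u : A) : Prop := forall a, u ** a = a /\ a ** u = a.

Definition unital : Prop := exists u : A, is_unit u.

Definition separable : Prop := exists2 S : set A, countable S & dense S.

Definition positive_functional phi : Prop :=
  GRing.linear_for *%R phi /\ forall a, 0 <= phi (star a ** a) :> R[i].

Definition functional_norm phi : \bar R :=
  ereal_sup [set (rnorm (phi a))%:E | a in [set a | rnorm a <= 1]].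

Definition states : set (functional R A) :=
  [set phi | positive_functional phi /\ functional_norm phi = 1%E].

Definition quasi_states : set (functional R A) :=
  [set phi | positive_functional phi /\ (functional_norm phi <= 1)%E].

Definition strictly_positive h : Prop :=
  selfadjoint h /\ forall phi, states phi -> 0 < phi h :> R[i].

Definition is_cstar_subalgebra (M : set A) : Prop :=
  [/\ closed M,
      M 0,
      forall (k : R[i]) a b, M a -> M b -> M (k *: a + b),
      forall a b, M a -> M b -> M (a ** b)
    & forall a, M a -> M (star a)].

Definition is_abelian (M : set A) : Prop :=
  forall a b, M a -> M b -> a ** b = b ** a.

(* For a linear functional phi, the restriction of phi to M is a character. *)
Definition restricts_to_character (M : set A) phi : Prop :=
  (forall a b, M a -> M b -> phi (a ** b) = phi a * phi b :> R[i]) /\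
  (exists2 a, M a & phi a != 0 :> R[i]).

Definition positive_element a : Prop := exists b, a = star b ** b.

(* (u_i)_{i in I} is an approximate unit: an increasing net of positive
   elements of the closed unit ball, indexed by the directed set (I, le). *)
Definition approximate_unit (I : Type) (le : I -> I -> Prop) (u : I -> A) :
    Prop :=
  [/\ [/\ inhabited I, forall i, le i i,
          forall i j k, le i j -> le j k -> le i k
        & forall i j, exists2 k, le i k & le j k],
      forall i, positive_element (u i) /\ rnorm (u i) <= 1,
      forall i j, le i j -> positive_element (u j - u i)
    & forall a (e : R), 0 < e -> exists i, forall j, le i j ->
        rnorm (u j ** a - a) <= e /\ rnorm (a ** u j - a) <= e].

End CStarNotions.

Arguments selfadjoint {R} A.
Arguments states {R} A.
Arguments quasi_states {R} A.

Definition star_morphism (R : realType) (A B : cstarAlgebra R)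
    (f : {linear A -> B}) : Prop :=
  (forall a b, f (a ** b) = f a ** f b) /\ (forall a, f (star a) = star (f a)).

Definition proper_morphism (R : realType) (A B : cstarAlgebra R)
    (f : {linear A -> B}) : Prop :=
  exists (I : Type) (le : I -> I -> Prop) (u : I -> A),
    approximate_unit le u /\ approximate_unit le (f \o u).

(* A real-valued function lip with a domain; the values of lip outside of dom
   are irrelevant and never used. *)
Record seminorm_data (R : realType) (A : cstarAlgebra R) := SeminormData {
  dom : set A ;
  lip :> A -> R
}.

Section QuantumMetrics.
Context (R : realType) (A : cstarAlgebra R) (L : seminorm_data A).
Implicit Types (a b h : A) (M : R) (phi psi mu : functional R A).

Definition dom_sa : set A := dom L `&` selfadjoint A.

Definition is_seminorm : Prop :=
  [/\ dom L 0,
      forall (k : R[i]) a b, dom L a -> dom L b -> dom L (k *: a + b),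
      forall a, dom L a -> 0 <= L a,
      forall (k : R[i]) a, dom L a -> L (k *: a) = rnorm k * L a
    & forall a b, dom L a -> dom L b -> L (a + b) <= L a + L b].

Definition is_hermitian : Prop :=
  forall a, dom L a -> dom L (star a) /\ L (star a) = L a.

Definition is_leibniz : Prop :=
  forall a b, dom L a -> dom L b ->
    dom L (a ** b) /\ L (a ** b) <= rnorm a * L b + L a * rnorm b.

Definition is_norm_modulo_constants : Prop :=
  (~ unital A -> forall a, dom L a -> L a = 0 -> a = 0) /\
  (forall u, is_unit u ->
     [set a | dom L a /\ L a = 0] = [set k *: u | k in [set: R[i]]]).

Definition norm_LM M a : R := Num.max (rnorm a / M) (L a).

Definition bl M phi psi : \bar R :=
  ereal_sup [set (rnorm (phi a - psi a))%:E
            | a in [set a | dom_sa a /\ norm_LM M a <= 1]].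

Definition mk phi psi : \bar R :=
  ereal_sup [set (rnorm (phi a - psi a))%:E
            | a in [set a | dom_sa a /\ L a <= 1]].

Definition qdiam : \bar R :=
  ereal_sup [set d | exists phi psi,
    [/\ states A phi, states A psi & d = mk phi psi]].

(* The topology of the distance d on the set S is the relative topology of S
   in T: a subset of S is relatively open if and only if it is open for d. *)
Definition induces_topology_on (T : topologicalType) (S : set T)
    (d : T -> T -> \bar R) : Prop :=
  forall U : set T, U `<=` S ->
    (exists2 O, open O & U = O `&` S) <->
    (forall x, U x -> exists2 r : R, 0 < r &
       forall y, S y -> (d x y < r%:E)%E -> U y).

(* The set of all h a h in uA with a = b + t 1_A, where t is real, b is in
   dom_sa(L), L(b) <= 1 and mu(b) = - t.  As h is in A and A is an ideal of uA
   containing it isometrically, h (b + t 1_A) h = h b h + t h h is an element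
   of A, and the set is bounded in uA if and only if it is in A. *)
Definition pinned_ball h mu : set A :=
  [set x | exists b (t : R),
    [/\ dom_sa b, L b <= 1, mu b = (- t)%:C%C :> R[i]
      & x = h ** b ** h + t%:C%C *: (h ** h)]].

Definition is_sqlcms : Prop :=
  [/\ [/\ separable A, is_seminorm, is_hermitian, is_leibniz
         & is_norm_modulo_constants],
      dense (dom L),
      induces_topology_on (states A) (bl 1),
      exists2 F : set A, closed F &
        [set a | dom_sa a /\ L a <= 1] = F `&` selfadjoint A
    & exists h mu, [/\ strictly_positive h, states A mu, mu h = 1 :> R[i]
        & bounded_set (pinned_ball h mu)]].

Definition is_pin mu : Prop :=
  states A mu /\
  states A `<=` closure [set phi | states A phi /\ (mk phi mu < +oo)%E].

Definition is_exhaustive_sequence mu (h : nat -> A) : Prop :=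
  [/\ forall n, dom_sa (h n),
      L (h n) @[n --> \oo] --> (0 : R),
      mu (h n) @[n --> \oo] --> (1 : R[i]^o)
    & rnorm (h n) @[n --> \oo] --> (1 : R)].

Definition is_topography (T : set A) : Prop :=
  [/\ is_cstar_subalgebra T, is_abelian T &
      exists h mu, [/\ T h, dom L h, strictly_positive h & states A mu] /\
        restricts_to_character T mu /\ bounded_set (pinned_ball h mu)].

Definition is_pointed_proper (T : set A) mu : Prop :=
  [/\ is_sqlcms, is_pin mu, is_topography T, restricts_to_character T mu
    & exists h : nat -> A, is_exhaustive_sequence mu h /\ forall n, T (h n)].

End QuantumMetrics.

Record pointed_proper (R : realType) := PointedProper {
  pp_alg : cstarAlgebra R ;
  pp_lip : seminorm_data pp_alg ;
  pp_top : set pp_alg ;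
  pp_pin : functional R pp_alg ;
  pp_axiom : is_pointed_proper pp_lip pp_top pp_pin
}.

Arguments pp_top {R} p.
Arguments pp_pin {R} p.

Section Isometries.
Context (R : realType) (D A : cstarAlgebra R).
Context (LD : seminorm_data D) (LA : seminorm_data A).
Implicit Types (f : {linear D -> A}).

Definition quantum_isometry (M : R) f : Prop :=
  [/\ star_morphism f /\ (forall a, exists d, f d = a),
      proper_morphism f,
      [set f d | d in dom LD] = dom LA,
      forall a, dom_sa LA a ->
        (norm_LM LA M a)%:E =
        ereal_inf [set (norm_LM LD M d)%:E
                  | d in [set d | dom_sa LD d /\ f d = a]]
    & forall d, dom_sa LD d -> LA (f d) <= LD d].

Definition topographic (TD : set D) (TA : set A) f : Prop :=
  (forall d, TD d -> TA (f d)) /\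
  (forall a (e : R), dom_sa LA a -> TA a -> 0 < e ->
     exists d, [/\ TD d, dom_sa LD d, f d = a,
                   rnorm d <= expR e * rnorm a & LD d <= expR e * LA a]).

End Isometries.

Section Tunnels.
Context (R : realType) (M : R) (A B : pointed_proper R).

Record tunnel := Tunnel {
  tn_alg : cstarAlgebra R ;
  tn_lip : seminorm_data tn_alg ;
  tn_top : set tn_alg ;
  tn_piA : {linear tn_alg -> pp_alg A} ;
  tn_piB : {linear tn_alg -> pp_alg B} ;
  tn_e : tn_alg ;
  tn_sqlcms : is_sqlcms tn_lip ;
  tn_topography : is_topography tn_lip tn_top ;
  tn_e_dom : dom_sa tn_lip tn_e ;
  tn_e_top : tn_top tn_e ;
  tn_isoA : quantum_isometry tn_lip (pp_lip A) M tn_piA ;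
  tn_topoA : topographic tn_lip (pp_lip A) tn_top (pp_top A) tn_piA ;
  tn_isoB : quantum_isometry tn_lip (pp_lip B) M tn_piB ;
  tn_topoB : topographic tn_lip (pp_lip B) tn_top (pp_top B) tn_piB ;
  tn_is_pin : is_pin tn_lip (pp_pin A \o tn_piA)
}.

(* X is included in the eps-neighbourhood of Y for d. *)
Definition almost_included (T : Type) (d : T -> T -> \bar R) (eps : R)
    (X Y : set T) : Prop :=
  forall x, X x -> (ereal_inf [set d x y | y in Y] <= eps%:E)%E.

Definition compressed_quasi_states (D : cstarAlgebra R) (e : D) :
    set (functional R D) :=
  [set psi | exists2 phi, quasi_states D phi & psi = fun d => phi (e ** d ** e)].

Definition pullback_quasi_states (D C : cstarAlgebra R) (f : {linear D -> C}) :
    set (functional R D) :=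
  [set psi | exists2 phi, quasi_states C phi & psi = phi \o f].

Definition extent (t : tunnel) : \bar R :=
  let d := bl (tn_lip t) M in
  let X := compressed_quasi_states (tn_e t) in
  Order.max
    (ereal_inf [set eps%:E | eps in [set eps : R |
       [/\ 0 < eps,
           almost_included d eps X (pullback_quasi_states (tn_piA t))
         & almost_included d eps X (pullback_quasi_states (tn_piB t))]]])
    (Order.max
      (mk (tn_lip t) (pp_pin A \o tn_piA t) (pp_pin B \o tn_piB t))
      (Num.max (2 * M * tn_lip t (tn_e t))
        (Num.max (rnorm (1 - pp_pin A (tn_piA t (tn_e t))))
                 (rnorm (1 - pp_pin B (tn_piB t (tn_e t))))))%:E).

(* It is +oo when there is no M-tunnel from A to B. *)
Definition local_metametric : \bar R :=
  ereal_inf [set c | exists t, c = extent t].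

End Tunnels.

Section Metametric.
Context (R : realType).
Implicit Types (A B : pointed_proper R).

(* The supremum is taken in [0, +oo], so that sup set0 = 0. *)
Definition sup_local_metametric A B (eps : R) : \bar R :=
  ereal_sup ([set 0%E] `|`
    [set local_metametric r A B | r in [set r : R | 1 <= r <= 1 / eps]]).

(* expeR -oo = 0 *)
Definition metametric A B : \bar R :=
  Order.max
    (ereal_inf [set eps%:E | eps in
      [set eps : R | 0 < eps /\ (sup_local_metametric A B eps < eps%:E)%E]])
    `|expeR (- qdiam (pp_lip A)) - expeR (- qdiam (pp_lip B))|%E.

End Metametric.

(* The records above contain MathComp structures and are therefore too large
   to be the carrier of a topologicalType, or the argument of `set`: every
   packed structure lives in a universe strictly above the one of these two.
   The few notions of general topology needed for the class of all pointed
   proper quantum metric spaces are thus stated here for an arbitrary type X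
   and a family op of subsets of X, thought of as the open sets. *)
Section LargeTopology.
Context (X : Type).
Implicit Types (op B : (X -> Prop) -> Prop) (S U V : X -> Prop).

Definition is_topology op : Prop :=
  [/\ op (fun=> True),
      forall U V, op U -> op V -> op (fun x => U x /\ V x)
    & forall F : (X -> Prop) -> Prop, (forall U, F U -> op U) ->
        op (fun x => exists2 U, F U & U x)].

Definition top_closure op S : X -> Prop :=
  fun x => forall U, op U -> U x -> exists2 y, U y & S y.

Definition is_basis op B : Prop :=
  (forall U, B U -> op U) /\
  (forall U x, op U -> U x ->
     exists V, [/\ B V, V x & forall y, V y -> U y]).

Definition top_converges op (u : nat -> X) (x : X) : Prop :=
  forall U, op U -> U x -> \forall n \near \oo, U (u n).

(* Continuity of f on X * X with the product topology. *)
Definition continuous2 op (T : topologicalType) (f : X -> X -> T) : Prop :=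
  forall x y (W : set T), nbhs (f x y) W ->
    exists U V, [/\ op U, op V, U x, V y
                  & forall x' y', U x' -> V y' -> W (f x' y')].

Definition is_metrizable (R : realType) op : Prop :=
  exists d : X -> X -> R,
    [/\ forall x y, d x y = 0 <-> x = y,
        forall x y, d x y = d y x,
        forall x y z, d x z <= d x y + d y z
      & forall U, op U <->
          (forall x, U x ->
             exists2 r : R, 0 < r & forall y, d x y < r -> U y)].

End LargeTopology.

(* Pointed proper quantum metric spaces up to metametric A B = 0: a point is
   an equivalence class. *)
Record hyperspace (R : realType) := Hyperspace {
  members : pointed_proper R -> Prop ;
  hyperspace_axiom :
    exists A, members = (fun B => metametric A B = 0%E)
}.

Section Hypertopology.
Context (R : realType).
Implicit Types (x y : hyperspace R) (S U : hyperspace R -> Prop).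

Definition hclass (A : pointed_proper R) : hyperspace R :=
  Hyperspace (ex_intro _ A erefl).

(* The metametric on classes.  The infimum is over a set with a single value,
   since metametric A B only depends on the classes of A and B. *)
Definition hdist x y : \bar R :=
  ereal_inf [set r | exists A B,
    [/\ members x A, members y B & r = metametric A B]].

Definition hball x (r : R) : hyperspace R -> Prop :=
  fun y => (hdist x y < r%:E)%E.

Definition hclosure S : hyperspace R -> Prop :=
  fun x => (exists y, S y) /\
           ereal_inf [set r | exists2 y, S y & r = hdist x y] = 0%E.

(* The closed sets are those equal to their hclosure. *)
Definition hopen U : Prop :=
  forall x, hclosure (fun y => ~ U y) x <-> ~ U x.

End Hypertopology.

(* Main.v *)
(* The local metametrics satisfy a relaxed triangle inequality: tunnels of extents
   below x and y, both at most 1, compose to a tunnel of extent at most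
   x + y + 5 x y.  The composed tunnel is the direct sum of the two quantum spaces,
   with the Lipschitz seminorm max(L1, L2, |p1 d1 - p2 d2| / delta), where p1 and p2
   are the two maps to the common middle space, and e = (e1 g2, g1 e2), where g1 and
   g2 are lifts through the middle space of the images of e1 and e2.  Hence
   D(A, C) <= D(A, B) + D(B, C) + 5 D(A, B) D(B, C), and since D <= 1, the function
   d(x, y) = sup_z |D(x, z) - D(y, z)| is a metric with D <= d <= 6 D; everything
   about the hypertopology follows from this equivalence.

   The direct sum is compared with its summands through states, which uses from the
   theory of C*-algebras: positivity of b* b, contractivity of *-morphisms,
   approximate units of separable algebras, the Cauchy-Schwarz inequality and
   the existence of a state attaining the norm of e e. *)
From HB Require Import structures.
Require Import Defs.
From mathcomp Require Import all_boot all_order all_algebra.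
From mathcomp Require Import ssrAC complex ring lra.
From mathcomp Require Import all_classical all_reals all_analysis.

Set Implicit Arguments.
Unset Strict Implicit.
Unset Printing Implicit Defensive.

Import Order.TTheory GRing.Theory Num.Theory.
Import numFieldNormedType.Exports.

Local Open Scope classical_set_scope.
Local Open Scope ring_scope.

(** * C*-algebras *)

(** Nothing in the definition of a tunnel bounds the norm of [e], so the products [e1 g2] and
    [g1 e2] are not controlled a priori. The bound comes from the extent: the inclusion of
    compressed quasi-states, tested on a state attaining the norm of [e ** e], yields
    [rnorm e ^ 2 <= 1 + x / M]. Topographies are Abelian, so [e1] commutes with [g2]: the products
    are self-adjoint, and the base states are multiplicative on them. The coefficient 5 is fixed by
    the summand reached through the middle space, where one error is multiplied by about [1 + 3 x],
    the mismatch [delta] costs at most another [x y], and the remainder absorbs the slack of the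
    lifts. The C*-algebra part avoids spectral theory. The norm of the unitization is replaced by
    the relation [ule], square roots come from a fixed-point iteration, and norm bounds come from
    exhibiting a self-adjoint element as the real part of a unitary. *)

Section RealNorm.
Context (R : realType) (V : normedZmodType R[i]).
Implicit Types x y : V.

Lemma rnormE x : (rnorm x)%:C%C = `|x|.
Proof. exact: RRe_real (normr_real x). Qed.

Lemma rnorm_le x (r : R) : (rnorm x <= r) = (`|x| <= r%:C%C).
Proof. by rewrite -rnormE lecR. Qed.

Lemma rnorm_ge0 x : 0 <= rnorm x.
Proof. by have := normr_ge0 x; rewrite -rnormE ler0c. Qed.

Lemma rnorm0 : rnorm (0 : V) = 0.
Proof. by apply: complexI; rewrite rnormE normr0. Qed.

Lemma rnorm_eq0 x : rnorm x = 0 -> x = 0.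
Proof. by move=> x0; apply/normr0_eq0; rewrite -rnormE x0. Qed.

Lemma rnormN x : rnorm (- x) = rnorm x.
Proof. by rewrite /rnorm normrN. Qed.

Lemma rnormD x y : rnorm (x + y) <= rnorm x + rnorm y.
Proof. by rewrite -lecR rmorphD /= !rnormE ler_normD. Qed.

Lemma rnormB x y : rnorm (x - y) <= rnorm x + rnorm y.
Proof. by rewrite (le_trans (rnormD _ _))// rnormN. Qed.

Lemma rdistC x y : rnorm (x - y) = rnorm (y - x).
Proof. by rewrite -opprB rnormN. Qed.

Lemma rdistD x y z : rnorm (x - z) <= rnorm (x - y) + rnorm (y - z).
Proof. by rewrite (le_trans _ (rnormD _ _))// addrA subrK. Qed.

Lemma rnorm_sub x y : rnorm x - rnorm y <= rnorm (x - y).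
Proof. by rewrite lerBlDr -{1}(subrK y x) rnormD. Qed.

End RealNorm.

Section RealNormScalars.
Context (R : realType).
Implicit Types z w : R[i].

Lemma rnormM_C z w : rnorm (z * w) = rnorm z * rnorm w.
Proof. by apply: complexI; rewrite rmorphM /= !rnormE normrM. Qed.

Lemma rnormC (t : R) : rnorm (t%:C)%C = `|t|.
Proof. by apply: complexI; rewrite rnormE normc_def /= expr0n /= addr0 sqrtr_sqr. Qed.

Lemma rnorm1 : rnorm (1 : R[i]) = 1.
Proof. by rewrite /rnorm normr1. Qed.

Lemma rnorm_conj z : rnorm z^* = rnorm z.
Proof. by rewrite /rnorm norm_conjC. Qed.

Lemma Re_le_rnorm z : complex.Re z <= rnorm z.
Proof.
by rewrite -lecR rnormE (le_trans _ (normc_ge_Re z))// lecR ler_norm.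
Qed.

Lemma ge0_rnorm z : 0 <= z -> z = (rnorm z)%:C%C.
Proof. by move=> z0; rewrite rnormE ger0_norm. Qed.

Lemma rnormZ (V : normedModType R[i]) z (x : V) :
  rnorm (z *: x) = rnorm z * rnorm x.
Proof. by apply: complexI; rewrite rmorphM /= !rnormE normrZ. Qed.

Lemma rnormZC (V : normedModType R[i]) (t : R) (x : V) :
  rnorm (t%:C%C *: x) = `|t| * rnorm x.
Proof. by rewrite rnormZ rnormC. Qed.

Lemma half_add (V : lmodType R[i]) (x : V) : (2^-1)%:C%C *: (x + x) = x.
Proof.
rewrite -{1}[x]scale1r -{2}[x]scale1r -scalerDl scalerA.
have -> : (2^-1)%:C%C * (1 + 1) = 1 :> R[i]; last by rewrite scale1r.
by rewrite -(rmorph1 (real_complex R)) -rmorphD -rmorphM /= mulVf ?pnatr_eq0.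
Qed.

Lemma unimodular (z : R[i]) : exists2 w : R[i], rnorm w = 1 & w * z = (rnorm z)%:C%C.
Proof.
have [z0|z0] := eqVneq (rnorm z) 0.
  by exists 1; rewrite ?rnorm1// mul1r (rnorm_eq0 z0) rnorm0.
have {}z0 : 0 < rnorm z by rewrite lt_def z0 rnorm_ge0.
exists (z^* * ((rnorm z)^-1)%:C%C).
  by rewrite rnormM_C rnorm_conj rnormC ger0_norm ?invr_ge0 ?rnorm_ge0// mulfV ?gt_eqF.
rewrite mulrAC (mulrC _^*) -normCK -rnormE -rmorphXn -rmorphM /=.
by rewrite expr2 mulfK ?gt_eqF.
Qed.

(** Positive elements of [R[i]] are real, so a radius in [R[i]] is the embedding of its real
    part. *)
Lemma nbhs_rnormP (V : normedModType R[i]) (x : V) (W : set V) : nbhs x W ->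
  exists2 e : R, 0 < e & forall y, rnorm (x - y) < e -> W y.
Proof.
move=> /nbhs_ballP[e /= e0 eW].
have eE : e = (complex.Re e)%:C%C by rewrite RRe_real ?gtr0_real.
exists (complex.Re e); first by move: e0; rewrite ltcE /= => /andP[].
by move=> y xy; apply: eW; rewrite -ball_normE /ball_ /= -rnormE eE ltcR.
Qed.

Lemma nbhs_rnorm (V : normedModType R[i]) (x : V) (e : R) : 0 < e ->
  nbhs x [set y | rnorm (y - x) < e].
Proof.
move=> e0; apply/nbhs_ballP; exists e%:C%C; first by rewrite /= ltcR.
by move=> y; rewrite -ball_normE /ball_ /= -rnormE ltcR rdistC.
Qed.

Lemma dense_near (V : normedModType R[i]) (S : set V) a (e : R) : dense S -> 0 < e ->
  exists2 s, S s & rnorm (a - s) <= e.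
Proof.
move=> Sd e0; have [|s [/interior_subset ae Ss]] := Sd _ _ (@open_interior _ [set y | rnorm (y - a) < e]).
  by exists a; exact: nbhs_rnorm.
by exists s => //; rewrite rdistC ltW.
Qed.

Lemma near_dense (V : normedModType R[i]) (S : set V) :
  (forall a (e : R), 0 < e -> exists2 s, S s & rnorm (a - s) <= e) -> dense S.
Proof.
move=> H O [x Ox] Oo; have [e e0 eO] := nbhs_rnormP (open_nbhs_nbhs (conj Oo Ox)).
have [s Ss xs] := H x _ (divr_gt0 e0 (ltr0Sn R 1)).
by exists s; split => //; apply: eO; rewrite (le_lt_trans xs)//; lra.
Qed.

Lemma closed_rnorm (V : normedModType R[i]) (S : set V) : closed S <->
  forall x, (forall e : R, 0 < e -> exists2 s, S s & rnorm (x - s) <= e) -> S x.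
Proof.
split=> [Sc x H|H x xS].
  apply: Sc => W /nbhs_rnormP[e e0 eW]; have [s Ss xs] := H _ (divr_gt0 e0 (ltr0Sn R 1)).
  by exists s; split => //; apply: eW; rewrite (le_lt_trans xs)//; lra.
apply: H => e e0; have [s [Ss xs]] := xS _ (nbhs_rnorm x e0).
by exists s => //; rewrite rdistC ltW.
Qed.

Lemma rnorm_complete (V : completeNormedModType R[i]) (u : nat -> V) :
  (forall e : R, 0 < e -> exists N, forall m n, (N <= m)%N -> (N <= n)%N ->
     rnorm (u m - u n) <= e) ->
  exists l, forall e : R, 0 < e -> exists N, forall n, (N <= n)%N ->
     rnorm (u n - l) <= e.
Proof.
move=> uC; have : cauchy (u @ \oo).
  apply/cauchyP => e e0.
  have re0 : 0 < complex.Re e.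
    by move: e0; rewrite ltcE /= => /andP[].
  have eE : e = (complex.Re e)%:C%C by rewrite RRe_real ?gtr0_real//.
  have [N uN] := uC (complex.Re e / 2) (divr_gt0 re0 (ltr0Sn _ 1)).
  exists (u N); exists N => // n /= Nn; rewrite -ball_normE /ball_ /=.
  rewrite -rnormE eE ltcR (le_lt_trans (uN _ _ (leqnn N) Nn)) //; lra.
move=> /cauchy_cvg /cvg_ex[l ul]; exists l => e e0.
move/cvgrPdist_le : ul => /(_ e%:C%C); rewrite ltcR => /(_ e0)[N _ uN].
by exists N => n Nn; rewrite rdistC rnorm_le; exact: uN.
Qed.

Lemma real_complete (u : nat -> R) :
  (forall e : R, 0 < e -> exists N, forall m n, (N <= m)%N -> (N <= n)%N ->
     `|u m - u n| <= e) ->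
  exists l, forall e : R, 0 < e -> exists N, forall n, (N <= n)%N ->
     `|u n - l| <= e.
Proof.
move=> uC; have : cauchy (u @ \oo).
  apply/cauchyP => e e0.
  have [N uN] := uC (e / 2) (divr_gt0 e0 (ltr0Sn _ 1)).
  exists (u N); exists N => // n /= Nn; rewrite -ball_normE /ball_ /=.
  by rewrite (le_lt_trans (uN _ _ (leqnn N) Nn)) //; lra.
move=> /cauchy_cvg /cvg_ex[l ul]; exists l => e e0.
move/cvgrPdist_le : ul => /(_ e e0)[N _ uN].
by exists N => n Nn; rewrite distrC; exact: uN.
Qed.

Lemma Im_le_rnorm z : `|complex.Im z| <= rnorm z.
Proof.
rewrite -lecR rnormE normc_def lecR -sqrtr_sqr ler_sqrt ?lerDr ?sqr_ge0//.
by rewrite addr_ge0 ?sqr_ge0.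
Qed.

Lemma absRe_le_rnorm z : `|complex.Re z| <= rnorm z.
Proof. by rewrite -lecR rnormE normc_ge_Re. Qed.

Lemma rnorm_le_ReIm z : rnorm z <= `|complex.Re z| + `|complex.Im z|.
Proof.
rewrite {1}[z]complexE (le_trans (rnormD _ _))// rnormM_C !rnormC lerD2l.
have -> : rnorm ('i%C : R[i]) = 1; last by rewrite mul1r.
by rewrite /rnorm normc_def /= expr0n expr1n add0r sqrtr1.
Qed.

Lemma rnorm_complete_C (u : nat -> R[i]) :
  (forall e : R, 0 < e -> exists N, forall m n, (N <= m)%N -> (N <= n)%N ->
     rnorm (u m - u n) <= e) ->
  exists l, forall e : R, 0 < e -> exists N, forall n, (N <= n)%N ->
     rnorm (u n - l) <= e.
Proof.
move=> uC.
have [|a ua] := @real_complete (fun n => complex.Re (u n)).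
  move=> e /uC[N uN]; exists N => m n Nm Nn; rewrite -raddfB.
  exact: le_trans (absRe_le_rnorm _) (uN _ _ Nm Nn).
have [|b ub] := @real_complete (fun n => complex.Im (u n)).
  move=> e /uC[N uN]; exists N => m n Nm Nn; rewrite -raddfB.
  exact: le_trans (Im_le_rnorm _) (uN _ _ Nm Nn).
exists (a +i* b)%C => e e0.
have [N1 uN1] := ua _ (divr_gt0 e0 (ltr0Sn _ 1)).
have [N2 uN2] := ub _ (divr_gt0 e0 (ltr0Sn _ 1)).
exists (maxn N1 N2) => n; rewrite geq_max => /andP[n1 n2].
rewrite (le_trans (rnorm_le_ReIm _))// [leRHS]splitr lerD//.
- by case: (u n) (uN1 _ n1).
- by case: (u n) (uN2 _ n2).
Qed.

End RealNormScalars.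

Section CStarBasics.
Context (R : realType) (A : cstarAlgebra R).
Implicit Types a b c : A.

Lemma cmul0r a : 0 ** a = 0 :> A.
Proof. by have := cmulZl 0 0 a; rewrite !scale0r. Qed.

Lemma cmulr0 a : a ** 0 = 0 :> A.
Proof. by have := cmulZr 0 a 0; rewrite !scale0r. Qed.

Lemma cmulNr a b : (- a) ** b = - (a ** b).
Proof. by rewrite -scaleN1r cmulZl scaleN1r. Qed.

Lemma cmulrN a b : a ** (- b) = - (a ** b).
Proof. by rewrite -scaleN1r cmulZr scaleN1r. Qed.

Lemma cmulBl a b c : (a - b) ** c = a ** c - b ** c.
Proof. by rewrite cmulDl cmulNr. Qed.

Lemma cmulBr a b c : c ** (a - b) = c ** a - c ** b.
Proof. by rewrite cmulDr cmulrN. Qed.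

Lemma starDE a b : star (a + b) = star a + star b. Proof. exact: starD. Qed.
Lemma starKE a : star (star a) = a. Proof. exact: starK. Qed.

Lemma star0 : star 0 = 0 :> A.
Proof. by have := starZ 0 (0 : A); rewrite rmorph0 !scale0r. Qed.

Lemma starN a : star (- a) = - star a.
Proof. by rewrite -scaleN1r starZ rmorphN rmorph1 scaleN1r. Qed.

Lemma starB a b : star (a - b) = star a - star b.
Proof. by rewrite starDE starN. Qed.

Lemma conj_real (t : R) : (t%:C%C : R[i])^* = t%:C%C.
Proof. exact: conjc_real. Qed.

Lemma starZC (t : R) a : star (t%:C%C *: a) = t%:C%C *: star a.
Proof. by rewrite starZ conj_real. Qed.

Lemma rcmul a b : rnorm (a ** b) <= rnorm a * rnorm b.
Proof. by rewrite rnorm_le rmorphM /= !rnormE cmul_norm. Qed.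

Lemma rcstar a : rnorm (star a ** a) = rnorm a ^+ 2.
Proof. by apply: complexI; rewrite rmorphXn /= !rnormE cstar_norm. Qed.

Lemma rnorm_star a : rnorm (star a) = rnorm a.
Proof.
have H (x : A) : rnorm x <= rnorm (star x).
  have [->|x0] := eqVneq (rnorm x) 0; first exact: rnorm_ge0.
  have x1 : 0 < rnorm x by rewrite lt_def x0 rnorm_ge0.
  by have := rcmul (star x) x; rewrite rcstar expr2 ler_pM2r.
by apply/eqP; rewrite eq_le H andbT -{2}(starKE a) H.
Qed.

Lemma rnorm_sa_sq a : star a = a -> rnorm (a ** a) = rnorm a ^+ 2.
Proof. by move=> {1}<-; exact: rcstar. Qed.

Lemma rnorm_cmul3 a b c : rnorm (a ** b ** c) <= rnorm a * rnorm b * rnorm c.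
Proof.
rewrite (le_trans (rcmul _ _))// ler_wpM2r ?rnorm_ge0//; exact: rcmul.
Qed.

End CStarBasics.

(* The unit is adjoined even to a unital algebra: A is then still an ideal, but the
   action on A alone is no longer faithful. *)
Definition unitization (R : realType) (A : cstarAlgebra R) : Type :=
  (A * R[i])%type.

HB.instance Definition _ (R : realType) (A : cstarAlgebra R) :=
  GRing.Lmodule.copy (unitization A) (A * R[i]^o)%type.

Section Unitization.
Context (R : realType) (A : cstarAlgebra R).
Local Notation U := (unitization A).
Implicit Types (x y z : U) (a b c : A) (r s : R).

Definition uone : U := (0, 1).
Definition umul x y : U :=
  (x.1 ** y.1 + x.2 *: y.1 + y.2 *: x.1, x.2 * y.2).

Lemma umulA : associative umul.
Proof.
move=> [x k] [y l] [z m]; congr pair => /=; last by rewrite mulrA.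
rewrite !(cmulDl, cmulDr, cmulZl, cmulZr, scalerDr, cmulA, scalerA).
rewrite (mulrC m k) (mulrC m l) !addrA.
by rewrite [LHS](ACl (1*4*2*5*3*6*7))/=.
Qed.

Lemma umul1x : left_id uone umul.
Proof.
by move=> [x k]; rewrite /umul /= cmul0r scale1r scaler0 addr0 add0r mul1r.
Qed.

Lemma umulx1 : right_id uone umul.
Proof.
by move=> [x k]; rewrite /umul /= cmulr0 scale1r scaler0 !add0r mulr1.
Qed.

Lemma umulDl : left_distributive umul +%R.
Proof.
move=> [x k] [y l] [z m]; congr pair => /=; last by rewrite mulrDl.
by rewrite cmulDl scalerDl scalerDr [RHS]addrACA; congr (_ + _); rewrite addrACA.
Qed.

Lemma umulDr : right_distributive umul +%R.
Proof.
move=> [x k] [y l] [z m]; congr pair => /=; last by rewrite mulrDr.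
by rewrite cmulDr scalerDl scalerDr [RHS]addrACA; congr (_ + _); rewrite addrACA.
Qed.

Lemma uone_neq0 : uone != 0 :> U.
Proof. by apply/eqP => /(congr1 snd) /= /eqP; rewrite oner_eq0. Qed.

HB.instance Definition _ := GRing.Zmodule_isNzRing.Build U
  umulA umul1x umulx1 umulDl umulDr uone_neq0.

Lemma uscaleAl (k : R[i]) x y : k *: (x * y) = (k *: x) * y.
Proof.
congr pair => /=; last exact: mulrA.
by rewrite !scalerDr cmulZl !scalerA (mulrC k y.2).
Qed.

HB.instance Definition _ := GRing.Lmodule_isLalgebra.Build R[i] U uscaleAl.

Lemma uscaleAr (k : R[i]) x y : k *: (x * y) = x * (k *: y).
Proof.
congr pair => /=; last exact: mulrCA.
by rewrite !scalerDr cmulZr !scalerA (mulrC k x.2).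
Qed.

HB.instance Definition _ := GRing.Lalgebra_isAlgebra.Build R[i] U uscaleAr.

Definition uinj a : U := (a, 0).
Definition ustar x : U := (star x.1, x.2^*).
Definition act x b : A := x.1 ** b + x.2 *: b.

Lemma uinjD a b : uinj (a + b) = uinj a + uinj b.
Proof. by congr pair => /=; rewrite addr0. Qed.

Lemma uinjZ k a : uinj (k *: a) = k *: uinj a.
Proof. by congr pair; rewrite /= scaler0. Qed.

Lemma uinjB a b : uinj (a - b) = uinj a - uinj b.
Proof. by congr pair => /=; rewrite subr0. Qed.

Lemma uinjM a b : uinj (a ** b) = uinj a * uinj b.
Proof. by congr pair => /=; rewrite ?mulr0// !scale0r !addr0. Qed.

Lemma ustar_inj a : ustar (uinj a) = uinj (star a).
Proof. by congr pair => /=; rewrite rmorph0. Qed.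

Lemma ustarK x : ustar (ustar x) = x.
Proof. by case: x => a k; rewrite /ustar /= starKE conjCK. Qed.

Lemma ustarD x y : ustar (x + y) = ustar x + ustar y.
Proof. by congr pair => /=; rewrite ?starDE ?rmorphD. Qed.

Lemma ustarN x : ustar (- x) = - ustar x.
Proof. by congr pair => /=; rewrite ?starN ?rmorphN. Qed.

Lemma ustarB x y : ustar (x - y) = ustar x - ustar y.
Proof. by rewrite ustarD ustarN. Qed.

Lemma ustarZ (k : R[i]) x : ustar (k *: x) = k^* *: ustar x.
Proof. by congr pair => /=; rewrite ?starZ ?rmorphM. Qed.

Lemma ustarZC r x : ustar (r%:C%C *: x) = r%:C%C *: ustar x.
Proof. by rewrite ustarZ conj_real. Qed.

Lemma ustar1 : ustar 1 = 1.
Proof. by congr pair => /=; rewrite ?star0 ?rmorph1. Qed.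

Lemma ustarM x y : ustar (x * y) = ustar y * ustar x.
Proof.
congr pair => /=; last by rewrite rmorphM mulrC.
by rewrite !starDE starM !starZ -!addrA; congr (_ + _); rewrite addrC.
Qed.

Lemma actM x y b : act (x * y) b = act x (act y b).
Proof.
rewrite /act /= cmulDr !cmulDl cmulZr !cmulZl cmulA scalerDr scalerA.
by rewrite -!addrA; congr (_ + _); rewrite [RHS]addrCA.
Qed.

Lemma actD x y b : act (x + y) b = act x b + act y b.
Proof. by rewrite /act /= cmulDl scalerDl addrACA. Qed.

Lemma actN x b : act (- x) b = - act x b.
Proof. by rewrite /act /= cmulNr scaleNr opprD. Qed.

Lemma actZ (k : R[i]) x b : act (k *: x) b = k *: act x b.
Proof. by rewrite /act /= cmulZl scalerDr scalerA. Qed.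

Lemma act1 b : act 1 b = b.
Proof. by rewrite /act /= cmul0r add0r scale1r. Qed.

Lemma act_star x b c : star (act x b) ** c = star b ** act (ustar x) c.
Proof.
by rewrite /act /= starDE starM starZ cmulDl cmulDr cmulZl cmulZr !cmulA.
Qed.

(* The norm of x is at most r, for the maximum of the operator norm on A and the
   modulus of the scalar part. *)
Definition ule x r : Prop := [/\ 0 <= r, rnorm x.2 <= r &
  forall b, rnorm (act x b) <= r * rnorm b].

Lemma ule_ge0 x r : ule x r -> 0 <= r. Proof. by case. Qed.

Lemma ule_le x r s : ule x r -> r <= s -> ule x s.
Proof.
move=> [r0 xr xb] rs; split; [exact: le_trans rs|exact: le_trans rs|].
by move=> b; rewrite (le_trans (xb b))// ler_wpM2r ?rnorm_ge0.
Qed.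

Lemma uleD x y r s : ule x r -> ule y s -> ule (x + y) (r + s).
Proof.
move=> [r0 xr xb] [s0 ys yb]; split; first exact: addr_ge0.
- by rewrite (le_trans (rnormD _ _))// lerD.
- by move=> b; rewrite actD (le_trans (rnormD _ _))// mulrDl lerD.
Qed.

Lemma uleZ x r (k : R[i]) : ule x r -> ule (k *: x) (rnorm k * r).
Proof.
move=> [r0 xr xb]; split; first by rewrite mulr_ge0 ?rnorm_ge0.
- by rewrite rnormM_C ler_wpM2l ?rnorm_ge0.
- by move=> b; rewrite actZ rnormZ -mulrA ler_wpM2l ?rnorm_ge0.
Qed.

Lemma uleZC x r s : ule x r -> ule (s%:C%C *: x) (`|s| * r).
Proof. by move=> /uleZ - /(_ s%:C%C); rewrite rnormC. Qed.

Lemma uleN x r : ule x r -> ule (- x) r.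
Proof.
move=> [r0 xr xb]; split => //; first by rewrite rnormN.
by move=> b; rewrite actN rnormN.
Qed.

Lemma uleB x y r s : ule x r -> ule y s -> ule (x - y) (r + s).
Proof. by move=> xr /uleN; exact: uleD. Qed.

Lemma uleM x y r s : ule x r -> ule y s -> ule (x * y) (r * s).
Proof.
move=> [r0 xr xb] [s0 ys yb]; split; first exact: mulr_ge0.
- by rewrite rnormM_C ler_pM ?rnorm_ge0.
- move=> b; rewrite actM (le_trans (xb _))// -mulrA ler_wpM2l//.
Qed.

Lemma ule1 : ule 1 1.
Proof.
by split => //; [rewrite rnorm1|move=> b; rewrite act1 mul1r].
Qed.

(** The square of the norm of [act x b] is the norm of [star b ** act (ustar x * x) b], so the
    C*-identity of [A] passes to operator bounds. *)
Lemma ule_cstar x r : 0 <= r -> ule (ustar x * x) (r ^+ 2) -> ule x r.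
Proof.
move=> r0 [_ /= xr xb]; split => //.
- by rewrite -(ler_pXn2r (ltn0Sn 1)) ?nnegrE ?rnorm_ge0// (le_trans _ xr)//
    rnormM_C rnorm_conj.
- move=> b.
  have rb0 : 0 <= r * rnorm b by rewrite mulr_ge0 ?rnorm_ge0.
  rewrite -(ler_pXn2r (ltn0Sn 1)) ?nnegrE ?rnorm_ge0//.
  rewrite -rcstar act_star -actM (le_trans (rcmul _ _))// rnorm_star exprMn.
  by rewrite expr2 mulrA mulrC ler_wpM2r ?rnorm_ge0 // mulrC -mulrA.
Qed.

(** The square of the norm of [act (ustar x) b] is the norm of [star b ** act x (act (ustar x) b)];
    one factor cancels. *)
Lemma ule_star x r : ule x r -> ule (ustar x) r.
Proof.
move=> [r0 xr xb]; split => //=; first by rewrite rnorm_conj.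
move=> b; have [->|xb0] := eqVneq (rnorm (act (ustar x) b)) 0.
  by rewrite mulr_ge0 ?rnorm_ge0.
have {}xb0 : 0 < rnorm (act (ustar x) b) by rewrite lt_def xb0 rnorm_ge0.
rewrite -(ler_pM2r xb0) -expr2 -rcstar act_star ustarK.
rewrite (le_trans (rcmul _ _))// rnorm_star mulrAC mulrC ler_wpM2r ?rnorm_ge0//.
Qed.

Lemma ule_inj a r : 0 <= r -> rnorm a <= r -> ule (uinj a) r.
Proof.
move=> r0 ar; split => //=; first by rewrite rnorm0.
move=> b; rewrite /act /= scale0r addr0 (le_trans (rcmul _ _))//.
by rewrite ler_wpM2r ?rnorm_ge0.
Qed.

(** Acting on [star x.1] yields [x.1 ** star x.1] up to the scalar part, which accounts for the
    second [r]. Sequences that are Cauchy for [ule] are thereby Cauchy in each component. *)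
Lemma ule_rnorm1 x r : ule x r -> rnorm x.1 <= 2 * r.
Proof.
move=> [r0 xr xb]; set a := x.1.
have [->|a0] := eqVneq (rnorm a) 0; first by rewrite mulr_ge0.
have {}a0 : 0 < rnorm (star a) by rewrite rnorm_star lt_def a0 rnorm_ge0.
rewrite -(ler_pM2r a0) -[in leLHS](rnorm_star a) -expr2 -rcstar starKE.
have -> : a ** star a = act x (star a) - x.2 *: star a.
  by rewrite /act addrK.
rewrite (le_trans (rnormB _ _))// -mulrA mulr2n mulrDl mul1r lerD//.
by rewrite rnormZ ler_wpM2r ?rnorm_ge0.
Qed.

(** Tested on [star a]: the embedding of [A] is isometric for the operator bound. *)
Lemma inj_ule a r : ule (uinj a) r -> rnorm a <= r.
Proof.
move=> [r0 _ xb].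
have [->//|a0] := eqVneq (rnorm a) 0.
have {}a0 : 0 < rnorm (star a) by rewrite rnorm_star lt_def a0 rnorm_ge0.
rewrite -(ler_pM2r a0) -[in leLHS](rnorm_star a) -expr2 -rcstar starKE.
by have := xb (star a); rewrite /act /= scale0r addr0.
Qed.

Lemma ule_eq0 x : (forall r, 0 < r -> ule x r) -> x = 0.
Proof.
move=> xr; have x1 : rnorm x.1 = 0.
  apply/eqP; rewrite eq_le rnorm_ge0 andbT; apply/ler_addgt0Pl => e e0.
  rewrite addr0; have := ule_rnorm1 (xr (e / 2) (divr_gt0 e0 (ltr0Sn _ 1))).
  by rewrite mulrC divfK.
have x2 : rnorm x.2 = 0.
  apply/eqP; rewrite eq_le rnorm_ge0 andbT; apply/ler_addgt0Pl => e e0.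
  by rewrite addr0; case: (xr e e0).
by case: x x1 x2 {xr} => a k /= /rnorm_eq0 -> /rnorm_eq0 ->.
Qed.

Lemma ule_closed x r : 0 <= r ->
  (forall e, 0 < e -> exists y, ule y r /\ ule (x - y) e) -> ule x r.
Proof.
move=> r0 H; suff K e : 0 < e -> ule x (r + e).
  split => //.
  - by apply/ler_addgt0Pr => e e0; case: (K e e0).
  - move=> b; apply/ler_addgt0Pr => e e0.
    have b1 : 0 < rnorm b + 1 by rewrite ltr_wpDl ?rnorm_ge0.
    have [_ _ /(_ b)] := K _ (divr_gt0 e0 b1).
    move/le_trans; apply; rewrite mulrDl lerD2l mulrAC ler_pdivrMr//.
    by rewrite ler_wpM2l ?(ltW e0)// lerDl.
move=> e0; have [y [yr xy]] := H e e0.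
by have := uleD yr xy; rewrite addrC subrK.
Qed.

End Unitization.

(** * Square roots in the unitization *)

Section Positivity.
Context (R : realType) (A : cstarAlgebra R).
Local Notation U := (unitization A).
Implicit Types (x y z : U) (a b c : A) (r s : R).

Lemma ustar0 : ustar 0 = 0 :> U.
Proof. by congr pair => /=; rewrite ?star0 ?rmorph0. Qed.

Lemma ule_ex x : exists2 r, 0 < r & ule x r.
Proof.
exists (rnorm x.1 + rnorm x.2 + 1).
  by rewrite ltr_wpDl// addr_ge0 ?rnorm_ge0.
split; first by rewrite !addr_ge0 ?rnorm_ge0.
  by rewrite -addrA addrCA lerDl addr_ge0 ?rnorm_ge0.
move=> b; rewrite (le_trans (rnormD _ _))// mulrDl mulrDl ler_wpDr ?mulr_ge0 ?rnorm_ge0//.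
by rewrite lerD// ?rcmul// rnormZ.
Qed.

(** [f] is an explicit rate of convergence, which the limit inherits. *)
Lemma ucomplete (u : nat -> U) (f : nat -> R) :
  (forall e, 0 < e -> exists N, forall n, (N <= n)%N -> f n <= e) ->
  (forall n m, (n <= m)%N -> ule (u m - u n) (f n)) ->
  exists l, forall n, ule (u n - l) (f n).
Proof.
move=> f0 uf.
have fC e : 0 < e -> exists N, forall m n, (N <= m)%N -> (N <= n)%N ->
    ule (u m - u n) e.
  move=> /f0[N Ne]; exists N => m n Nm Nn.
  case/orP: (leq_total n m) => mn; first exact: ule_le (uf _ _ mn) (Ne _ Nn).
  by rewrite -opprB; apply: uleN; apply: ule_le (uf _ _ mn) (Ne _ Nm).
have [|l1 ul1] := @rnorm_complete R A (fun n => (u n).1).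
  move=> e e0; have [N Ne] := fC _ (divr_gt0 e0 (ltr0Sn _ 1)).
  exists N => m n Nm Nn; have := ule_rnorm1 (Ne m n Nm Nn).
  by rewrite mulrC divfK.
have [|l2 ul2] := @rnorm_complete_C R (fun n => (u n).2).
  move=> e e0; have [N Ne] := fC _ e0.
  by exists N => m n Nm Nn; case: (Ne m n Nm Nn).
exists (l1, l2) => n; apply: ule_closed; first exact: ule_ge0 (uf n n (leqnn n)).
move=> e e0; have e20 := divr_gt0 e0 (ltr0Sn R 1).
have [N1 uN1] := ul1 _ e20; have [N2 uN2] := ul2 _ e20.
pose m := maxn n (maxn N1 N2).
have nm : (n <= m)%N by rewrite leq_max leqnn.
exists (u n - u m); split.
  by rewrite -opprB; apply: uleN; exact: uf.
have -> : u n - (l1, l2) - (u n - u m) = u m - (l1, l2).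
  by rewrite opprB addrC addrA subrK.
have m1 : (N1 <= m)%N by rewrite !leq_max leqnn orbT.
have m2 : (N2 <= m)%N by rewrite !leq_max leqnn !orbT.
split; first exact: ltW.
  by rewrite (le_trans (uN2 _ m2))//; lra.
move=> b; rewrite (le_trans (rnormD _ _))// [in leRHS](splitr e) mulrDl lerD//.
  by rewrite (le_trans (rcmul _ _))// ler_wpM2r ?rnorm_ge0// uN1.
by rewrite rnormZ ler_wpM2r ?rnorm_ge0// uN2.
Qed.

Lemma commrZ x y (k : R[i]) : GRing.comm x y -> GRing.comm x (k *: y).
Proof. by rewrite /GRing.comm => xy; rewrite -scalerAr xy scalerAl. Qed.

(* A fixed point s of s |-> (x + s ^ 2) / 2 satisfies (1 - s) ^ 2 = 1 - x.  The
   iteration is dominated by the same one at 1 in R. *)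
Fixpoint sqrt_iter x n : U :=
  if n is m.+1 then (2^-1)%:C%C *: (x + sqrt_iter x m * sqrt_iter x m) else 0.

Fixpoint sqrt_iterR n : R :=
  if n is m.+1 then (1 + sqrt_iterR m ^+ 2) / 2 else 0.

(** With [d = 1 - s] the step is [d - d^2 / 2], increasing on [0, 1]. At [d = 2 / k] it equals
    [2 (k - 1) / k^2 <= 2 / (k + 1)], so the rate survives the induction. *)
Lemma sqrt_iterR_bound n : 0 <= sqrt_iterR n <= 1 /\ 1 - sqrt_iterR n <= 2 / n.+2%:R.
Proof.
elim: n => [|n [/andP[s0 s1] IH]] /=; first by rewrite lexx ler01 subr0 divff.
move: (sqrt_iterR n) s0 s1 IH => s s0 s1 IH; split; first by apply/andP; split; nra.
have n2 : 0 < n.+2%:R :> R by [].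
have n3 : 0 < n.+3%:R :> R by [].
have E : n.+3%:R = n.+2%:R + 1 :> R by rewrite -natr1.
move: IH; rewrite !ler_pdivlMr// E; move: (n.+2%:R : R) n2 => k k0 {n3 E}.
move=> H; have k1 : (1 - s) * k <= 2 by [].
set d := 1 - s in H k1.
have -> : 1 - (1 + s ^+ 2) / 2 = d - d ^+ 2 / 2 by rewrite /d; field.
have d0 : 0 <= d by rewrite /d subr_ge0.
have d1 : d <= 1 by rewrite /d; lra.
nra.
Qed.

Lemma sqrt_iter_comm x y n : GRing.comm y x -> GRing.comm y (sqrt_iter x n).
Proof.
move=> yx; elim: n => [|n IH] /=; first exact: commr0.
by apply: commrZ; apply: commrD => //; exact: commrM.
Qed.

(** The iterates commute, so an increment is half the product of the previous increment and the sum
    of the same two iterates. The identity also holds in [R], and [ule] bounds add and multiply. *)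
Lemma sqrt_iter_step x n : ule x 1 ->
  ule (sqrt_iter x n) (sqrt_iterR n) /\
  ule (sqrt_iter x n.+1 - sqrt_iter x n) (sqrt_iterR n.+1 - sqrt_iterR n).
Proof.
move=> x1; have h0 : `|2^-1| = 2^-1 :> R by rewrite ger0_norm ?invr_ge0.
elim: n => [|n [IH1 IH2]].
  split; first by split=> //=; [rewrite rnorm0|move=> b; rewrite /act /= cmul0r scale0r addr0 rnorm0 mul0r].
  rewrite /= mulr0 expr0n /= !addr0 !subr0 mulrC.
  by have := uleZC 2^-1 x1; rewrite h0.
have IH3 : ule (sqrt_iter x n.+1) (sqrt_iterR n.+1).
  have := uleZC 2^-1 (uleD x1 (uleM IH1 IH1)).
  by rewrite h0 /= mulrC expr2.
split => //.
have -> : sqrt_iter x n.+2 - sqrt_iter x n.+1 =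
  (2^-1)%:C%C *: ((sqrt_iter x n.+1 - sqrt_iter x n) *
                  (sqrt_iter x n.+1 + sqrt_iter x n)).
  rewrite [sqrt_iter x n.+2]/= {2}[sqrt_iter x n.+1]/= -scalerBr; congr (_ *: _).
  rewrite opprD addrACA subrr add0r mulrBl !mulrDr.
  have -> : sqrt_iter x n.+1 * sqrt_iter x n = sqrt_iter x n * sqrt_iter x n.+1.
    by apply: sqrt_iter_comm; apply/commr_sym; exact: sqrt_iter_comm.
  by rewrite opprD addrA addrK.
have -> : sqrt_iterR n.+2 - sqrt_iterR n.+1 =
   2^-1 * ((sqrt_iterR n.+1 - sqrt_iterR n) * (sqrt_iterR n.+1 + sqrt_iterR n)).
  have S k : sqrt_iterR k.+1 = (1 + sqrt_iterR k ^+ 2) / 2 by [].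
  rewrite (S n.+1) {2}(S n).
  by move: (sqrt_iterR n.+1) (sqrt_iterR n) => u v; field.
by have := uleZC 2^-1 (uleM IH2 (uleD IH3 IH1)); rewrite h0.
Qed.

Lemma sqrt_iter_dist x n m : ule x 1 -> (n <= m)%N ->
  ule (sqrt_iter x m - sqrt_iter x n) (sqrt_iterR m - sqrt_iterR n).
Proof.
move=> x1; elim: m => [|m IH]; first by rewrite leqn0 => /eqP ->; rewrite !subrr; exact: (sqrt_iter_step 0 x1).1.
rewrite leq_eqVlt => /predU1P[->|].
  by rewrite !subrr; exact: (sqrt_iter_step 0 x1).1.
rewrite ltnS => /IH nm; have [_ /(uleD nm)] := sqrt_iter_step m x1.
by rewrite [X in ule X]addrC [X in ule _ X]addrC !subrKA.
Qed.

Lemma invn_small (c e : R) : 0 < e -> exists N, forall n, (N <= n)%N ->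
  c / n.+1%:R <= e.
Proof.
move=> e0; exists (Num.truncn (c / e)) => n Nn; rewrite ler_pdivrMr// mulrC -ler_pdivrMr//.
apply: ltW; apply: lt_le_trans (truncnS_gt _) _; rewrite ler_nat ltnS//.
Qed.

(** [g] is [1 - s] for the limit [s] of the iteration. Commutation with everything that commutes
    with [x] passes to the limit and later plays the part of functional calculus. *)
Lemma usqrt x : ustar x = x -> ule x 1 -> exists g : U,
  [/\ ustar g = g, ule (1 - g) 1, g * g = 1 - x &
      forall y, GRing.comm y x -> GRing.comm y g].
Proof.
move=> xsa x1.
have bnd n : sqrt_iterR n <= 1 /\ 1 - sqrt_iterR n <= 2 / n.+1%:R.
  have [/andP[_ ?] H] := sqrt_iterR_bound n; split=> //.
  by rewrite (le_trans H)// ler_pM2l// lef_pV2 ?posrE// ler_nat.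
have [||s sP] := @ucomplete (sqrt_iter x) (fun n => 2 / n.+1%:R).
- exact: invn_small.
- move=> n m nm; apply: ule_le (sqrt_iter_dist x1 nm) _.
  by have [m1 _] := bnd m; have [_ /(le_trans _)] := bnd n; apply; rewrite lerD2r.
have s1 : ule s 1.
  apply: ule_closed => // e e0; have [N Ne] := invn_small 2 e0.
  exists (sqrt_iter x N); split.
    by apply: ule_le (sqrt_iter_step N x1).1 _; have [] := bnd N.
  rewrite -opprB; apply: uleN; apply: ule_le (sP N) _; exact: Ne.
have itle n : ule (sqrt_iter x n) 1.
  by apply: ule_le (sqrt_iter_step n x1).1 _; have [] := bnd n.
exists (1 - s); split.
- rewrite ustarB ustar1; congr (1 - _).
  apply/eqP; rewrite -subr_eq0; apply/eqP; apply: ule_eq0 => e e0.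
  have [N Ne] := invn_small 4 e0.
  have Sn n : ustar (sqrt_iter x n) = sqrt_iter x n.
    elim: n => [|n IH] /=; first exact: ustar0.
    by rewrite ustarZC ustarD ustarM IH xsa.
  have H := uleB (ule_star (sP N)) (sP N).
  move: H; rewrite ustarB Sn opprB [X in ule X]addrC subrKA -mulrDl => H.
  rewrite -opprB; apply: uleN; apply: ule_le H _.
  apply: le_trans (Ne N (leqnn N)); rewrite ler_pM2r ?invr_gt0//; lra.
- by rewrite subKr.
- rewrite mulrBr mulr1 mulrBl mul1r; suff <- : s + s - s * s = x.
    by rewrite !opprB opprD !addrA [LHS](ACl (1*3*2*4)).
  apply/eqP; rewrite -subr_eq0; apply/eqP; apply: ule_eq0 => e e0.
  have [N Ne] := invn_small 8 e0.
  have sN1 := sP N.+1; have sN := sP N.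
  (* The recursion eliminates [x] and leaves the errors of two consecutive iterates: four terms,
     each at most [2 / N.+1%:R], hence the constant 8. *)
  have E : s + s - s * s - x =
     (s * (sqrt_iter x N - s) + (sqrt_iter x N - s) * sqrt_iter x N)
      - ((sqrt_iter x N.+1 - s) + (sqrt_iter x N.+1 - s)).
    have -> : sqrt_iter x N.+1 - s + (sqrt_iter x N.+1 - s) =
        x + sqrt_iter x N * sqrt_iter x N - (s + s).
      rewrite addrACA -opprD; congr (_ - _) => /=.
      by rewrite -scalerDr half_add.
    rewrite mulrBr mulrBl addrC [X in _ = X - _]addrC subrKA opprB opprD !addrA.
    by rewrite [RHS](ACl (3*4*2*5*1*6))/= addrK [LHS](ACl (2*3*4*1)).
  rewrite E.
  have := uleB (uleD (uleM s1 sN) (uleM sN (itle N))) (uleD sN1 sN1).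
  move/ule_le; apply; rewrite mul1r mulr1.
  have k1 : 2 / N.+2%:R <= 2 / N.+1%:R :> R by rewrite ler_pM2l// lef_pV2 ?posrE// ler_nat.
  have := Ne N (leqnn N).
  have -> : 8 / N.+1%:R = 4 * (2 / N.+1%:R) :> R by rewrite mulrA -natrM.
  by move: (2 / N.+1%:R : R) (2 / N.+2%:R : R) k1 => k k' k1 ke; lra.
- move=> y yx; apply: commrB; first exact: commr1.
  apply/eqP; rewrite -subr_eq0; apply/eqP; apply: ule_eq0 => e e0.
  have [r r0 yr] := ule_ex y.
  have [N Ne] := invn_small (2 * 2 * r) e0.
  have yN := sqrt_iter_comm N yx.
  have -> : y * s - s * y = (sqrt_iter x N - s) * y - y * (sqrt_iter x N - s).
    by rewrite mulrBl mulrBr -yN opprB [RHS]addrC addrA subrK.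
  apply: ule_le (uleB (uleM (sP N) yr) (uleM yr (sP N))) _.
  by apply: le_trans (Ne N (leqnn N)); rewrite le_eqVlt; apply/orP; left; apply/eqP; ring.
Qed.

End Positivity.

(** * Positive elements *)

Section Kaplansky.
Context (R : realType) (A : cstarAlgebra R).
Local Notation U := (unitization A).
Implicit Types (x y z : U) (a b c : A) (r s : R).

(** For self-adjoint [x], a norm of [r - x] at most [r] says that the spectrum lies in [0, 2 r]. In
    this form a sum of positive elements is positive at once, as the radii add. *)
Definition pos x : Prop :=
  ustar x = x /\ exists2 r, 0 < r & ule (r%:C%C *: 1 - x) r.

Lemma scalerCA r s x : r%:C%C *: (s%:C%C *: x) = (r * s)%:C%C *: x.
Proof. by rewrite scalerA -rmorphM. Qed.

Lemma scalerCV r x : 0 < r -> r^-1%:C%C *: (r%:C%C *: x) = x.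
Proof. by move=> r0; rewrite scalerCA mulVf ?gt_eqF// scale1r. Qed.

Lemma scalerCK r x : 0 < r -> r%:C%C *: (r^-1%:C%C *: x) = x.
Proof. by move=> r0; rewrite scalerCA mulfV ?gt_eqF// scale1r. Qed.

Lemma pos_sqrt x : pos x -> exists c : U,
  [/\ ustar c = c, pos c, c * c = x &
      forall y, GRing.comm y x -> GRing.comm y c].
Proof.
move=> [xsa [r r0 xr]].
pose y : U := 1 - r^-1%:C%C *: x.
have y1 : ule y 1.
  have -> : y = r^-1%:C%C *: (r%:C%C *: 1 - x) by rewrite scalerBr scalerCV.
  have := uleZC r^-1 xr.
  by rewrite ger0_norm ?invr_ge0 ?ltW// mulVf ?gt_eqF.
have [|g [gsa g1 gg gc]] := usqrt _ y1; first by rewrite ustarB ustar1 ustarZC xsa.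
have q0 : 0 < Num.sqrt r by rewrite sqrtr_gt0.
exists ((Num.sqrt r)%:C%C *: g); split.
- by rewrite ustarZC gsa.
- split; first by rewrite ustarZC gsa.
  exists (Num.sqrt r) => //; rewrite -scalerBr.
  by have := uleZC (Num.sqrt r) g1; rewrite mulr1 ger0_norm ?sqrtr_ge0.
- by rewrite -scalerAl -scalerAr scalerCA -expr2 sqr_sqrtr ?ltW// gg subKr scalerCK.
- by move=> z zx; apply/commrZ/gc/commrB; [exact: commr1|exact: commrZ].
Qed.

(** [c + i d] is unitary, and [c] is the mean of it and its adjoint. *)
Lemma unitary_bound (c d : U) : ustar c = c -> ustar d = d -> GRing.comm c d ->
  c * c + d * d = 1 -> ule c 1.
Proof.
move=> csa dsa cd cd1; pose i : R[i] := 'i%C.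
have ii : i * i = -1 by rewrite -expr2 sqr_i.
have wi : i^* = - i by apply/eqP; rewrite eq_complex /= oppr0 !eqxx.
pose w := c + i *: d.
have w1 : ule w 1.
  apply: ule_cstar => //; rewrite expr1n.
  have -> : ustar w * w = 1; last exact: ule1.
  rewrite /w ustarD ustarZ csa dsa wi mulrDl !mulrDr -!scalerAl -!scalerAr.
  rewrite scalerA mulNr ii opprK scale1r -cd scaleNr addrA addrC addrA.
  by rewrite addrA addrK addrC.
have wb := ule_star w1.
have E : c = (2^-1)%:C%C *: (w + ustar w).
  rewrite /w ustarD ustarZ csa dsa wi scaleNr addrACA subrr addr0.
  by rewrite half_add.
rewrite E; have := uleZC 2^-1 (uleD w1 wb).
by rewrite ger0_norm ?invr_ge0// -[1 + 1]/2 mulVf// pnatr_eq0.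
Qed.

(** For the contraction [d = x / r] and a root [g] of [1 - d^2], [unitary_bound] makes [g] a
    contraction; so [r^2 - x^2 = r^2 g^2] has norm at most [r^2]. *)
Lemma sq_pos x : ustar x = x -> pos (x * x).
Proof.
move=> xsa; split; first by rewrite ustarM xsa.
have [r r0 xr] := ule_ex x.
exists (r ^+ 2); first exact: exprn_gt0.
pose d := r^-1%:C%C *: x.
have dsa : ustar d = d by rewrite /d ustarZC xsa.
have d1 : ule d 1.
  by have := uleZC r^-1 xr; rewrite ger0_norm ?invr_ge0 ?ltW// mulVf ?gt_eqF.
have dd1 : ule (d * d) 1 by have := uleM d1 d1; rewrite mulr1.
have [|g [gsa _ gg gc]] := usqrt _ dd1; first by rewrite ustarM dsa.
have g1 : ule g 1.
  apply: (@unitary_bound _ d) => //; last by rewrite gg subrK.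
  by apply/commr_sym/gc; exact: commrM.
have -> : (r ^+ 2)%:C%C *: 1 - x * x = (r ^+ 2)%:C%C *: (g * g).
  rewrite gg scalerBr /d -scalerAl -scalerAr !scalerCA expr2 -!mulrA.
  by rewrite (mulrA r r^-1) mulfV ?gt_eqF// mul1r mulfV ?gt_eqF// scale1r.
have := uleZC (r ^+ 2) (uleM g1 g1).
by rewrite !mulr1 ger0_norm ?sqr_ge0.
Qed.

Lemma pos0 : pos 0.
Proof. by rewrite -(mulr0 0); apply: sq_pos; exact: ustar0. Qed.

Lemma pos_add x y : pos x -> pos y -> pos (x + y).
Proof.
move=> [xsa [r r0 xr]] [ysa [s s0 ys]]; split; first by rewrite ustarD xsa ysa.
exists (r + s); first exact: addr_gt0.
by have := uleD xr ys; rewrite addrACA -opprD -scalerDl -rmorphD.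
Qed.

Lemma pos_scale r x : 0 <= r -> pos x -> pos (r%:C%C *: x).
Proof.
rewrite le_eqVlt => /predU1P[<- _|r0 [xsa [s s0 xs]]].
  by rewrite scale0r; exact: pos0.
split; first by rewrite ustarZC xsa.
exists (r * s); first exact: mulr_gt0.
have := uleZC r xs; rewrite scalerBr scalerCA ger0_norm ?ltW//.
Qed.

Lemma pos1 : pos 1.
Proof. by rewrite -(mulr1 1); apply: sq_pos; exact: ustar1. Qed.

Lemma one_sub_pos x : ustar x = x -> ule x 1 -> pos (1 - x).
Proof.
move=> xsa x1; split; first by rewrite ustarB ustar1 xsa.
by exists 1 => //; rewrite scale1r opprB addrC subrK.
Qed.

Lemma pos_sa x : pos x -> ustar x = x. Proof. by case. Qed.

(** Commuting roots [c] of [1 - y] and [d] of [1 + y] satisfy [y^2 + (c d)^2 = 1], so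
    [unitary_bound] applies to [y]. Order bounds become norm bounds here. *)
Lemma pm_bound y : pos (1 - y) -> pos (1 + y) -> ule y 1.
Proof.
move=> p1 p2; have ysa : ustar y = y.
  have := pos_sa p2; rewrite ustarD ustar1; exact: addrI.
have [c [csa _ cc cC]] := pos_sqrt p1; have [d [dsa _ dd dC]] := pos_sqrt p2.
have cy : GRing.comm c y.
  apply/commr_sym/cC; apply: commrB; [exact: commr1|exact: commr_refl].
have dy : GRing.comm d y.
  apply/commr_sym/dC; apply: commrD; [exact: commr1|exact: commr_refl].
have dc : GRing.comm d c by apply: cC; apply: commrB => //; exact: commr1.
apply: (@unitary_bound y (c * d)) => //.
- by rewrite ustarM csa dsa dc.
- by apply: commrM; apply: commr_sym.
- rewrite -mulrA (mulrA d) dc -(mulrA c) mulrA cc dd mulrDr mulr1 mulrBl mul1r.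
  by rewrite addrC addrA subrK subrK.
Qed.

(** For every [r > 0] both [1 + x / r] and [1 - x / r] are positive, so [pm_bound] makes the norm of
    [x] at most [r]. *)
Lemma pos_antisym x : pos x -> pos (- x) -> x = 0.
Proof.
move=> p1 p2; apply: ule_eq0 => r r0.
have r1 : 0 <= r^-1 by rewrite invr_ge0 ltW.
have : ule (r^-1%:C%C *: x) 1.
  apply: pm_bound; last exact: pos_add pos1 (pos_scale r1 p1).
  by rewrite -scalerN; exact: pos_add pos1 (pos_scale r1 p2).
move=> /(uleZC r); rewrite scalerCK// mulr1 ger0_norm ?ltW//.
Qed.

Lemma ustar_sq_eq0 x : ustar x * x = 0 -> x = 0.
Proof.
move=> x0; apply: ule_eq0 => r r0; apply: ule_cstar; first exact: ltW.
rewrite x0; split=> /=; first exact: sqr_ge0.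
  by rewrite rnorm0 sqr_ge0.
by move=> b; rewrite /act /= cmul0r scale0r addr0 rnorm0 mulr_ge0 ?sqr_ge0 ?rnorm_ge0.
Qed.

Lemma sa_sq_eq0 x : ustar x = x -> x * x = 0 -> x = 0.
Proof. by move=> xsa xx; apply: ustar_sq_eq0; rewrite xsa. Qed.

(* twice the sum of the squares of the real and imaginary parts of x *)
Lemma pos_symmetrized x : pos (ustar x * x + x * ustar x).
Proof.
pose i : R[i] := 'i%C.
have ii : i * i = -1 by rewrite -expr2 sqr_i.
have wi : i^* = - i by apply/eqP; rewrite eq_complex /= oppr0 !eqxx.
pose h := x + ustar x; pose k := i *: (x - ustar x).
have hsa : ustar h = h by rewrite /h ustarD ustarK addrC.
have ksa : ustar k = k by rewrite /k ustarZ wi ustarB ustarK scaleNr -scalerN opprB.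
have -> : ustar x * x + x * ustar x = (2^-1)%:C%C *: (h * h + k * k).
  have -> : h * h + k * k = (ustar x * x + x * ustar x) + (ustar x * x + x * ustar x).
    rewrite /k -scalerAl -scalerAr scalerA ii scaleN1r /h.
    move: (ustar x) => u.
    have -> : (x + u) * (x + u) = (x * x + u * u) + (u * x + x * u).
      by rewrite mulrDl !mulrDr !addrA [LHS](ACl (1*4*3*2)).
    have -> : (x - u) * (x - u) = (x * x + u * u) - (u * x + x * u).
      by rewrite mulrBl !mulrBr opprB opprD !addrA [LHS](ACl (1*3*4*2)).
    by rewrite opprB [X in _ + X]addrC addrACA subrr add0r.
  by rewrite half_add.
apply: pos_scale; first by rewrite invr_ge0.
by apply: pos_add; exact: sq_pos.
Qed.

(* With x = ustar b * b, a = |x| and y = b (a - x), one has ustar y * y = - z ^ 2 for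
   a self-adjoint z.  For w = y z, both ustar w * w and w * ustar w are then opposite
   to squares while their sum is positive, which forces y = 0 and so x = a. *)
Lemma pos_ustarM (b : U) : pos (ustar b * b).
Proof.
pose x := ustar b * b.
have xsa : ustar x = x by rewrite /x ustarM ustarK.
have [a [asa apos aa aC]] := pos_sqrt (sq_pos xsa).
have [q [qsa _ qq qC]] := pos_sqrt apos.
have ax : GRing.comm a x by apply/commr_sym/aC; exact: commrM.
have qx : GRing.comm q x by apply/commr_sym/qC/commr_sym.
have qa : GRing.comm q a by apply/commr_sym/qC.
pose c := a - x.
have csa : ustar c = c by rewrite /c ustarB asa xsa.
have qc : GRing.comm q c by exact: commrB.
have xc : GRing.comm x c by apply: commrB => //; exact: commr_sym.
have ac : GRing.comm a c by apply: commrB.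
have cx : c * x = - (a * c) by rewrite /c mulrBl mulrBr opprB aa.
pose z := q * c.
have zsa : ustar z = z by rewrite /z ustarM csa qsa qc.
have zz : z * z = a * (c * c).
  by rewrite /z -mulrA (mulrA c q) -qc -(mulrA q c) mulrA qq.
pose y := b * c.
have yy : ustar y * y = - (z * z).
  by rewrite /y ustarM csa -mulrA (mulrA (ustar b)) -/x mulrA cx zz mulNr mulrA.
pose P := y * ustar y.
have Psa : ustar P = P by rewrite /P ustarM ustarK.
pose w := y * z.
have ww1 : ustar w * w = - ((z * z) * (z * z)).
  by rewrite /w ustarM zsa -mulrA (mulrA (ustar y)) yy mulNr mulrN !mulrA.
have ww2 : w * ustar w = - (P * P).
  have zz' : z * z = - (ustar y * y) by rewrite yy opprK.
  by rewrite /w ustarM zsa -mulrA (mulrA z) zz' mulNr mulrN /P !mulrA.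
have := pos_symmetrized w; rewrite ww1 ww2 -opprD => npos.
have zpos : pos ((z * z) * (z * z)) by apply: sq_pos; rewrite ustarM zsa.
have PP : pos (P * P) by exact: sq_pos.
have PP0 : P * P = 0.
  have S0 := pos_antisym (pos_add zpos PP) npos.
  apply: pos_antisym => //.
  by have -> : - (P * P) = z * z * (z * z) by apply/eqP; rewrite eq_sym -addr_eq0 S0.
have P0 : P = 0 by exact: sa_sq_eq0.
have y0 : y = 0.
  rewrite -(ustarK y); have -> : ustar y = 0; last by rewrite ustar0.
  by apply: ustar_sq_eq0; rewrite ustarK.
have z0 : z = 0.
  by apply: sa_sq_eq0 => //; rewrite -(opprK (z * z)) -yy y0 mulr0 oppr0.
have ac0 : a * c = 0 by rewrite -qq -mulrA -/z z0 mulr0.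
have c0 : c = 0.
  apply: sa_sq_eq0 => //; rewrite {2}/c mulrBr cx -ac ac0 oppr0 subr0 //.
by rewrite -/x -(subrK x a) -/c in apos *; move: apos; rewrite c0 add0r.
Qed.

End Kaplansky.

Section Contractions.
Context (R : realType).

(** [g] makes [a + i g] unitary. An algebraic identity, unlike a norm bound, is carried along by any
    unital morphism. *)
Lemma sa_complement (A : cstarAlgebra R) (a : A) : star a = a -> rnorm a <= 1 ->
  exists g : unitization A, [/\ ustar g = g, GRing.comm (uinj a) g &
    uinj a * uinj a + g * g = 1].
Proof.
move=> asa a1; have ua1 := ule_inj ler01 a1.
have aa1 : ule (uinj a * uinj a) 1 by have := uleM ua1 ua1; rewrite mulr1.
have [|g [gsa _ gg gc]] := usqrt _ aa1; first by rewrite ustarM ustar_inj asa.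
exists g; split => //; first by apply/gc/commrM.
by rewrite gg addrC subrK.
Qed.

(** [F] extends [f] to the unitizations with [F 1 = 1], so it preserves the identity of
    [sa_complement], and [unitary_bound] settles self-adjoint contractions. Scaling and the
    C*-identity give the general case. *)
Lemma star_morphism_contractive (A B : cstarAlgebra R) (f : {linear A -> B}) a :
  star_morphism f -> rnorm (f a) <= rnorm a.
Proof.
move=> [fM fstar].
pose F (x : unitization A) : unitization B := (f x.1, x.2).
have FM x y : F (x * y) = F x * F y.
  by congr pair; rewrite /= !linearD !linearZ fM.
have FD x y : F (x + y) = F x + F y by congr pair; rewrite /= linearD.
have Fstar x : ustar (F x) = F (ustar x) by congr pair; rewrite /= fstar.
have F1 : F 1 = 1 by congr pair; rewrite /= linear0.
have fsa1 (b : A) : star b = b -> rnorm b <= 1 -> rnorm (f b) <= 1.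
  move=> bsa b1; have [g [gsa bg bg1]] := sa_complement bsa b1.
  apply: inj_ule; have -> : uinj (f b) = F (uinj b) by [].
  apply: (@unitary_bound _ _ _ (F g)).
  - by rewrite Fstar ustar_inj bsa.
  - by rewrite Fstar gsa.
  - by rewrite /GRing.comm -!FM bg.
  - by rewrite -!FM -FD bg1 F1.
have fsa (b : A) : star b = b -> rnorm (f b) <= rnorm b.
  move=> bsa; have [b0|b0] := eqVneq (rnorm b) 0.
    by rewrite (rnorm_eq0 b0) linear0 !rnorm0.
  have {}b0 : 0 < rnorm b by rewrite lt_def b0 rnorm_ge0.
  have := fsa1 ((rnorm b)^-1%:C%C *: b); rewrite linearZ !rnormZC starZC bsa.
  rewrite ger0_norm ?invr_ge0 ?rnorm_ge0// mulVf ?gt_eqF// => /(_ erefl (lexx _)).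
  by rewrite mulrC ler_pdivrMr// mul1r.
rewrite -(ler_pXn2r (ltn0Sn 1)) ?nnegrE ?rnorm_ge0//.
by rewrite -!rcstar -fstar -fM; apply: fsa; rewrite starM starKE.
Qed.

(** Both squares lie between 0 and 1, so their difference lies between -1 and 1. This is what makes
    a norm-attaining functional positive. *)
Lemma rnorm_sub_le1 (A : cstarAlgebra R) (e b : A) : star e = e ->
  rnorm (e ** e) <= 1 -> rnorm (star b ** b) <= 1 ->
  rnorm (e ** e - star b ** b) <= 1.
Proof.
move=> esa e1 b1; apply: inj_ule; rewrite uinjB; apply: pm_bound.
- rewrite opprB addrA addrAC; apply: pos_add.
    apply: one_sub_pos; first by rewrite ustar_inj starM esa.
    exact: ule_inj.
  by rewrite uinjM -ustar_inj; exact: pos_ustarM.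
- rewrite addrA addrAC; apply: pos_add.
    apply: one_sub_pos; first by rewrite ustar_inj starM starKE.
    exact: ule_inj.
  by rewrite uinjM; apply: sq_pos; rewrite ustar_inj esa.
Qed.

End Contractions.

(** * Approximate units *)

Section ApproximateUnit.
Context (R : realType) (A : cstarAlgebra R).
Local Notation U := (unitization A).
Implicit Types (x y z : U) (a b c : A) (r s : R).

(** Commuting factors have commuting roots, so [x * y] is the square of a self-adjoint product. *)
Lemma pos_mul x y : pos x -> pos y -> GRing.comm x y -> pos (x * y).
Proof.
move=> px py xy.
have [c [csa _ cc cC]] := pos_sqrt px; have [d [dsa _ dd dC]] := pos_sqrt py.
have cy : GRing.comm c y by apply/commr_sym/cC/commr_sym.
have cd : GRing.comm c d by apply: dC.
have -> : x * y = (c * d) * (c * d).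
  by rewrite -cc -dd -!mulrA; congr (_ * _); rewrite !mulrA cd.
by apply: sq_pos; rewrite ustarM csa dsa cd.
Qed.

(** After scaling, [1 - x / r] is [(1 - y / r) + (y - x) / r], a sum of positive elements. *)
Lemma pos_le x y r : 0 < r -> pos x -> pos (y - x) -> ule y r -> ule x r.
Proof.
move=> r0 px pyx yr.
have r1 : 0 <= r^-1 by rewrite invr_ge0 ltW.
have ysa : ustar y = y by rewrite -(subrK x y) ustarD (pos_sa px) (pos_sa pyx).
suff : ule (r^-1%:C%C *: x) 1.
  by move=> /(uleZC r); rewrite scalerCK// mulr1 ger0_norm ?ltW.
apply: pm_bound; last by apply: pos_add; [exact: pos1|exact: pos_scale].
have -> : 1 - r^-1%:C%C *: x = (1 - r^-1%:C%C *: y) + r^-1%:C%C *: (y - x).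
  by rewrite scalerBr addrA subrK.
apply: pos_add; last exact: pos_scale.
apply: one_sub_pos; first by rewrite ustarZC ysa.
by have := uleZC r^-1 yr; rewrite ger0_norm// mulVf ?gt_eqF.
Qed.

(** The scalar part [k] of a root satisfies [k^2 = 0], so the root already lies in [A]. *)
Lemma pos_inj a : pos (uinj a) -> exists2 b, star b = b & a = b ** b.
Proof.
move=> /pos_sqrt[[c k] [csa _ cc _]].
have k0 : k = 0.
  by have /(congr1 snd) /= /eqP := cc; rewrite mulf_eq0 orbb => /eqP.
exists c; first by have /(congr1 fst) := csa.
by have /(congr1 fst) /= := cc; rewrite k0 !scale0r !addr0.
Qed.

Section Powers.
Variable h : A.
Hypothesis hpos : pos (uinj h).
Hypothesis h1 : ule (uinj h) 1.
Let t : U := 1 - uinj h.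

Let tpos : pos t. Proof. exact: one_sub_pos (pos_sa hpos) h1. Qed.

Let th n : GRing.comm (t ^+ n) (uinj h).
Proof.
apply/commr_sym/commrX/commrB; [exact: commr1|exact: commr_refl].
Qed.

Let tX_pos n : pos (t ^+ n).
Proof.
elim: n => [|n IH]; first by rewrite expr0; exact: pos1.
by rewrite exprS; apply: pos_mul => //; exact: commrX.
Qed.

Let tS n : t ^+ n - t ^+ n.+1 = t ^+ n * uinj h.
Proof. by rewrite exprSr -{1}(mulr1 (t ^+ n)) -mulrBr opprB addrC subrK. Qed.

(* 1 - (1 - h) ^ n, which lies in A although 1 need not *)
Fixpoint au n : A := if n is m.+1 then au m + h - au m ** h else 0.

Lemma au_inj n : uinj (au n) = 1 - t ^+ n.
Proof.
elim: n => [|n IH] /=; first by rewrite expr0 subrr.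
rewrite uinjB uinjD uinjM IH mulrBl mul1r opprB -tS !addrA.
by rewrite [LHS](ACl (1*5*(4*2)*(3*6)))/= !subrr !addr0.
Qed.

Lemma au_pos n : pos (uinj (au n)).
Proof.
elim: n => [|n IH].
  by rewrite au_inj subrr; exact: pos0.
rewrite au_inj -(subrK (t ^+ n) 1) -addrA tS -au_inj.
by apply: pos_add => //; exact: pos_mul.
Qed.

Lemma au_le1 n : rnorm (au n) <= 1.
Proof.
apply: inj_ule; apply: pm_bound; last by apply: pos_add; [exact: pos1|exact: au_pos].
by rewrite au_inj opprB addrC subrK; exact: tX_pos.
Qed.

Lemma au_sa n : star (au n) = au n.
Proof. by have := pos_sa (au_pos n); rewrite ustar_inj => /(congr1 fst). Qed.

Lemma au_mono n m : (n <= m)%N -> pos (uinj (au m - au n)).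
Proof.
elim: m => [|m IH].
  by rewrite leqn0 => /eqP ->; rewrite subrr; exact: pos0.
rewrite leq_eqVlt => /predU1P[->|/IH nm]; first by rewrite subrr; exact: pos0.
have -> : uinj (au m.+1 - au n) = uinj (au m - au n) + t ^+ m * uinj h.
  have S : uinj (au m.+1) = uinj (au m) + t ^+ m * uinj h.
    by rewrite !au_inj -tS addrA subrK.
  by rewrite uinjB S [in RHS]uinjB addrAC.
by apply: pos_add => //; exact: pos_mul.
Qed.

(** [1 - t^n] is the sum of [t^k h] for [k < n], and each summand dominates [t^n h]. *)
Lemma power_bound n : pos (1 - t ^+ n - n%:R%:C%C *: (t ^+ n * uinj h)).
Proof.
elim: n => [|n IH].
  by rewrite expr0 subrr scale0r subr0; exact: pos0.
have -> : 1 - t ^+ n.+1 - n.+1%:R%:C%C *: (t ^+ n.+1 * uinj h) =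
  (1 - t ^+ n - n%:R%:C%C *: (t ^+ n * uinj h)) +
    n.+1%:R%:C%C *: (t ^+ n * (uinj h * uinj h)).
  have -> : t ^+ n * (uinj h * uinj h) = t ^+ n * uinj h - t ^+ n.+1 * uinj h.
    by rewrite mulrA -mulrBl tS.
  rewrite scalerBr; set X := t ^+ n.+1 * _.
  have -> : n.+1%:R%:C%C *: (t ^+ n * uinj h) =
      n%:R%:C%C *: (t ^+ n * uinj h) + (t ^+ n - t ^+ n.+1).
    by rewrite tS -natr1 rmorphD scalerDl rmorph1 scale1r.
  by rewrite !addrA !subrK.
apply: pos_add => //; apply: pos_scale; first exact: ler0n.
apply: pos_mul => //; first by apply: sq_pos; exact: pos_sa hpos.
by apply: commrM; exact: th.
Qed.

Lemma power_ule n : ule (t ^+ n.+1 * uinj h) n.+1%:R^-1.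
Proof.
have n0 : 0 < n.+1%:R :> R by [].
have : ule (n.+1%:R%:C%C *: (t ^+ n.+1 * uinj h)) 1.
  apply: (@pos_le _ (1 - t ^+ n.+1)) => //.
  - by apply: pos_scale => //; exact: pos_mul.
  - exact: power_bound.
  - by rewrite -au_inj; apply: ule_inj => //; exact: au_le1.
by move=> /(uleZC n.+1%:R^-1); rewrite scalerCV// mulr1 ger0_norm.
Qed.

(** With [u = au n.+1] and [s = t ^+ n.+1], one has [a - a u = a s] in the unitization. Its square
    is the compression of [star a ** a] by [s], dominated by [r] times the compression of [h], and
    [power_ule] bounds the latter. *)
Lemma au_approx a r : 0 < r -> pos (r%:C%C *: uinj h - uinj (star a ** a)) ->
  forall n, rnorm (a ** au n.+1 - a) ^+ 2 <= r / n.+1%:R.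
Proof.
move=> r0 ar n; have rn : 0 < r / n.+1%:R by rewrite divr_gt0.
rewrite -rnormN opprB -rcstar; apply: inj_ule.
have -> : uinj (star (a - a ** au n.+1) ** (a - a ** au n.+1)) =
    t ^+ n.+1 * uinj (star a ** a) * t ^+ n.+1.
  have E : uinj (a - a ** au n.+1) = uinj a * t ^+ n.+1.
    by rewrite uinjB uinjM au_inj mulrBr mulr1 opprB addrC subrK.
  by rewrite !uinjM -ustar_inj E ustarM ustar_inj (pos_sa (tX_pos _)) !mulrA.
have tt : ustar (t ^+ n.+1) = t ^+ n.+1 by exact: pos_sa.
have conj_pos x : pos x -> pos (t ^+ n.+1 * x * t ^+ n.+1).
  move=> /pos_sqrt[c [csa _ <- _]].
  have -> : t ^+ n.+1 * (c * c) * t ^+ n.+1 = ustar (c * t ^+ n.+1) * (c * t ^+ n.+1).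
    by rewrite ustarM tt csa !mulrA.
  exact: pos_ustarM.
apply: (@pos_le _ (r%:C%C *: (t ^+ n.+1 * uinj h * t ^+ n.+1))) => //.
- by rewrite uinjM -ustar_inj; apply: conj_pos; exact: pos_ustarM.
- rewrite scalerAl scalerAr -mulrBl -mulrBr; exact: conj_pos.
- have t1 : ule (t ^+ n.+1) 1.
    apply: (@pos_le _ 1) => //; last exact: ule1.
    by rewrite -au_inj; exact: au_pos.
  have := uleZC r (uleM (power_ule n) t1).
  by rewrite mulr1 ger0_norm// ltW.
Qed.

End Powers.

End ApproximateUnit.

Section SeparableApproximateUnit.
Context (R : realType) (A : cstarAlgebra R).
Local Notation U := (unitization A).

Lemma separable_dense_seq : separable A -> exists d : nat -> A,
  forall a (e : R), 0 < e -> exists k, rnorm (a - d k) <= e.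
Proof.
move=> [S Scount Sdense].
have S0 : S !=set0 by have [s Ss _] := dense_near 0 Sdense (@ltr01 R); exists s.
have [d dS] : exists d : nat -> A, S `<=` range d.
  by move/pcard_surjP : Scount => [d ds]; exists d => x /ds [k _ <-]; exists k.
by exists d => a e /(dense_near a Sdense)[s /dS[k _ <-] ae]; exists k.
Qed.

(** In general the radius witnessing positivity depends on the element. For positive contractions
    the radius 1 serves all of them, and so survives the limit. *)
Lemma pos_ule_closed (x : U) :
  (forall e, 0 < e -> exists y, [/\ pos y, ule y 1 & ule (x - y) e]) ->
  pos x /\ ule x 1.
Proof.
move=> H.
have xsa : ustar x = x.
  apply/eqP; rewrite -subr_eq0; apply/eqP; apply: ule_eq0 => e e0.
  have [y [ypos y1 xy]] := H _ (divr_gt0 e0 (ltr0Sn _ 1)).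
  have -> : ustar x - x = ustar (x - y) - (x - y).
    by rewrite ustarB (pos_sa ypos) opprB subrKA.
  by rewrite [e]splitr; apply: uleB => //; exact: ule_star.
split; last first.
  by apply: ule_closed => // e /H[y [_ y1 xy]]; exists y.
split => //; exists 1 => //; apply: ule_closed => // e /H[y [ypos y1 xy]].
exists (1 - y); split.
  apply: pm_bound; first by rewrite opprB addrC subrK.
  by apply: pos_add; [exact: pos1|apply: one_sub_pos => //; exact: pos_sa].
by rewrite scale1r opprB addrC subrKA -opprB; exact: uleN.
Qed.

Lemma rnorm_pow2 (k : nat) : 0 < (2^-1 : R) ^+ k. Proof. by rewrite exprn_gt0 ?invr_gt0. Qed.

(** A weighted series of the squares [star (d k) ** d k] over a dense sequence gives one [h]
    dominating a positive multiple of each of them. The elements [1 - (1 - h)^(n+1)] then form an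
    increasing approximate unit. *)
Lemma separable_approximate_unit : separable A -> exists u : nat -> A,
  [/\ approximate_unit (fun i j => is_true (i <= j)%N) u,
      forall n, star (u n) = u n & forall n, rnorm (u n) <= 1].
Proof.
move=> /separable_dense_seq[d dP].
pose p k := star (d k) ** d k.
pose c k : R := (2^-1) ^+ k.+1 / (1 + rnorm (p k)).
have pk0 k : 0 < 1 + rnorm (p k) by rewrite ltr_wpDr ?rnorm_ge0.
have c0 k : 0 < c k by rewrite divr_gt0 ?rnorm_pow2.
pose q k := (c k)%:C%C *: p k.
have qpos k : pos (uinj (q k)).
  rewrite uinjZ uinjM -ustar_inj; apply: pos_scale (ltW (c0 k)) _.
  exact: pos_ustarM.
have q1 k : rnorm (q k) <= (2^-1) ^+ k.+1.
  by rewrite rnormZC gtr0_norm// /c mulrAC ler_pdivrMr// ler_pM2l ?rnorm_pow2// lerDr.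
pose H n := \sum_(k < n) q k.
have HS n : H n.+1 = H n + q n by rewrite /H big_ord_recr.
have Hd n m : (n <= m)%N -> pos (uinj (H m - H n)) /\
    rnorm (H m - H n) <= (2^-1) ^+ n - (2^-1) ^+ m.
  have z : pos (uinj 0 : U) by exact: pos0.
  elim: m => [|m IH]; first by rewrite leqn0 => /eqP ->; rewrite !subrr rnorm0.
  rewrite leq_eqVlt => /predU1P[->|/IH [Hp Hn]]; first by rewrite !subrr rnorm0.
  rewrite HS addrAC uinjD; split; first exact: pos_add.
  rewrite (le_trans (rnormD _ _))// (le_trans (lerD Hn (q1 m)))// exprS.
  lra.
have Hd' n m : (n <= m)%N -> rnorm (H m - H n) <= (2^-1) ^+ n.
  by move=> /Hd[_ /le_trans]; apply; rewrite gerBl ltW ?rnorm_pow2.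
have half0 (e : R) : 0 < e -> exists N, forall n, (N <= n)%N -> (2^-1) ^+ n <= e.
  move=> e0; have [N Ne] := invn_small 1 e0; exists N => n Nn.
  apply: le_trans (Ne n Nn); rewrite div1r exprVn lef_pV2 ?posrE ?exprn_gt0//.
  by rewrite -natrX ler_nat ltn_expl.
have [|h hP] := @rnorm_complete _ _ H.
  move=> e /half0[N Ne]; exists N => m n Nm Nn.
  case/orP: (leq_total n m) => mn; first exact: le_trans (Hd' _ _ mn) (Ne _ Nn).
  by rewrite rdistC; exact: le_trans (Hd' _ _ mn) (Ne _ Nm).
have H1 n : rnorm (H n) <= 1.
  by have := Hd' 0%N n (leq0n n); rewrite /H big_ord0 subr0 expr0.
have Hpos n : pos (uinj (H n)).
  by have [] := Hd 0%N n (leq0n n); rewrite /H big_ord0 subr0.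
have [hpos h1] : pos (uinj h) /\ ule (uinj h) 1.
  apply: pos_ule_closed => e e0; have [N Ne] := hP e e0.
  exists (uinj (H N)); split => //; first exact: ule_inj.
  by rewrite -uinjB; apply: ule_inj; [exact: ltW|rewrite rdistC; exact: Ne].
(* Every partial sum beyond [k] dominates [q k], and the limit keeps this. *)
have hq k : pos (uinj (h - q k)).
  suff [] : pos (uinj (h - q k)) /\ ule (uinj (h - q k)) 1 by [].
  apply: pos_ule_closed => e e0; have [N Ne] := hP e e0.
  pose m := maxn N k.+1.
  have mk : (k.+1 <= m)%N by rewrite leq_max leqnn orbT.
  have P1 : pos (uinj (H m - q k)).
    have -> : H m - q k = (H m - H k.+1) + H k.
      by rewrite HS opprD addrA addrAC subrK.
    by rewrite uinjD; apply: pos_add => //; have [] := Hd _ _ mk.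
  exists (uinj (H m - q k)); split => //.
  - apply: (@pos_le _ _ _ (uinj (H m))) => //; last exact: ule_inj.
    by rewrite uinjB opprB addrC subrK.
  - rewrite -uinjB opprB addrA subrK; apply: ule_inj; first exact: ltW.
    by rewrite rdistC; apply: Ne; rewrite leq_max leqnn.
pose u n := au h n.+1.
have usa n : star (u n) = u n by exact: au_sa.
have u1 n : rnorm (u n) <= 1 by exact: au_le1.
have posP a : pos (uinj a) -> positive_element a.
  by move=> /pos_inj[b bsa ->]; exists b; rewrite bsa.
have uapp a (e : R) : 0 < e -> exists N, forall n, (N <= n)%N ->
    rnorm (a ** u n - a) <= e.
  move=> e0; have e3 : 0 < e / 3 by rewrite divr_gt0.
  have [k ak] := dP a _ e3.
  (* [au_approx] controls the square of the error, hence the target [(e / 3)^2]. *)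
  have [N Ne] := invn_small (c k)^-1 (exprn_gt0 2 e3).
  exists N => n Nn.
  have dk : rnorm (d k ** u n - d k) <= e / 3.
    rewrite -(ler_pXn2r (ltn0Sn 1)) ?nnegrE ?rnorm_ge0 ?(ltW e3)//.
    apply: le_trans (Ne n Nn); apply: au_approx => //; first by rewrite invr_gt0.
    have -> : uinj (star (d k) ** d k) = (c k)^-1%:C%C *: uinj (q k).
      by rewrite uinjZ scalerCV.
    rewrite -scalerBr; apply: pos_scale; first by rewrite invr_ge0 ltW.
    by rewrite -uinjB.
  have -> : a ** u n - a = (a - d k) ** u n + (d k ** u n - d k) + (d k - a).
    by rewrite cmulBl !subrKA.
  rewrite (le_trans (rnormD _ _))// (le_trans (lerD (rnormD _ _) (lexx _)))//.
  have : rnorm ((a - d k) ** u n) <= e / 3.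
    rewrite (le_trans (rcmul _ _))// -[e / 3]mulr1 ler_pM ?rnorm_ge0//.
  move: dk ak; rewrite (rdistC a); lra.
exists u; split => //; split.
- split => //; [exact: inhabits 0%N|by move=> i j k; exact: leq_trans|].
  by move=> i j; exists (maxn i j); rewrite leq_max leqnn ?orbT.
- by move=> i; split=> //; apply: posP; exact: au_pos.
- by move=> i j ij; apply: posP; exact: au_mono.
- move=> a e e0; have [N1 aN1] := uapp a e e0; have [N2 aN2] := uapp (star a) e e0.
  exists (maxn N1 N2) => j; rewrite geq_max => /andP[j1 j2]; split; last exact: aN1.
  by rewrite -rnorm_star starB starM usa; exact: aN2.
Qed.

End SeparableApproximateUnit.

(** * Positive functionals and states *)

Section Functionals.
Context (R : realType) (A : cstarAlgebra R).
Implicit Types (a b : A) (phi psi : functional R A) (c r e : R).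

Section Linear.
Variable phi : functional R A.
Hypothesis philin : GRing.linear_for *%R phi.

Lemma fun0 : phi 0 = 0.
Proof. by have := philin (-1) 0 0; rewrite scaler0 addr0 mulN1r addNr. Qed.

Lemma funD a b : phi (a + b) = phi a + phi b.
Proof. by have := philin 1 a b; rewrite scale1r mul1r. Qed.

Lemma funZ (k : R[i]) a : phi (k *: a) = k * phi a.
Proof. by have := philin k a 0; rewrite !addr0 fun0 addr0. Qed.

Lemma funN a : phi (- a) = - phi a.
Proof. by rewrite -scaleN1r funZ mulN1r. Qed.

Lemma funB a b : phi (a - b) = phi a - phi b.
Proof. by rewrite funD funN. Qed.

End Linear.

Lemma positive_linear phi : positive_functional phi -> GRing.linear_for *%R phi.
Proof. by case. Qed.

Lemma functional_norm_ub phi c a : positive_functional phi ->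
  (functional_norm phi <= c%:E)%E -> rnorm (phi a) <= c * rnorm a.
Proof.
move=> [lin _] phic; have [a0|a0] := eqVneq (rnorm a) 0.
  by rewrite (rnorm_eq0 a0) fun0// !rnorm0 mulr0.
have {}a0 : 0 < rnorm a by rewrite lt_def a0 rnorm_ge0.
pose b := (rnorm a)^-1%:C%C *: a.
have b1 : rnorm b <= 1 by rewrite rnormZC ger0_norm ?invr_ge0 ?rnorm_ge0// mulVf ?gt_eqF.
have : ((rnorm (phi b))%:E <= c%:E)%E.
  by apply: le_trans phic; apply: ereal_sup_ubound; exists b.
rewrite lee_fin funZ// rnormM_C rnormC ger0_norm ?invr_ge0 ?rnorm_ge0//.
by rewrite mulrC ler_pdivrMr.
Qed.

Lemma functional_norm_le phi c : 0 <= c ->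
  (forall a, rnorm (phi a) <= c * rnorm a) -> (functional_norm phi <= c%:E)%E.
Proof.
move=> c0 H; apply: ge_ereal_sup => _ [a a1 <-]; rewrite lee_fin.
by rewrite (le_trans (H a))// -[leRHS]mulr1 ler_wpM2l.
Qed.

Lemma functional_norm_ge phi a : rnorm a <= 1 ->
  ((rnorm (phi a))%:E <= functional_norm phi)%E.
Proof. by move=> a1; apply: ereal_sup_ubound; exists a. Qed.

Lemma functional_norm_approx phi c e : functional_norm phi = c%:E -> 0 < e ->
  exists2 a, rnorm a <= 1 & c - e < rnorm (phi a).
Proof.
move=> phic e0; have : ((c - e)%:E < functional_norm phi)%E.
  by rewrite phic lte_fin gtrBl.
by move=> /ereal_sup_gt[_ [a a1 <-]]; rewrite lte_fin; exists a.
Qed.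

Lemma functional_norm_fin phi c : positive_functional phi ->
  (functional_norm phi <= c%:E)%E -> exists2 n, 0 <= n & functional_norm phi = n%:E.
Proof.
move=> [lin _] phic; have phi0 : (0 <= functional_norm phi)%E.
  apply: le_trans (functional_norm_ge _ (a := 0) _); last by rewrite rnorm0.
  by rewrite lee_fin rnorm_ge0.
have fin : functional_norm phi \is a fin_num.
  by rewrite ge0_fin_numE// (le_lt_trans phic)// ltry.
exists (fine (functional_norm phi)); first exact: fine_ge0.
by rewrite fineK.
Qed.

Lemma quasi_statesP phi : quasi_states A phi <->
  positive_functional phi /\ forall a, rnorm (phi a) <= rnorm a.
Proof.
split=> -[pos H]; split => //.
  by move=> a; rewrite -[leRHS]mul1r; exact: functional_norm_ub.
by apply: functional_norm_le => // a; rewrite mul1r.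
Qed.

Lemma state_quasi phi : states A phi -> quasi_states A phi.
Proof. by move=> [pos H]; split => //; rewrite H. Qed.

Lemma state_bound phi a : states A phi -> rnorm (phi a) <= rnorm a.
Proof. by move=> /state_quasi/quasi_statesP[_]; exact. Qed.

Lemma statesP phi : states A phi <-> quasi_states A phi /\
  forall e, 0 < e -> exists2 a, rnorm a <= 1 & 1 - e <= rnorm (phi a).
Proof.
split=> [phiS|[/quasi_statesP[pos H1] H2]].
  split; first exact: state_quasi.
  move=> e e0; have [a a1 ae] := functional_norm_approx phiS.2 e0.
  by exists a => //; exact: ltW.
split => //; apply/eqP; rewrite eq_le functional_norm_le//; last first.
  by move=> a; rewrite mul1r.
apply/lee_addgt0Pr => e e0; have [a a1 ae] := H2 e e0.
rewrite -leeBlDr// (le_trans _ (functional_norm_ge phi a1))// -EFinB lee_fin//.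
Qed.

Lemma positive_real phi a : positive_functional phi ->
  phi (star a ** a) = (rnorm (phi (star a ** a)))%:C%C.
Proof. by move=> [_ H]; exact: ge0_rnorm. Qed.

Lemma Im_real (z : R[i]) (t : R) : z = t%:C%C -> complex.Im z = 0.
Proof. by move=> ->. Qed.

(** The value at the square of [a + k b] is real. Taking [k = 1] and [k = i] compares the imaginary
    and the real parts of the two mixed terms. *)
Lemma positive_sym phi a b : positive_functional phi ->
  phi (star b ** a) = (phi (star a ** b))^*.
Proof.
move=> pos; have lin := positive_linear pos.
have H (k : R[i]) : complex.Im (k * phi (star a ** b) + k^* * phi (star b ** a)) = 0.
  have := positive_real (a + k *: b) pos; set t : R := rnorm _.
  rewrite starDE starZ cmulDl !cmulDr !cmulZl !cmulZr.
  rewrite scalerA !(funD lin) !(funZ lin).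
  rewrite (positive_real a pos) (positive_real b pos).
  have -> : k^* * k = (rnorm k ^+ 2)%:C%C by rewrite rmorphXn /= rnormE mulrC -normCK.
  move=> E; suff : k * phi (star a ** b) + k^* * phi (star b ** a) =
     (t - rnorm (phi (star a ** a)) - rnorm k ^+ 2 * rnorm (phi (star b ** b)))%:C%C.
    by move/Im_real.
  by rewrite !rmorphB rmorphM /= -E; ring.
have := H 1; have := H 'i%C; rewrite rmorph1 !mul1r.
case: (phi (star a ** b)) => x y; case: (phi (star b ** a)) => z w /=.
move=> h1 h2.
by apply/eqP; rewrite eq_complex /=; apply/andP; split; apply/eqP; lra.
Qed.

Lemma quadratic_discr (p q X : R) : 0 <= p -> 0 <= q -> 0 <= X ->
  (forall t, 0 <= p - 2 * t * X + t ^+ 2 * X * q) -> X <= p * q.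
Proof.
move=> p0 q0; rewrite le_eqVlt => /predU1P[<- _|X0 H]; first exact: mulr_ge0.
move: q0; rewrite le_eqVlt => /predU1P[q0|q0].
  (* For [q = 0] the expression is affine in [t], and at this [t] it equals -1. *)
  have := H ((p + 1) / (2 * X)); rewrite -q0 mulr0 addr0.
  have -> : 2 * ((p + 1) / (2 * X)) * X = p + 1 by field; rewrite gt_eqF.
  by rewrite opprD addrA subrr add0r oppr_ge0 ler10.
have := H q^-1; have -> : p - 2 * q^-1 * X + q^-1 ^+ 2 * X * q = p - X / q.
  by field; rewrite gt_eqF.
by rewrite subr_ge0 ler_pdivrMr.
Qed.

(** Positivity at [a + k b] with [k = - t z], where [z] is the value at [star b ** a]: the phase of
    [z] is absorbed and a quadratic in the real [t] remains. *)
Lemma cauchy_schwarz phi a b : positive_functional phi ->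
  rnorm (phi (star b ** a)) ^+ 2 <=
  rnorm (phi (star a ** a)) * rnorm (phi (star b ** b)).
Proof.
move=> pos; have lin := positive_linear pos.
apply: quadratic_discr; rewrite ?rnorm_ge0 ?sqr_ge0// => t.
set z := phi (star b ** a); pose k : R[i] := - t%:C%C * z.
have zE : z * z^* = (rnorm z)%:C%C * (rnorm z)%:C%C.
  by rewrite rnormE -expr2 -normCK.
have := positive_real (a + k *: b) pos; set s : R := rnorm _ => E.
have := positive_real a pos; set p : R := rnorm _ => pE.
have := positive_real b pos; set q : R := rnorm _ => qE.
suff -> : p - 2 * t * rnorm z ^+ 2 + t ^+ 2 * rnorm z ^+ 2 * q = s.
  exact: rnorm_ge0.
apply: complexI; rewrite -E.
rewrite starDE starZ cmulDl !cmulDr !cmulZl !cmulZr.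
rewrite scalerA !(funD lin) !(funZ lin).
rewrite (positive_sym b a pos) -/z pE qE.
rewrite /k rmorphM rmorphN /= conj_real.
rewrite !rmorphD !rmorphN !rmorphM /= -zE.
have -> : (2%:C%C : R[i]) = 2 by rewrite -[2 in LHS](_ : 1 + 1 = 2)// rmorphD rmorph1.
ring.
Qed.

End Functionals.

Section PositiveOperations.
Context (R : realType) (A : cstarAlgebra R).
Implicit Types (a b e : A) (phi psi : functional R A).

Lemma positive_add phi psi : positive_functional phi -> positive_functional psi ->
  positive_functional (fun a => phi a + psi a : R[i]).
Proof.
move=> p1 p2; split.
  move=> k a b /=; rewrite !(funD, funZ)//; try exact: positive_linear.
  by rewrite mulrDr addrACA.
by move=> a; rewrite addr_ge0 ?p1.2 ?p2.2.
Qed.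

Lemma positive_scale (c : R) phi : 0 <= c -> positive_functional phi ->
  positive_functional (fun a => c%:C%C * phi a : R[i]).
Proof.
move=> c0 p1; split.
  move=> k a b /=; rewrite !(funD, funZ)//; try exact: positive_linear.
  by rewrite mulrDr mulrCA.
by move=> a; rewrite mulr_ge0 ?p1.2// ler0c.
Qed.

Lemma positive_compress e phi : star e = e -> positive_functional phi ->
  positive_functional (fun a => phi (e ** a ** e) : R[i]).
Proof.
move=> esa p1; split.
  move=> k a b /=; rewrite cmulDr cmulDl cmulZr cmulZl.
  by rewrite !(funD, funZ)//; exact: positive_linear.
move=> a; have -> : e ** (star a ** a) ** e = star (a ** e) ** (a ** e).
  by rewrite starM esa !cmulA.
exact: p1.2.
Qed.

Lemma quasi_state_convex (s t : R) phi psi : 0 <= s -> 0 <= t -> s + t <= 1 ->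
  quasi_states A phi -> quasi_states A psi ->
  quasi_states A (fun a => s%:C%C * phi a + t%:C%C * psi a : R[i]).
Proof.
move=> s0 t0 st /quasi_statesP[p1 pb1] /quasi_statesP[p2 pb2]; apply/quasi_statesP.
split; first by apply: (@positive_add (fun a => s%:C%C * phi a : R[i])
  (fun a => t%:C%C * psi a : R[i])); exact: positive_scale.
move=> a; rewrite (le_trans (rnormD _ _))// !rnormM_C !rnormC !ger0_norm//.
have := pb1 a; have := pb2 a; have := rnorm_ge0 a => a0 h2 h1.
rewrite (@le_trans _ _ ((s + t) * rnorm a))//; last by rewrite ler_piMl.
by rewrite mulrDl lerD// ler_wpM2l.
Qed.

Lemma quasi_state_compress e phi : star e = e -> rnorm e <= 1 ->
  quasi_states A phi -> quasi_states A (fun a => phi (e ** a ** e) : R[i]).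
Proof.
move=> esa e1 /quasi_statesP[p1 pb]; apply/quasi_statesP; split.
  exact: positive_compress.
move=> a; rewrite (le_trans (pb _))// (le_trans (rnorm_cmul3 _ _ _))//.
have := rnorm_ge0 a; have := rnorm_ge0 e => e0 a0.
rewrite -mulrA mulrCA -[leRHS]mulr1; apply: ler_wpM2l => //.
by rewrite mulr_ile1.
Qed.

Lemma quasi_state0 : quasi_states A (fun=> 0 : R[i]).
Proof.
apply/quasi_statesP; split; last by move=> a; rewrite rnorm0 rnorm_ge0.
by split => // k a b /=; rewrite mulr0 addr0.
Qed.

End PositiveOperations.

Section SeparableFunctionals.
Context (R : realType) (A : cstarAlgebra R).
Hypothesis Asep : separable A.
Implicit Types (a b e : A) (phi psi : functional R A).

Lemma approximate_unit_seq : exists u : nat -> A,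
  [/\ forall n, star (u n) = u n, forall n, rnorm (u n) <= 1 &
      forall a (e : R), 0 < e -> exists n,
        rnorm (u n ** a - a) <= e /\ rnorm (a ** u n - a) <= e].
Proof.
have [u [[_ _ _ uP] usa u1]] := separable_approximate_unit Asep.
by exists u; split => // a e /(uP a)[n nP]; exists n; exact: nP.
Qed.

Lemma rnorm_eq_eps (z w : R[i]) : (forall e : R, 0 < e -> rnorm (z - w) <= e) -> z = w.
Proof.
move=> H; apply/eqP; rewrite -subr_eq0; apply/eqP/rnorm_eq0/eqP.
rewrite eq_le rnorm_ge0 andbT; apply/ler_addgt0Pr => e /H; by rewrite add0r.
Qed.

(** [positive_sym] is applied to [a] and an element of an approximate unit, which replaces the unit
    up to an error [e]. *)
Lemma quasi_state_star phi a : quasi_states A phi -> phi (star a) = (phi a)^*.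
Proof.
move=> /quasi_statesP[pos pb]; have lin := positive_linear pos.
have [u [usa u1 uP]] := approximate_unit_seq.
apply: rnorm_eq_eps => e e0.
have [n [n1 n2]] := uP a _ (divr_gt0 e0 (ltr0Sn _ 1)).
have E : phi (star a ** u n) = (phi (u n ** a))^*.
  by rewrite (positive_sym _ _ pos) usa.
have -> : phi (star a) - (phi a)^* =
    (phi (u n ** a) - phi a)^* - (phi (star a ** u n) - phi (star a)).
  by rewrite E rmorphB /=; ring.
rewrite [e]splitr (le_trans (rnormB _ _))// lerD//.
  by rewrite rnorm_conj -funB// (le_trans (pb _)).
rewrite -funB// (le_trans (pb _))// -rnorm_star starB starM usa starKE//.
Qed.

Lemma quasi_state_real phi a : quasi_states A phi -> star a = a ->
  phi a = (complex.Re (phi a))%:C%C.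
Proof.
move=> phiQ asa; rewrite RRe_real// CrealE.
by rewrite -(quasi_state_star a phiQ) asa.
Qed.

End SeparableFunctionals.

Section StatePullback.
Context (R : realType) (D A : cstarAlgebra R) (f : {linear D -> A}).
Hypothesis fstar : star_morphism f.

Lemma quasi_state_pullback (phi : functional R A) : quasi_states A phi ->
  quasi_states D (phi \o f).
Proof.
move=> /quasi_statesP[pos pb]; apply/quasi_statesP; split; last first.
  move=> a /=; rewrite (le_trans (pb _))//; exact: star_morphism_contractive.
split.
  move=> k a b /=; rewrite linearD linearZ funD ?funZ//; exact: positive_linear.
by move=> a /=; rewrite fstar.1 fstar.2; exact: pos.2.
Qed.

(** To avoid lifting the unit ball of [A], the norm is tested on squares from an approximate unit of
    [D]: by Cauchy-Schwarz, [phi (f (u n ** u n))] bounds the square of [phi (f (u n) ** a)], which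
    is close to that of [phi a]. *)
Lemma state_pullback (phi : functional R A) : separable D ->
  (forall a, exists d, f d = a) -> states A phi -> states D (phi \o f).
Proof.
move=> Dsep fsurj phiS; have phiQ := state_quasi phiS.
apply/statesP; split; first exact: quasi_state_pullback.
move=> e e0.
(* The value at [f (u n) ** a] is at least [1 - 2 t], so its square is at least
   [1 - 4 t >= 1 - e]. *)
pose t := Num.min (e / 4) 1; have t0 : 0 < t by rewrite lt_min ltr01 divr_gt0.
have t1 : t <= 1 by rewrite ge_min lexx orbT.
have te : t <= e / 4 by rewrite ge_min lexx.
have [_ /(_ t t0)[a a1 ae]] := (statesP phi).1 phiS.
have [pos pb] := (quasi_statesP phi).1 phiQ.
have [u [usa u1 uP]] := approximate_unit_seq Dsep.
have [d da] := fsurj a; have [n [n1 _]] := uP d t t0.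
exists (u n ** u n).
  by rewrite (le_trans (rcmul _ _))// mulr_ile1 ?rnorm_ge0.
have CS := cauchy_schwarz a (f (u n)) pos.
have vsa : star (f (u n)) = f (u n) by rewrite -fstar.2 usa.
rewrite vsa -fstar.1 in CS.
have h1 : rnorm (phi (star a ** a)) <= 1.
  by rewrite (le_trans (pb _))// rcstar expr_le1 ?rnorm_ge0.
have h2 : rnorm (phi (f (u n) ** a) - phi a) <= t.
  rewrite -(funB (positive_linear pos)) (le_trans (pb _))//.
  rewrite -{1 2}da -fstar.1 -linearB.
  by rewrite (le_trans (star_morphism_contractive _ fstar)).
have h3 := rnorm_sub (phi a) (phi (f (u n) ** a)).
rewrite rdistC in h3.
move: CS h1 h2 h3 ae; rewrite /= => CS h1 h2 h3 ae.
have := rnorm_ge0 (phi (f (u n ** u n))); move: CS.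
have := rnorm_ge0 (phi (f (u n) ** a)); move: h2 h3 ae h1.
have := rnorm_ge0 (phi (star a ** a)).
move: (rnorm (phi (f (u n ** u n)))) (rnorm (phi (star a ** a))) => p q.
move: (rnorm (phi (f (u n) ** a))) (rnorm (phi a)) (rnorm (_ - _)) => x y z.
move=> q0 zt yxz ty q1 x0 xpq p0.
have xt : 1 - 2 * t <= x by lra.
have xp : x ^+ 2 <= p by rewrite (le_trans xpq)// ler_piMl.
have : 1 - 4 * t <= x ^+ 2 by nra.
lra.
Qed.

End StatePullback.

(** * Norming functionals and existence of states *)

Section HahnBanach.
Context (R : realType) (V : normedModType R[i]).
Implicit Types (x y : V) (q : V -> R) (s t : R).

Definition sublinear q : Prop :=
  (forall x y, q (x + y) <= q x + q y) /\
  (forall t x, 0 <= t -> q (t%:C%C *: x) = t * q x).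

Definition below_norm q : Prop := sublinear q /\ forall x, q x <= rnorm x.

Lemma sublinear0 q : sublinear q -> q 0 = 0.
Proof. by move=> [_ /(_ 0 0 (lexx _))]; rewrite scale0r mul0r. Qed.

(** The inequality at [t^-1] gives the reverse one at [t]. *)
Lemma sublinearP q : (forall x y, q (x + y) <= q x + q y) -> q 0 = 0 ->
  (forall t x, 0 < t -> t * q x <= q (t%:C%C *: x)) -> sublinear q.
Proof.
move=> qD q0 scal; split => // t x; rewrite le_eqVlt => /predU1P[<-|t0].
  by rewrite scale0r mul0r q0.
apply/eqP; rewrite eq_le scal// andbT; have ti0 : 0 < t^-1 by rewrite invr_gt0.
have := scal t^-1 (t%:C%C *: x) ti0; rewrite scalerA -rmorphM /= mulVf ?gt_eqF// scale1r.
by rewrite mulrC ler_pdivrMr// mulrC.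
Qed.

Lemma below_norm_ge q x : below_norm q -> - rnorm x <= q x.
Proof.
move=> [qs qn]; have := qs.1 x (- x); rewrite subrr (sublinear0 qs).
have := qn (- x); rewrite rnormN; lra.
Qed.

(* The shift of q along x is sublinear and below q; a minimal q equals its shifts,
   which makes it additive. *)
Definition shift_set q x y : set R :=
  [set q (y + t%:C%C *: x) - t * q x | t in [set t | 0 <= t]].
Definition shift q x y : R := inf (shift_set q x y).

Lemma shift_set_lb q x y : sublinear q -> lbound (shift_set q x y) (- q (- y)).
Proof.
move=> qs _ [t /= t0 <-]; rewrite -(qs.2 t x t0) lerBrDr.
have := qs.1 (y + t%:C%C *: x) (- y); rewrite addrAC subrr add0r; lra.
Qed.

Lemma shift_le q x y t : sublinear q -> 0 <= t ->
  shift q x y <= q (y + t%:C%C *: x) - t * q x.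
Proof.
move=> qs t0; apply: ge_inf; last by exists t.
by exists (- q (- y)); exact: shift_set_lb.
Qed.

Lemma le_shift q x y c : (forall t, 0 <= t -> c <= q (y + t%:C%C *: x) - t * q x) ->
  c <= shift q x y.
Proof.
move=> H; apply: lb_le_inf; first by exists (q (y + 0%:C%C *: x) - 0 * q x); exists 0 => /=.
by move=> _ [t t0 <-]; exact: H.
Qed.

Lemma shift_sublinear q x : sublinear q -> sublinear (shift q x).
Proof.
move=> qs; apply: sublinearP.
- move=> y z; rewrite -lerBlDr; apply: le_shift => t t0.
  rewrite lerBlDr -lerBlDl; apply: le_shift => s s0.
  rewrite lerBlDl (le_trans (shift_le _ _ qs (addr_ge0 s0 t0)))//.
  have := qs.1 (z + s%:C%C *: x) (y + t%:C%C *: x).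
  rewrite addrACA (addrC z) -scalerDl -rmorphD /= => H; lra.
- apply/eqP; rewrite eq_le; apply/andP; split.
    by rewrite (le_trans (shift_le _ _ qs (lexx 0)))// scale0r addr0 mul0r subr0 sublinear0.
  by apply: le_shift => t t0; rewrite add0r qs.2// subrr.
move=> u z u0; apply: le_shift => t t0.
have tu0 : 0 <= t / u by rewrite divr_ge0// ltW.
have := shift_le x z qs tu0; rewrite -(ler_pM2l u0) => /le_trans; apply.
rewrite mulrBr -(qs.2 u (z + _) (ltW u0)) scalerDr scalerA -rmorphM /=.
have E : u * (t / u) = t by rewrite mulrC divfK ?gt_eqF.
by rewrite E [u * (t / u * _)]mulrA E.
Qed.

Lemma shift_below q x : below_norm q -> below_norm (shift q x).
Proof.
move=> [qs qn]; split; first exact: shift_sublinear.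
move=> y; rewrite (le_trans (shift_le _ _ qs (lexx 0)))//.
by rewrite scale0r addr0 mul0r subr0.
Qed.

Lemma rnorm_below : below_norm (@rnorm R V).
Proof.
split => //; split; first exact: rnormD.
by move=> t x t0; rewrite rnormZC ger0_norm.
Qed.

(** Zorn's lemma for the reversed pointwise order: the infimum of a chain is again below the norm,
    and the bound [- rnorm x] keeps it finite. *)
Lemma minimal_sublinear q0 : below_norm q0 -> exists q, below_norm q /\
  (forall x, q x <= q0 x) /\
  forall q', below_norm q' -> (forall x, q' x <= q x) -> q' = q.
Proof.
move=> q0n; pose T := {q | below_norm q /\ forall x, q x <= q0 x}.
pose le (p q : T) : bool := `[< forall x, sval q x <= sval p x >].
have t0 : T by exists q0.
have [||||m mP] := @Zorn T le.
- by move=> t; apply/asboolP.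
- by move=> r s t /asboolP rs /asboolP st; apply/asboolP => x; exact: le_trans (rs x).
- move=> [s sP] [t tP] /asboolP st /asboolP ts; apply: eq_exist => /=.
  by apply/funext => x; apply/eqP; rewrite eq_le st ts.
- move=> C Ctot; have [[c0 Cc0]|C0] := pselect (C !=set0); last first.
    by exists t0 => s Cs; case: C0; exists s.
  pose S x : set R := [set sval c x | c in C].
  have Slb x : has_lbound (S x).
    by exists (- rnorm x) => _ [[c [cP cq]] _ <-]; exact: below_norm_ge.
  pose q x := inf (S x).
  have qle c x : C c -> q x <= sval c x by move=> Cc; apply: ge_inf => //; exists c.
  have qge b x : (forall c, C c -> b <= sval c x) -> b <= q x.
    move=> H; apply: lb_le_inf; first by exists (sval c0 x); exists c0.
    by move=> _ [c Cc <-]; exact: H.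
  have qP : below_norm q /\ forall x, q x <= q0 x.
    split; last by move=> x; rewrite (le_trans (qle _ x Cc0))//; exact: (svalP c0).2.
    split; last by move=> x; rewrite (le_trans (qle _ x Cc0))//; exact: (svalP c0).1.2.
    apply: sublinearP.
    - move=> x y; rewrite -lerBlDr; apply: (qge _ x) => c Cc.
      rewrite lerBlDr -lerBlDl; apply: (qge _ y) => d Cd; rewrite lerBlDl.
      have [/asboolP cd|/asboolP dc] := Ctot _ _ Cc Cd.
      + rewrite (le_trans (qle _ _ Cd))// (le_trans ((svalP d).1.1.1 _ _))//.
        by rewrite lerD2r.
      + rewrite (le_trans (qle _ _ Cc))// (le_trans ((svalP c).1.1.1 _ _))//.
        by rewrite lerD2l.
    - apply/eqP; rewrite eq_le; apply/andP; split.
        by rewrite (le_trans (qle _ _ Cc0))// (sublinear0 (svalP c0).1.1).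
      by apply: qge => c Cc; rewrite (sublinear0 (svalP c).1.1).
    - move=> u z u0; apply: (qge _ (u%:C%C *: z)) => c Cc.
      by rewrite ((svalP c).1.1.2 _ _ (ltW u0)) ler_pM2l// qle.
  by exists (exist _ q qP) => s Cs; apply/asboolP => x /=; exact: qle.
- exists (sval m); split; first exact: (svalP m).1.
  split; first exact: (svalP m).2.
  move=> q' q'n q'm.
  have q'P : below_norm q' /\ forall x, q' x <= q0 x.
    by split => // x; exact: le_trans (q'm x) ((svalP m).2 x).
  have : le m (exist _ q' q'P) by apply/asboolP.
  by move=> /mP /(congr1 sval).
Qed.

(** The minimal functional is chosen below the shift of the norm along [p]. That shift is at most
    [- rnorm p] at [- p], which forces the value [rnorm p] at [p]. *)
Lemma hahn_banach_norm (p : V) : exists f : V -> R,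
  [/\ forall x y, f (x + y) = f x + f y,
      forall t x, f (t%:C%C *: x) = t * f x,
      forall x, f x <= rnorm x & f p = rnorm p].
Proof.
have [q [qn [q0 qmin]]] := minimal_sublinear (shift_below p rnorm_below).
have qD x y : q (x + y) = q x + q y.
  apply/eqP; rewrite eq_le qn.1.1 /=.
  have E : shift q y = q.
    apply: qmin; first exact: shift_below.
    move=> z; rewrite (le_trans (shift_le _ _ qn.1 (lexx 0)))//.
    by rewrite scale0r addr0 mul0r subr0.
  rewrite -lerBrDr -{1}E (le_trans (shift_le _ _ qn.1 (@ler01 R)))//.
  by rewrite scale1r mul1r.
have qN x : q (- x) = - q x.
  by apply/eqP; rewrite -addr_eq0 -qD addNr (sublinear0 qn.1).
exists q; split => //.
- move=> t x; have [t0|t0] := leP 0 t; first exact: qn.1.2.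
  have -> : t%:C%C *: x = - ((- t)%:C%C *: x) by rewrite rmorphN scaleNr opprK.
  by rewrite qN qn.1.2 ?oppr_ge0 ?ltW// mulNr opprK.
- exact: qn.2.
- apply/eqP; rewrite eq_le qn.2 /= -lerN2 -qN (le_trans (q0 _))//.
  rewrite (le_trans (shift_le _ _ rnorm_below.1 (@ler01 R)))//.
  by rewrite scale1r addNr rnorm0 mul1r sub0r.
Qed.

End HahnBanach.

Section StateExistence.
Context (R : realType) (A : cstarAlgebra R).

(** A real norming functional [f] of [e ** e] is composed with the real part and complexified. For
    positivity, normalize [e] and [b]: by [rnorm_sub_le1] the functional is at most 1 on
    [e ** e - star b ** b], while it is already 1 on the first term. *)
Lemma exists_state (e : A) : star e = e -> e != 0 ->
  exists2 phi : functional R A, states A phi & phi (e ** e) = (rnorm (e ** e))%:C%C.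
Proof.
move=> esa e0.
have {}e0 : 0 < rnorm e.
  rewrite lt_def rnorm_ge0 andbT; apply: contra e0 => /eqP/rnorm_eq0 ->; exact: eqxx.
have [f [fD fZ fn fe]] := hahn_banach_norm (e ** e).
pose i : R[i] := 'i%C.
have ii : i * i = -1 by rewrite -expr2 sqr_i.
pose re (a : A) := (2^-1)%:C%C *: (a + star a).
have star_re a : star (re a) = re a by rewrite /re starZC starDE starKE addrC.
have re_sa a : star a = a -> re a = a.
  by move=> asa; rewrite /re asa half_add.
have reD a b : re (a + b) = re a + re b.
  by rewrite /re starDE -scalerDr addrACA.
have reZ t a : re (t%:C%C *: a) = t%:C%C *: re a.
  by rewrite /re starZC -scalerDr !scalerA mulrC.
have re_norm a : rnorm (re a) <= rnorm a.
  rewrite /re rnormZC ger0_norm ?invr_ge0//.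
  have := rnormD a (star a); rewrite rnorm_star; lra.
pose g a := f (re a).
have gD a b : g (a + b) = g a + g b by rewrite /g reD fD.
have gZ t a : g (t%:C%C *: a) = t * g a by rewrite /g reZ fZ.
have gn a : g a <= rnorm a by rewrite (le_trans (fn _)).
pose phi : functional R A := fun a => (g a -i* g (i *: a))%C.
have phi_sa a : star a = a -> phi a = (f a)%:C%C.
  move=> asa; rewrite /phi /g re_sa//.
  have -> : re (i *: a) = 0.
    rewrite /re starZ asa -scalerDl.
    have -> : i + i^* = 0 by apply/eqP; rewrite eq_complex /= addr0 addrN eqxx.
    by rewrite scale0r scaler0.
  by have := fZ 0 0; rewrite scale0r mul0r => ->; rewrite oppr0.
have philin : GRing.linear_for *%R phi.
  move=> k a b; have kE : k *: a = (complex.Re k)%:C%C *: a + (complex.Im k)%:C%C *: (i *: a).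
    by rewrite scalerA -scalerDl mulrC -complexE.
  have iiE : i *: (i *: a) = (-1)%:C%C *: a by rewrite scalerA ii rmorphN1.
  have ik : i *: (k *: a) = (complex.Re k)%:C%C *: (i *: a) + (complex.Im k)%:C%C *: ((-1)%:C%C *: a).
    by rewrite kE scalerDr !(scalerA i) !(mulrC i) -!scalerA iiE.
  rewrite /phi gD scalerDr gD ik kE !gD !gZ.
  case: k {kE ik} => x y /=; apply/eqP; rewrite eq_complex /=.
  by apply/andP; split; apply/eqP; ring.
have phiRe a : complex.Re (phi a) = g a by [].
have phin a : rnorm (phi a) <= rnorm a.
  have [w wn wE] := unimodular (phi a).
  have E : phi (w *: a) = (rnorm (phi a))%:C%C by rewrite funZ.
  have := gn (w *: a); rewrite -phiRe E /= rnormZ wn mul1r //.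
exists phi; last by rewrite phi_sa ?fe// starM esa.
have phipos : positive_functional phi.
  split => // b; have bsa : star (star b ** b) = star b ** b by rewrite starM starKE.
  rewrite phi_sa// ler0c.
  have [->|b0] := eqVneq b 0.
    by have := fZ 0 0; rewrite cmulr0 scale0r mul0r => ->.
  have {}b0 : 0 < rnorm b.
    rewrite lt_def rnorm_ge0 andbT; apply: contra b0 => /eqP/rnorm_eq0 ->; exact: eqxx.
  have nsq (x : A) : 0 < rnorm x -> star ((rnorm x)^-1%:C%C *: x) ** ((rnorm x)^-1%:C%C *: x)
      = ((rnorm x ^+ 2)^-1)%:C%C *: (star x ** x).
    move=> x0; rewrite starZC cmulZl cmulZr scalerA -rmorphM -invfM -expr2 //.
  have nsq1 (x : A) : 0 < rnorm x -> rnorm (star ((rnorm x)^-1%:C%C *: x) ** ((rnorm x)^-1%:C%C *: x)) = 1.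
    move=> x0; rewrite nsq// rnormZC rcstar ger0_norm ?invr_ge0 ?sqr_ge0//.
    by rewrite mulVf// gt_eqF// exprn_gt0.
  have e'sa : star ((rnorm e)^-1%:C%C *: e) = (rnorm e)^-1%:C%C *: e by rewrite starZC esa.
  have := rnorm_sub_le1 e'sa; have := nsq1 e e0; rewrite e'sa => -> /(_ _ (lexx _)).
  have := nsq1 b b0 => H /(_ ((rnorm b)^-1%:C%C *: b)); rewrite H => /(_ (lexx _)).
  move/(le_trans (fn _)).
  have := nsq e e0; rewrite e'sa esa => ->; rewrite nsq//.
  rewrite fD -scaleN1r -(rmorphN1 (real_complex R)) scalerA -rmorphM !fZ fe.
  rewrite rnorm_sa_sq// mulVf ?gt_eqF ?exprn_gt0// mulN1r.
  have : 0 < (rnorm b ^+ 2)^-1 by rewrite invr_gt0 exprn_gt0.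
  move: (_^-1) (f _) => u v u0; rewrite mulNr gerDl oppr_le0 pmulr_rge0//.
apply/statesP; split; first exact/quasi_statesP.
move=> d d0; exists (((rnorm e ^+ 2)^-1)%:C%C *: (e ** e)).
  rewrite rnormZC rnorm_sa_sq// ger0_norm ?invr_ge0 ?sqr_ge0// mulVf//.
  by rewrite gt_eqF// exprn_gt0.
rewrite funZ// phi_sa ?starM ?esa// fe -rmorphM rnormC rnorm_sa_sq//.
by rewrite mulVf ?gt_eqF ?exprn_gt0// normr1 gerBl ltW.
Qed.

End StateExistence.

(** * Direct sums of C*-algebras and their functionals *)

HB.saturate prod.

Lemma prod_complete (K : numFieldType) (A B : completeNormedModType K)
  (F : set_system (A * B)) : ProperFilter F -> cauchy F -> cvg F.
Proof.
move=> FF /cauchyP FC.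
have F1 : cauchy (fst @ F).
  apply/cauchyP => e /FC[x Fx]; exists x.1.
  by apply: (@filterS _ F _ _ _ _ Fx) => y [].
have F2 : cauchy (snd @ F).
  apply/cauchyP => e /FC[x Fx]; exists x.2.
  by apply: (@filterS _ F _ _ _ _ Fx) => y [].
move: F1 F2 => /cauchy_cvg/cvg_ex[l1 h1] /cauchy_cvg/cvg_ex[l2 h2].
apply/cvg_ex; exists (l1, l2).
have H : (fun x : A * B => (x.1, x.2)) @ F --> (l1, l2) by exact: cvg_pair.
move=> S /H FS; apply: (@filterS _ F _ _ _ _ FS) => -[x y]; exact.
Qed.

Section DirectSum.
Context (R : realType) (A B : cstarAlgebra R).
Local Notation AB := (A * B)%type.

HB.instance Definition _ := Uniform_isComplete.Build AB (@prod_complete _ A B).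

Lemma rnorm_prod (x : AB) : rnorm x = Num.max (rnorm x.1) (rnorm x.2).
Proof.
apply: complexI; rewrite rnormE prod_normE -!rnormE.
by rewrite /Order.max ltcR; case: ifP.
Qed.

Definition pmul (x y : AB) : AB := (x.1 ** y.1, x.2 ** y.2).
Definition pstar (x : AB) : AB := (star x.1, star x.2).

Lemma pmulA : associative pmul.
Proof. by move=> x y z; rewrite /pmul /= !cmulA. Qed.
Lemma pmulDl : left_distributive pmul +%R.
Proof. by move=> x y z; rewrite /pmul /= !cmulDl. Qed.
Lemma pmulDr : right_distributive pmul +%R.
Proof. by move=> x y z; rewrite /pmul /= !cmulDr. Qed.
Lemma pmulZl (k : R[i]) x y : pmul (k *: x) y = k *: pmul x y.
Proof. by rewrite /pmul /= !cmulZl. Qed.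
Lemma pmulZr (k : R[i]) x y : pmul x (k *: y) = k *: pmul x y.
Proof. by rewrite /pmul /= !cmulZr. Qed.
Lemma pstarK : involutive pstar.
Proof. by case=> x y; rewrite /pstar /= !starKE. Qed.
Lemma pstarD : {morph pstar : a b / a + b}.
Proof. by move=> x y; rewrite /pstar /= !starDE. Qed.
Lemma pstarZ (k : R[i]) x : pstar (k *: x) = k^* *: pstar x.
Proof. by rewrite /pstar /= !starZ. Qed.
Lemma pstarM x y : pstar (pmul x y) = pmul (pstar y) (pstar x).
Proof. by rewrite /pstar /pmul /= !starM. Qed.
Lemma pmul_norm x y : `|pmul x y| <= `|x| * `|y|.
Proof.
rewrite -!rnormE -rmorphM lecR !rnorm_prod ge_max.
by apply/andP; split; rewrite (le_trans (rcmul _ _))// ler_pM ?rnorm_ge0//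
  le_max lexx ?orbT.
Qed.
Lemma pcstar_norm x : `|pmul (pstar x) x| = `|x| ^+ 2.
Proof.
rewrite -!rnormE -rmorphXn !rnorm_prod /= !rcstar; congr (_%:C)%C.
have := rnorm_ge0 x.1; have := rnorm_ge0 x.2.
move: (rnorm x.1) (rnorm x.2) => u v v0 u0.
by rewrite /Order.max ltr_pXn2r ?nnegrE//; case: ifP.
Qed.

HB.instance Definition _ := isCStarAlgebra.Build R AB
  pmulA pmulDl pmulDr pmulZl pmulZr pstarK pstarD pstarZ pstarM
  pmul_norm pcstar_norm.

End DirectSum.

Section DirectSumFunctionals.
Context (R : realType) (A B : cstarAlgebra R).
Local Notation AB := (A * B)%type.
Implicit Types (phi : functional R AB).

Definition inl_fun phi : functional R A := fun a => phi (a, 0).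
Definition inr_fun phi : functional R B := fun b => phi (0, b).
Definition join_fun (f : functional R A) (g : functional R B) : functional R AB :=
  fun d => f d.1 + g d.2 : R[i].

Lemma pair_split (d : AB) : d = (d.1, 0) + (0, d.2).
Proof. by case: d => a b; congr pair; rewrite /= ?addr0 ?add0r. Qed.

Lemma inl_positive phi : positive_functional phi -> positive_functional (inl_fun phi).
Proof.
move=> [lin pos]; split.
  move=> k a b; rewrite /inl_fun -lin; congr phi.
  by congr pair; rewrite /= scaler0 addr0.
move=> a; rewrite /inl_fun; have := pos (a, 0); congr (_ <= phi _).
by congr pair; rewrite /= cmulr0.
Qed.

Lemma inr_positive phi : positive_functional phi -> positive_functional (inr_fun phi).
Proof.
move=> [lin pos]; split.
  move=> k a b; rewrite /inr_fun -lin; congr phi.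
  by congr pair; rewrite /= scaler0 addr0.
move=> a; rewrite /inr_fun; have := pos (0, a); congr (_ <= phi _).
by congr pair; rewrite /= cmulr0.
Qed.

Lemma join_positive f g : positive_functional f -> positive_functional g ->
  positive_functional (join_fun f g).
Proof.
move=> [lf pf] [lg pg]; split.
  by move=> k a b; rewrite /join_fun /= lf lg mulrDr addrACA.
by move=> a; rewrite /join_fun /= addr_ge0 ?pf ?pg.
Qed.

Lemma fun_split phi d : GRing.linear_for *%R phi ->
  phi d = inl_fun phi d.1 + inr_fun phi d.2.
Proof. by move=> lin; rewrite {1}(pair_split d) funD. Qed.

Lemma inl_join f g : positive_functional g -> inl_fun (join_fun f g) = f.
Proof.
move=> pg; apply/funext => a; rewrite /inl_fun /join_fun /= fun0 ?addr0//.
exact: positive_linear.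
Qed.

Lemma inr_join f g : positive_functional f -> inr_fun (join_fun f g) = g.
Proof.
move=> pf; apply/funext => a; rewrite /inr_fun /join_fun /= fun0 ?add0r//.
exact: positive_linear.
Qed.

(** Near-maximizers on the two summands are rotated by unimodular scalars so that their values add
    up; the pair still has norm at most 1, so the norms of the restrictions add. *)
Lemma norm_split phi (c : R) : positive_functional phi ->
  (forall d, rnorm (phi d) <= c * rnorm d) ->
  exists c1 c2, [/\ 0 <= c1, 0 <= c2, functional_norm (inl_fun phi) = c1%:E,
    functional_norm (inr_fun phi) = c2%:E & functional_norm phi = (c1 + c2)%:E].
Proof.
move=> pos phic; have lin := positive_linear pos.
have pl := inl_positive pos; have pr := inr_positive pos.
have c0 : 0 <= `|c| by [].
have le1 a : rnorm ((a, 0) : AB) = rnorm a.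
  by rewrite rnorm_prod /= rnorm0 max_l// rnorm_ge0.
have le2 b : rnorm ((0, b) : AB) = rnorm b.
  by rewrite rnorm_prod /= rnorm0 max_r// rnorm_ge0.
have phic' d : rnorm (phi d) <= `|c| * rnorm d.
  by rewrite (le_trans (phic d))// ler_wpM2r ?rnorm_ge0 ?ler_norm.
have [|c1 c10 n1] := functional_norm_fin (c := `|c|) pl.
  by apply: functional_norm_le => // a; rewrite -(le1 a); exact: phic'.
have [|c2 c20 n2] := functional_norm_fin (c := `|c|) pr.
  by apply: functional_norm_le => // a; rewrite -(le2 a); exact: phic'.
exists c1, c2; split => //; apply/eqP; rewrite eq_le; apply/andP; split.
  apply: functional_norm_le => [|d]; first exact: addr_ge0.
  rewrite (fun_split d lin) (le_trans (rnormD _ _))// mulrDl lerD//.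
    rewrite (@le_trans _ _ (c1 * rnorm d.1)) ?ler_wpM2l ?rnorm_prod ?le_max ?lexx//.
    by apply: functional_norm_ub => //; rewrite n1.
  rewrite (@le_trans _ _ (c2 * rnorm d.2)) ?ler_wpM2l ?rnorm_prod ?le_max ?lexx ?orbT//.
  by apply: functional_norm_ub => //; rewrite n2.
apply/lee_addgt0Pr => e e0; have e20 : 0 < e / 2 by rewrite divr_gt0.
have [a a1 ae] := functional_norm_approx n1 e20.
have [b b1 be] := functional_norm_approx n2 e20.
have [w w1 wE] := unimodular (inl_fun phi a).
have [v v1 vE] := unimodular (inr_fun phi b).
rewrite -leeBlDr// (le_trans _ (@functional_norm_ge _ _ phi (w *: a, v *: b) _))//; last first.
  by rewrite rnorm_prod /= !rnormZ w1 v1 !mul1r ge_max a1 b1.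
rewrite (fun_split _ lin) /= (funZ (positive_linear pl)) (funZ (positive_linear pr)).
rewrite wE vE -rmorphD rnormC -EFinB lee_fin ger0_norm ?addr_ge0 ?rnorm_ge0//.
move: ae be; lra.
Qed.

Lemma join_norm f g (c1 c2 : R) : positive_functional f -> positive_functional g ->
  functional_norm f = c1%:E -> functional_norm g = c2%:E ->
  functional_norm (join_fun f g) = (c1 + c2)%:E.
Proof.
move=> pf pg n1 n2; have pj := join_positive pf pg.
have h (c : R) (C : cstarAlgebra R) (k : functional R C) : positive_functional k ->
    functional_norm k = c%:E -> 0 <= c.
  move=> [lin _] hc; rewrite -lee_fin -hc.
  by rewrite (le_trans _ (@functional_norm_ge _ _ k 0 _)) ?rnorm0// lee_fin rnorm_ge0.
have [|d1 [d2 [_ _ m1 m2 ->]]] := norm_split (c := c1 + c2) pj.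
  move=> d; rewrite /join_fun (le_trans (rnormD _ _))// mulrDl lerD//.
    rewrite (@le_trans _ _ (c1 * rnorm d.1)) ?ler_wpM2l ?rnorm_prod ?le_max ?lexx ?(h _ _ _ pf n1)//.
    by apply: functional_norm_ub => //; rewrite n1.
  rewrite (@le_trans _ _ (c2 * rnorm d.2)) ?ler_wpM2l ?rnorm_prod ?le_max ?lexx ?orbT ?(h _ _ _ pg n2)//.
  by apply: functional_norm_ub => //; rewrite n2.
move: m1 m2; rewrite inl_join// inr_join// n1 n2.
by move=> [<-] [<-].
Qed.

End DirectSumFunctionals.

Section Normalize.
Context (R : realType) (A : cstarAlgebra R).

Lemma normalize_state (phi : functional R A) (c : R) : 0 < c ->
  positive_functional phi -> functional_norm phi = c%:E ->
  states A (fun a => c^-1%:C%C * phi a : R[i]).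
Proof.
move=> c0 pos n; apply/statesP; split.
  apply/quasi_statesP; split; first by apply: positive_scale => //; rewrite invr_ge0 ltW.
  move=> a; rewrite rnormM_C rnormC ger0_norm ?invr_ge0 ?(ltW c0)// mulrC ler_pdivrMr//.
  by rewrite mulrC; apply: functional_norm_ub => //; rewrite n.
move=> e e0; have [a a1 ae] := functional_norm_approx n (mulr_gt0 c0 e0).
exists a => //; rewrite rnormM_C rnormC ger0_norm ?invr_ge0 ?(ltW c0)//.
by rewrite mulrC ler_pdivlMr// mulrBl mul1r mulrC ltW// mulrC.
Qed.

End Normalize.

(** * Lipschitz seminorms and the weak* topology *)

Section Gap.
Context (R : realType) (A : cstarAlgebra R) (S : set A).
Implicit Types (phi psi : functional R A).

(** [bl] and [mk] are both of this form, for the test sets [bl_ball] and [mk_ball] below. *)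
Definition gap phi psi : \bar R :=
  ereal_sup [set (rnorm (phi a - psi a))%:E | a in S].

Lemma gap_ge phi psi a : S a -> ((rnorm (phi a - psi a))%:E <= gap phi psi)%E.
Proof. by move=> Sa; apply: ereal_sup_ubound; exists a. Qed.

Lemma gap_le phi psi (r : \bar R) :
  (forall a, S a -> ((rnorm (phi a - psi a))%:E <= r)%E) -> (gap phi psi <= r)%E.
Proof. by move=> H; apply: ge_ereal_sup => _ [a Sa <-]; exact: H. Qed.

Lemma gapC phi psi : gap phi psi = gap psi phi.
Proof. by congr ereal_sup; apply: eq_imagel => a _; rewrite rdistC. Qed.

Lemma gap_ge0 phi psi : S !=set0 -> (0 <= gap phi psi)%E.
Proof. by move=> [a Sa]; apply: le_trans (gap_ge _ _ Sa); rewrite lee_fin rnorm_ge0. Qed.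

Lemma gap_refl phi : (gap phi phi <= 0)%E.
Proof. by apply: gap_le => a _; rewrite subrr rnorm0. Qed.

Lemma gap_triangle phi psi chi (r s : R) : (gap phi psi <= r%:E)%E ->
  (gap psi chi <= s%:E)%E -> (gap phi chi <= (r + s)%:E)%E.
Proof.
move=> h1 h2; apply: gap_le => a Sa; rewrite lee_fin (le_trans (rdistD _ (psi a) _))//.
by rewrite lerD// -lee_fin; [exact: le_trans (gap_ge _ _ Sa) h1|exact: le_trans (gap_ge _ _ Sa) h2].
Qed.

Lemma gap_scale phi psi (r t : R) a : GRing.linear_for *%R phi ->
  GRing.linear_for *%R psi -> (gap phi psi <= r%:E)%E -> 0 < t ->
  S (t^-1%:C%C *: a) -> rnorm (phi a - psi a) <= r * t.
Proof.
move=> l1 l2 gr t0 /(gap_ge phi psi) /le_trans/(_ gr); rewrite lee_fin !funZ// -mulrBr.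
by rewrite rnormM_C rnormC ger0_norm ?invr_ge0 ?(ltW t0)// mulrC ler_pdivrMr.
Qed.

End Gap.

Section Balls.
Context (R : realType) (A : cstarAlgebra R) (L : seminorm_data A).
Implicit Types (phi psi : functional R A) (M r t : R) (a b : A).

Definition bl_ball M : set A := [set a | dom_sa L a /\ norm_LM L M a <= 1].
Definition mk_ball : set A := [set a | dom_sa L a /\ L a <= 1].

Lemma mkE phi psi : mk L phi psi = gap mk_ball phi psi. Proof. by []. Qed.

Hypothesis Lsemi : is_seminorm L.

Lemma dom_sa0 : dom_sa L 0.
Proof. by case: Lsemi => L0 _ _ _ _; split => //; exact: star0. Qed.

Lemma lip0 : L 0 = 0.
Proof.
case: Lsemi => L0 _ _ LZ _; have := LZ 0 0 L0.
by rewrite scale0r rnorm0 mul0r.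
Qed.

Lemma dom_saZ t a : dom_sa L a -> dom_sa L (t%:C%C *: a).
Proof.
case: Lsemi => L0 Llin _ _ _ [da asa]; split; last by rewrite /selfadjoint /= starZC asa.
by have := Llin t%:C%C a 0 da L0; rewrite addr0.
Qed.

Lemma lipZ t a : dom_sa L a -> L (t%:C%C *: a) = `|t| * L a.
Proof. by case: Lsemi => _ _ _ LZ _ [da _]; rewrite LZ// rnormC. Qed.

Lemma lip_ge0 a : dom L a -> 0 <= L a.
Proof. by case: Lsemi => _ _ h _ _; exact: h. Qed.

Lemma norm_LMZ M t a : dom_sa L a -> 0 <= t ->
  norm_LM L M (t%:C%C *: a) = t * norm_LM L M a.
Proof.
move=> da t0; rewrite /norm_LM rnormZC lipZ// ger0_norm// -mulrA.
by rewrite maxr_pMr.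
Qed.

Lemma bl_ball0 M : bl_ball M !=set0.
Proof.
by exists 0; split; [exact: dom_sa0|rewrite /norm_LM rnorm0 lip0 mul0r maxxx].
Qed.

Lemma mk_ball0 : mk_ball !=set0.
Proof. by exists 0; split; [exact: dom_sa0|rewrite lip0]. Qed.

Lemma bl_scale M r t phi psi a : GRing.linear_for *%R phi ->
  GRing.linear_for *%R psi -> (bl L M phi psi <= r%:E)%E -> dom_sa L a ->
  0 < t -> norm_LM L M a <= t -> rnorm (phi a - psi a) <= r * t.
Proof.
move=> l1 l2 blr da t0 at_; apply: (gap_scale l1 l2 blr t0); split; first exact: dom_saZ.
by rewrite norm_LMZ ?invr_ge0 ?(ltW t0)// mulrC ler_pdivrMr// mul1r.
Qed.

Lemma mk_scale r t phi psi a : GRing.linear_for *%R phi ->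
  GRing.linear_for *%R psi -> (mk L phi psi <= r%:E)%E -> dom_sa L a ->
  0 < t -> L a <= t -> rnorm (phi a - psi a) <= r * t.
Proof.
move=> l1 l2 blr da t0 at_; apply: (gap_scale l1 l2 blr t0); split; first exact: dom_saZ.
by rewrite lipZ// ger0_norm ?invr_ge0 ?(ltW t0)// mulrC ler_pdivrMr// mul1r.
Qed.

End Balls.

Section WeakTopology.
Context (R : realType) (A : cstarAlgebra R).
Implicit Types (phi psi : functional R A) (a b : A) (e r : R).

Lemma near_functional phi a e : 0 < e ->
  \forall psi \near phi, rnorm (psi a - phi a) < e.
Proof.
move=> e0; have H := @proj_continuous A (fun=> R[i]^o) a phi.
exact: (H _ (nbhs_rnorm (phi a : R[i]^o) e0)).
Qed.

Lemma cvg_functional (F : set_system (functional R A)) phi : Filter F ->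
  (forall a e, 0 < e -> F [set psi | rnorm (psi a - phi a) < e]) ->
  F --> (phi : functional R A).
Proof.
move=> FF H.
apply/(@pointwise_cvgP A R[i]^o F phi FF) => a.
move=> S /nbhs_rnormP[e e0 eS].
by apply: (@filterS _ F FF _ _ _ (H a e e0)) => psi; rewrite /= rdistC; exact: eS.
Qed.

Variable L : seminorm_data A.
Hypothesis Lsemi : is_seminorm L.
Hypothesis Lherm : is_hermitian L.
Hypothesis Ldense : dense (dom L).

Lemma dom_re_im b : dom L b -> exists x y,
  [/\ dom_sa L x, dom_sa L y & b = x + 'i%C *: y].
Proof.
case: Lsemi => L0 Llin _ _ _ db; have [dbs _] := Lherm db.
have ii : 'i%C * 'i%C = -1 :> R[i] by rewrite -expr2 sqr_i.
have h : dom_sa L ((2^-1)%:C%C *: (b + star b)).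
  apply: dom_saZ => //; split; last by rewrite /selfadjoint /= starDE starKE addrC.
  by have := Llin 1 _ _ db dbs; rewrite scale1r.
have k : dom_sa L ((2^-1)%:C%C *: (- 'i%C *: (b - star b))).
  apply: dom_saZ => //; split; last first.
    have wi' : (- ('i%C : R[i]))^* = 'i%C by apply/eqP; rewrite eq_complex /= oppr0 opprK !eqxx.
    rewrite /selfadjoint /= starZ starB starKE wi'.
    by rewrite scaleNr -scalerN opprB.
  have d1 : dom L (b - star b).
    by have := Llin (-1) _ _ dbs db; rewrite scaleN1r addrC.
  by have := Llin (- 'i%C) _ _ d1 L0; rewrite addr0.
exists ((2^-1)%:C%C *: (b + star b)), ((2^-1)%:C%C *: (- 'i%C *: (b - star b))).
split => //; rewrite !scalerA.
have -> : 'i%C * (2^-1)%:C%C * - 'i%C = (2^-1)%:C%C :> R[i].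
  by rewrite mulrN mulrAC ii mulN1r opprK.
by rewrite -scalerDr addrACA subrr addr0 half_add.
Qed.

(** [bl] tests only self-adjoint elements of the domain, so [a] is approximated by some [b] in the
    domain, which is split into real and imaginary parts. Two errors [e / 8] and two errors [e / 4]
    add up to less than [e]. *)
Lemma bl_weak a e : 0 < e -> exists2 r, 0 < r & forall phi psi,
  states A phi -> states A psi -> (bl L 1 phi psi < r%:E)%E -> rnorm (phi a - psi a) < e.
Proof.
move=> e0; have e40 : 0 < e / 4 by rewrite divr_gt0.
have e80 : 0 < e / 8 by rewrite divr_gt0.
have [b db ab] := dense_near a Ldense e80.
have [x [y [dx dy bE]]] := dom_re_im db.
have ge0 z : dom_sa L z -> 0 <= norm_LM L 1 z.
  by move=> [dz _]; rewrite le_max divr_ge0// rnorm_ge0.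
pose t := norm_LM L 1 x + norm_LM L 1 y + 1.
have t0 : 0 < t by rewrite ltr_wpDl// addr_ge0 ?ge0.
exists (e / 4 / t); first by rewrite divr_gt0.
move=> phi psi phiS psiS /ltW blr.
have lp := positive_linear phiS.1; have lq := positive_linear psiS.1.
have hx : rnorm (phi x - psi x) <= e / 4.
  have := bl_scale Lsemi lp lq blr dx t0; rewrite divfK ?gt_eqF//; apply.
  by rewrite /t -addrA lerDl addr_ge0 ?ge0.
have hy : rnorm (phi y - psi y) <= e / 4.
  have := bl_scale Lsemi lp lq blr dy t0; rewrite divfK ?gt_eqF//; apply.
  by rewrite /t addrAC lerDr addr_ge0 ?ge0.
have i1 : rnorm ('i%C : R[i]) = 1.
  by rewrite /rnorm normc_def /= expr0n expr1n add0r sqrtr1.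
have hb : rnorm (phi b - psi b) <= e / 4 + e / 4.
  rewrite bE !funD// !funZ// opprD addrACA -mulrBr (le_trans (rnormD _ _))//.
  by rewrite rnormM_C i1 mul1r lerD.
have h1 : rnorm (phi a - phi b) <= e / 8.
  by rewrite -funB// (le_trans (state_bound _ phiS)).
have h2 : rnorm (psi b - psi a) <= e / 8.
  by rewrite -funB// (le_trans (state_bound _ psiS))// rdistC.
have h3 := rdistD (phi a) (phi b) (psi a).
have h4 := rdistD (phi b) (psi b) (psi a).
lra.
Qed.

(* Only this half of the condition on bl depends on L being a quantum metric: the
   converse half is bl_weak. *)
Definition weak_bl : Prop := forall phi r, states A phi -> 0 < r ->
  \forall psi \near phi, states A psi -> (bl L 1 phi psi < r%:E)%E.

Lemma induces_weak_bl : induces_topology_on (states A) (bl L 1) <-> weak_bl.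
Proof.
split.
- move=> ind phi r phiS r0.
  pose U := [set psi | states A psi /\ (bl L 1 phi psi < r%:E)%E].
  have [|_ [|O Oo UO]] := ind U; first by move=> psi [].
    move=> x [xS bx].
    have [s s0 bs] : exists2 s : R, 0 < s & (bl L 1 phi x <= (r - s)%:E)%E.
      have b0 : (0 <= bl L 1 phi x)%E by exact: (gap_ge0 _ _ (bl_ball0 Lsemi 1)).
      have : bl L 1 phi x \is a fin_num by rewrite ge0_fin_numE// (lt_trans bx)// ltry.
      move=> /fineK E; rewrite -E lte_fin in bx; rewrite -E.
      exists (r - fine (bl L 1 phi x)); first by rewrite subr_gt0.
      by rewrite subKr.
    exists (s / 2); first by rewrite divr_gt0.
    move=> y yS /ltW by_; split => //.
    have := gap_triangle bs by_; rewrite -/(bl L 1 phi y) => /le_lt_trans; apply.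
    rewrite lte_fin; lra.
  have Uphi : U phi.
    by split => //; apply: (le_lt_trans (gap_refl _ _)); rewrite lte_fin.
  have : nbhs phi O by apply: open_nbhs_nbhs; split => //; move: Uphi; rewrite UO => -[].
  apply: filterS => psi Opsi psiS; have : U psi by rewrite UO.
  by case.
- move=> wbl U US; split.
  * move=> [V Vo UE] x Ux; have xS := US _ Ux.
    (* [G] is the filter of [bl]-balls around [x]; by [bl_weak] it converges to [x] pointwise. *)
    pose G := filter_from [set r : R | 0 < r]
      (fun r => [set psi | states A psi /\ (bl L 1 x psi < r%:E)%E]).
    have FG : Filter G.
      apply: filter_from_filter; first by exists 1; exact: ltr01.
      move=> r s /= r0 s0; exists (Num.min r s); first by rewrite /= lt_min r0.
      by move=> psi [pS]; rewrite EFin_min lt_min => /andP[h1 h2]; split.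
    have Gx : G --> (x : functional R A).
      apply: cvg_functional => a e /(bl_weak a)[r r0 rP].
      exists r => // psi [pS blr] /=; rewrite rdistC; exact: rP.
    have : nbhs x V by apply: open_nbhs_nbhs; split => //; move: Ux; rewrite UE => -[].
    move=> /Gx[r r0 rO]; exists r => // y yS xy; rewrite UE; split => //.
    exact: rO.
  (* All functionals that are not states are included, so that the interior in the whole space meets
     the states exactly in [U]. *)
  * move=> H; exists (interior [set psi | states A psi -> U psi]); first exact: open_interior.
    apply/seteqP; split.
      move=> x Ux; split; last exact: US.
      have [r r0 rU] := H _ Ux.
      have := wbl x r (US _ Ux) r0.
      by apply: filterS => psi h pS; apply: rU => //; exact: h.
    by move=> x [/interior_subset h1 /h1].
Qed.

End WeakTopology.

(** * Change of the base state *)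

Section Pinning.
Context (R : realType) (A : cstarAlgebra R).
Implicit Types (mu nu : functional R A) (x b h : A).

Lemma bounded_rnorm (S : set A) : bounded_set S <-> exists C : R, forall x, S x -> rnorm x <= C.
Proof.
split.
  move=> [M [Mreal HM]].
  have ME : M = (complex.Re M)%:C%C by rewrite RRe_real.
  exists (complex.Re M + 1) => x Sx; rewrite rnorm_le; apply: HM => //=.
  by rewrite ME ltcR ltrDl.
move=> [C HC]; exists C%:C%C; split; first by rewrite complex_real.
move=> M CM x Sx; have MR : M = (complex.Re M)%:C%C.
  by rewrite RRe_real// -(subrK C%:C%C M) realD ?complex_real// gtr0_real// subr_gt0.
by apply: le_trans (ltW CM); rewrite -rnorm_le HC.
Qed.

Hypothesis Asep : separable A.

(* Cauchy-Schwarz for x - mu(x) 1, where an approximate unit replaces 1. *)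
Lemma multiplicative_domain mu x b : quasi_states A mu -> star x = x ->
  mu (x ** x) = mu x * mu x -> mu (x ** b) = mu x * mu b.
Proof.
move=> muQ xsa xx; have [pos mub] := (quasi_statesP mu).1 muQ.
have lin := positive_linear pos.
have mE := quasi_state_real Asep muQ xsa; set m := complex.Re (mu x) in mE.
apply: rnorm_eq_eps => e e0.
pose K := rnorm (mu (star b ** b)).
have K0 : 0 <= K by exact: rnorm_ge0.
(* The first bound makes [|m| d] at most [e / 2]; the second makes [2 |m| d K] at most [(e / 2)^2]
   in Cauchy-Schwarz. *)
pose d := Num.min (e / (2 * (`|m| + 1))) ((e / 2) ^+ 2 / (2 * (`|m| + 1) * (K + 1))).
have m1 : 0 < `|m| + 1 by rewrite ltr_wpDl.
have K1 : 0 < K + 1 by rewrite ltr_wpDl.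
have e2 : 0 < e / 2 by rewrite divr_gt0.
have d0 : 0 < d.
  by rewrite lt_min !divr_gt0 ?mulr_gt0 ?exprn_gt0.
have [u [usa u1 [[ux xu] [ub _]]]] : exists v, [/\ star v = v, rnorm v <= 1 &
    (rnorm (v ** x - x) <= d /\ rnorm (x ** v - x) <= d) /\
    (rnorm (v ** b - b) <= d /\ rnorm (b ** v - b) <= d)].
  have [u [[_ _ _ uP] usa u1]] := separable_approximate_unit Asep.
  have [N1 uN1] := uP x d d0; have [N2 uN2] := uP b d d0.
  exists (u (maxn N1 N2)); split => //; split.
    by apply: uN1; rewrite leq_max leqnn.
  by apply: uN2; rewrite leq_max leqnn orbT.
pose w := x - m%:C%C *: u.
have wsa : star w = w by rewrite /w starB starZC xsa usa.
have CS := cauchy_schwarz b w pos; rewrite wsa -/K in CS.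
have ww : rnorm (mu (w ** w)) <= 2 * `|m| * d.
  have [r0 rE] : 0 <= rnorm (mu (w ** w)) /\ mu (w ** w) = (rnorm (mu (w ** w)))%:C%C.
    by split; [exact: rnorm_ge0|rewrite -{1}wsa positive_real ?wsa].
  (* The expansion uses [mu (x ** x) = m^2]. The first two terms are small, and the last is
     nonpositive because [mu (u ** u)] is at most 1. *)
  have : mu (w ** w) = m%:C%C * (m%:C%C - mu (x ** u)) + m%:C%C * (m%:C%C - mu (u ** x))
      + m%:C%C * m%:C%C * (mu (u ** u) - 1).
    rewrite /w cmulBl !cmulBr !cmulZl !cmulZr scalerA !(funB lin) !(funZ lin) xx mE.
    by ring.
  have uu : mu (u ** u) = (rnorm (mu (u ** u)))%:C%C by rewrite -{1}usa positive_real ?usa.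
  have uu1 : rnorm (mu (u ** u)) <= 1.
    rewrite (le_trans (mub _))// (le_trans (rcmul _ _))//.
    by rewrite mulr_ile1 ?rnorm_ge0.
  have ReD (y z : R[i]) : complex.Re (y + z) = complex.Re y + complex.Re z by case: y z => [? ?] [].
  move=> /(congr1 (@complex.Re R)); rewrite !ReD uu => E.
  have {}E := etrans (congr1 (@complex.Re R) (esym rE)) E.
  have ReC (y : R) : complex.Re y%:C%C = y by [].
  rewrite ReC in E.
  have h1 : complex.Re (m%:C%C * (m%:C%C - mu (x ** u))) <= `|m| * d.
    rewrite (le_trans (Re_le_rnorm _))// rnormM_C rnormC ler_wpM2l//.
    by rewrite -mE -(funB lin) (le_trans (mub _))// rdistC.
  have h2 : complex.Re (m%:C%C * (m%:C%C - mu (u ** x))) <= `|m| * d.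
    rewrite (le_trans (Re_le_rnorm _))// rnormM_C rnormC ler_wpM2l//.
    by rewrite -mE -(funB lin) (le_trans (mub _))// rdistC.
  have h3 : complex.Re (m%:C%C * m%:C%C * ((rnorm (mu (u ** u)))%:C%C - 1)) <= 0.
    rewrite -rmorphM -(rmorph1 (real_complex R)) -rmorphB -rmorphM /=.
    by rewrite -expr2 mulr_ge0_le0 ?sqr_ge0// subr_le0.
  rewrite E; lra.
have wb : mu (w ** b) = mu (x ** b) - m%:C%C * mu (u ** b).
  by rewrite /w cmulBl cmulZl (funB lin) (funZ lin).
have hub : rnorm (mu (u ** b) - mu b) <= d by rewrite -(funB lin) (le_trans (mub _)).
have wb2 : rnorm (mu (w ** b)) <= e / 2.
  rewrite -(ler_pXn2r (ltn0Sn 1)) ?nnegrE ?rnorm_ge0 ?(ltW e2)//.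
  rewrite (le_trans CS)// (@le_trans _ _ ((K + 1) * (2 * (`|m| + 1) * d)))//.
    apply: ler_pM; rewrite ?rnorm_ge0 ?lerDl// (le_trans ww)//.
    by rewrite ler_wpM2r ?(ltW d0)// ler_wpM2l// lerDl.
  have dle : d <= (e / 2) ^+ 2 / (2 * (`|m| + 1) * (K + 1)) by rewrite ge_min lexx orbT.
  move: dle; rewrite ler_pdivlMr ?mulr_gt0// => dle; apply: le_trans dle.
  by rewrite le_eqVlt; apply/orP; left; apply/eqP; ring.
rewrite mE; have -> : mu (x ** b) - m%:C%C * mu b =
  mu (w ** b) + m%:C%C * (mu (u ** b) - mu b) by rewrite wb; ring.
rewrite (le_trans (rnormD _ _))// [e in leRHS](splitr e) lerD//.
rewrite rnormM_C rnormC (@le_trans _ _ ((`|m| + 1) * d))//.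
  by apply: ler_pM; rewrite ?rnorm_ge0 ?lerDl.
have dle : d <= e / (2 * (`|m| + 1)) by rewrite ge_min lexx.
move: dle; rewrite ler_pdivlMr ?mulr_gt0// => dle.
rewrite ler_pdivlMr// (le_trans _ dle)// le_eqVlt; apply/orP; left; apply/eqP; ring.
Qed.

(** [multiplicative_domain] extracts [h] on the left, and on the right after taking adjoints. *)
Lemma mu_compress mu h b : quasi_states A mu -> star h = h ->
  mu (h ** h) = mu h * mu h -> mu (h ** b ** h) = mu h * mu h * mu b.
Proof.
move=> muQ hsa hh; rewrite -cmulA (multiplicative_domain _ muQ hsa hh).
have -> : mu (b ** h) = mu b * mu h.
  have -> : b ** h = star (h ** star b) by rewrite starM starKE hsa.
  rewrite (quasi_state_star Asep _ muQ) (multiplicative_domain _ muQ hsa hh).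
  transitivity ((mu h)^* * (mu (star b))^*); first exact: rmorphM.
  by rewrite -!(quasi_state_star Asep _ muQ) starKE hsa; exact: mulrC.
by rewrite -[RHS]mulrA; congr (_ * _); exact: mulrC.
Qed.

(* Changing the state moves the constant t by a bounded amount, because mu(h a h)
   is mu(h) ^ 2 mu(a) on the multiplicative domain of mu. *)
Lemma repin (L : seminorm_data A) h nu mu : states A nu -> states A mu ->
  star h = h -> mu (h ** h) = mu h * mu h -> mu h != 0 :> R[i] ->
  bounded_set (pinned_ball L h nu) -> bounded_set (pinned_ball L h mu).
Proof.
move=> /state_quasi nuQ /state_quasi muQ hsa hh h0 /bounded_rnorm[C CP].
have [pos mub] := (quasi_statesP mu).1 muQ; have lin := positive_linear pos.
have mE := quasi_state_real Asep muQ hsa; set m := complex.Re (mu h) in mE.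
have m0 : 0 < m ^+ 2.
  rewrite exprn_even_gt0//=; apply: contra h0 => /eqP m0; by rewrite mE m0.
apply/bounded_rnorm; exists (C + C / m ^+ 2 * rnorm (h ** h)).
move=> x [b [t [db Lb bt ->]]].
have bE := quasi_state_real Asep nuQ db.2; set s := complex.Re (nu b) in bE.
have yb : pinned_ball L h nu (h ** b ** h + (- s)%:C%C *: (h ** h)).
  by exists b, (- s); split => //; rewrite opprK.
have yC := CP _ yb.
(* Evaluating [mu] at the bounded element isolates [(- s - t) m^2]. *)
have sC : `|- s - t| <= C / m ^+ 2.
  rewrite ler_pdivlMr//.
  have : rnorm (mu (h ** b ** h + (- s)%:C%C *: (h ** h))) <= C.
    by rewrite (le_trans (mub _)).
  rewrite (funD lin) (funZ lin) mu_compress// hh bt mE -!rmorphM -rmorphD rnormC.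
  have -> : m * m * - t + - s * (m * m) = (- s - t) * m ^+ 2 by ring.
  by rewrite normrM (ger0_norm (ltW m0)).
have -> : h ** b ** h + t%:C%C *: (h ** h) =
    (h ** b ** h + (- s)%:C%C *: (h ** h)) - (- s - t)%:C%C *: (h ** h).
  by rewrite rmorphB scalerBl opprB addrA addrAC addrK.
rewrite (le_trans (rnormB _ _))// lerD// rnormZC ler_wpM2r ?rnorm_ge0//.
Qed.

End Pinning.

Section WeakConvergence.
Context (R : realType) (A : cstarAlgebra R) (L : seminorm_data A).
Hypothesis Lsemi : is_seminorm L.
Hypothesis Lwb : weak_bl L.
Context (X : Type) (F : set_system X).
Hypothesis FF : Filter F.
Variables (G : X -> functional R A) (N : X -> R).
Variables (phi : functional R A) (c : R).
Hypothesis phipos : positive_functional phi.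
Hypothesis phic : functional_norm phi = c%:E.
Hypothesis c0 : 0 <= c.
Hypothesis GN : F [set x | positive_functional (G x) /\ functional_norm (G x) = (N x)%:E].
Hypothesis Nc : forall e : R, 0 < e -> F [set x | `|N x - c| <= e].
Hypothesis Gphi : forall a (e : R), 0 < e -> F [set x | rnorm (G x a - phi a) < e].

Lemma bl_ball_norm (M : R) a : 0 < M -> bl_ball L M a -> rnorm a <= M.
Proof.
by move=> M0 [_]; rewrite /norm_LM ge_max => /andP[+ _]; rewrite ler_pdivrMr// mul1r.
Qed.

(** The restriction of a state to one summand of a direct sum is a positive functional of varying
    norm. For [c > 0] the functionals are normalized and [weak_bl] applies; for [c = 0] the small
    norms alone suffice. *)
Lemma weak_bl_scaled (r : R) : 0 < r ->
  F [set x | forall a, bl_ball L 1 a -> rnorm (G x a - phi a) <= r].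
Proof.
move=> r0; have b1 a : bl_ball L 1 a -> rnorm a <= 1 by apply: bl_ball_norm.
have ub x a : positive_functional (G x) /\ functional_norm (G x) = (N x)%:E ->
    rnorm a <= 1 -> 0 <= N x /\ rnorm (G x a) <= N x.
  move=> [pG nG] a1; have := functional_norm_ge (G x) a1; rewrite nG lee_fin => h.
  by split => //; apply: le_trans h; exact: rnorm_ge0.
have linphi := positive_linear phipos.
have phi1 a : rnorm a <= 1 -> rnorm (phi a) <= c.
  by move=> a1; have := functional_norm_ge phi a1; rewrite phic lee_fin.
have FI := @filterI _ F FF.
move: c0; rewrite le_eqVlt => /predU1P[c00|cpos].
  have := FI _ _ GN (Nc r0); move=> FH; apply: (@filterS _ F FF _ _ _ FH) => x /= [h1 h2] a /b1 a1.
  have [N0 Gx] := ub x a h1 a1; have := phi1 a a1; rewrite -c00 => p0.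
  have -> : phi a = 0 by apply: rnorm_eq0; apply/eqP; rewrite eq_le p0 rnorm_ge0.
  rewrite subr0 (le_trans Gx)//; move: h2; rewrite -c00 subr0 ger0_norm//.
have psiS := normalize_state cpos phipos phic; set psi := (fun _ => _) in psiS.
have cN : F [set x | c / 2 <= N x].
  have c2 : 0 < c / 2 by rewrite divr_gt0.
  have := Nc c2; move=> FH; apply: (@filterS _ F FF _ _ _ FH) => x /=; rewrite ler_norml => /andP[h _]; lra.
pose H x : functional R A := fun a => (N x)^-1%:C%C * G x a : R[i].
have HS : F [set x | states A (H x) /\ 0 < N x].
  have := FI _ _ GN cN; move=> FH; apply: (@filterS _ F FF _ _ _ FH) => x /= [[pG nG] cNx].
  have N0 : 0 < N x by apply: lt_le_trans cNx; rewrite divr_gt0.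
  by split => //; exact: normalize_state.
have Hpsi : H @ F --> (psi : functional R A).
  apply: cvg_functional => a e e0.
  have k0 : 0 < e * c / 4 by rewrite divr_gt0// mulr_gt0.
  have l0 : 0 < e * c ^+ 2 / (4 * (rnorm (phi a) + 1)).
    by rewrite divr_gt0 ?mulr_gt0 ?exprn_gt0// ltr_wpDl ?rnorm_ge0.
  have := FI _ _ (FI _ _ cN (Gphi a k0)) (Nc l0).
  move=> FH; apply: (@filterS _ F FF _ _ _ FH) => x /= [[cNx h1] h2].
  have N0 : 0 < N x by apply: lt_le_trans cNx; rewrite divr_gt0.
  rewrite /H /psi.
  have -> : (N x)^-1%:C%C * G x a - c^-1%:C%C * phi a =
      (N x)^-1%:C%C * (G x a - phi a) + ((N x)^-1 - c^-1)%:C%C * phi a.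
    by rewrite rmorphB /=; ring.
  rewrite (le_lt_trans (rnormD _ _))// !rnormM_C !rnormC (gtr0_norm (x := (N x)^-1)) ?invr_gt0//.
  have Ninv : (N x)^-1 <= 2 / c.
    by rewrite -[2 / c]invf_div lef_pV2 ?posrE ?divr_gt0.
  have t1 : (N x)^-1 * rnorm (G x a - phi a) < e / 2.
    apply: (@le_lt_trans _ _ (2 / c * rnorm (G x a - phi a))).
      by rewrite ler_wpM2r ?rnorm_ge0.
    rewrite mulrAC ltr_pdivrMr//; lra.
  have t2 : `|(N x)^-1 - c^-1| * rnorm (phi a) <= e / 2.
    have -> : (N x)^-1 - c^-1 = (c - N x) / (N x * c).
      by field; rewrite !gt_eqF.
    rewrite normrM normfV (gtr0_norm (mulr_gt0 N0 cpos)) distrC.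
    apply: (@le_trans _ _ (e * c ^+ 2 / (4 * (rnorm (phi a) + 1)) / (c / 2 * c) * (rnorm (phi a) + 1))).
      apply: ler_pM; rewrite ?rnorm_ge0 ?lerDl// ?divr_ge0 ?(ltW (mulr_gt0 N0 cpos))//.
      apply: ler_pM => //; first by rewrite invr_ge0 ltW ?mulr_gt0.
      by rewrite lef_pV2 ?posrE ?mulr_gt0 ?divr_gt0// ler_wpM2r// ltW.
    have p1 : 0 < rnorm (phi a) + 1 by rewrite ltr_wpDl ?rnorm_ge0.
    rewrite le_eqVlt; apply/orP; left; apply/eqP; field.
    by rewrite (gt_eqF cpos) (gt_eqF p1).
  lra.
have r1 : 0 < r / (2 * c) by rewrite divr_gt0 ?mulr_gt0.
have r2 : 0 < r / 2 by rewrite divr_gt0.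
have W : F [set x | states A (H x) -> (bl L 1 psi (H x) < (r / (2 * c))%:E)%E].
  exact: (Hpsi _ (Lwb psiS r1)).
have := FI _ _ (FI _ _ W HS) (Nc r2).
move=> FH; apply: (@filterS _ F FF _ _ _ FH) => x /= [[h1 [h2 N0]] h3] a ab.
have a1 := b1 _ ab; have {h1}/ltW h1 := h1 h2.
have := le_trans (gap_ge psi (H x) ab) h1; rewrite lee_fin rdistC => h4.
have h5 : rnorm (H x a) <= 1 by rewrite (le_trans (state_bound _ h2)).
(* The error splits into that of the norms and that of the normalized states. *)
have -> : G x a - phi a = (N x - c)%:C%C * H x a + c%:C%C * (H x a - psi a).
  have -> : G x a = (N x)%:C%C * H x a.
    by rewrite /H mulrA -rmorphM mulfV ?gt_eqF// mul1r.
  have -> : phi a = c%:C%C * psi a.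
    by rewrite /psi mulrA -rmorphM mulfV ?gt_eqF// mul1r.
  by rewrite rmorphB /=; ring.
rewrite (le_trans (rnormD _ _))// (rnormM_C (N x - c)%:C%C) (rnormM_C c%:C%C) !rnormC.
rewrite (gtr0_norm cpos) [r in leRHS](splitr r) lerD//.
  by apply: (le_trans _ h3); rewrite ler_piMr.
rewrite (le_trans (ler_wpM2l (ltW cpos) h4))// le_eqVlt; apply/orP; left; apply/eqP.
by field; rewrite gt_eqF.
Qed.

End WeakConvergence.

Lemma linear_scale (R : realType) (C E : cstarAlgebra R) (f : {linear C -> E}) (k : R[i]) x :
  f (k *: x) = k *: f x.
Proof. by rewrite linearZ. Qed.

(** * Direct sums of quantum metric spaces *)

Section DirectSumSeminorm.
Context (R : realType) (D1 D2 B : cstarAlgebra R).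
Variables (L1 : seminorm_data D1) (L2 : seminorm_data D2).
Variables (p1 : {linear D1 -> B}) (p2 : {linear D2 -> B}) (delta : R).
Local Notation D := (D1 * D2)%type.

Definition sumL : seminorm_data D := SeminormData
  [set d : D | dom L1 d.1 /\ dom L2 d.2]
  (fun d : D => Num.max (Num.max (L1 d.1) (L2 d.2)) (rnorm (p1 d.1 - p2 d.2) / delta)).

Definition sumT (T1 : set D1) (T2 : set D2) : set D := [set d : D | T1 d.1 /\ T2 d.2].

Hypothesis delta0 : 0 < delta.

Lemma sumL_le d r : sumL d <= r <->
  [/\ L1 d.1 <= r, L2 d.2 <= r & rnorm (p1 d.1 - p2 d.2) <= delta * r].
Proof.
rewrite /= !ge_max ler_pdivrMr// (mulrC r).
split; first by move=> /andP[/andP[-> ->] ->].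
by move=> [-> -> ->].
Qed.

Hypothesis S1 : is_seminorm L1.
Hypothesis S2 : is_seminorm L2.

Lemma sumL_seminorm : is_seminorm sumL.
Proof.
have [a1 b1 c1 d1 e1] := S1; have [a2 b2 c2 d2 e2] := S2.
split.
- by split.
- by move=> k a b /= [? ?] [? ?]; split; [exact: b1|exact: b2].
- by move=> a /= [h1 h2]; rewrite !le_max c1.
- move=> k a [h1 h2].
  have E : p1 (k *: a).1 - p2 (k *: a).2 = k *: (p1 a.1 - p2 a.2).
    by rewrite scalerBr -!linearZ.
  rewrite [LHS]/= [p1 _ - _]E d1// d2// rnormZ -mulrA.
  by rewrite !maxr_pMr ?rnorm_ge0.
- move=> a b [a1' a2'] [b1' b2']; apply/sumL_le => /=; split.
  + rewrite (le_trans (e1 _ _ a1' b1'))// lerD// !le_max lexx ?orbT//.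
  + rewrite (le_trans (e2 _ _ a2' b2'))// lerD// !le_max lexx ?orbT//.
  + have -> : p1 (a.1 + b.1) - p2 (a.2 + b.2) = (p1 a.1 - p2 a.2) + (p1 b.1 - p2 b.2).
      by rewrite (linearD p1) (linearD p2) opprD addrACA.
    rewrite mulrDr (le_trans (rnormD _ _))// lerD//.
    * by rewrite mulrC -ler_pdivrMr// le_max lexx orbT.
    * by rewrite mulrC -ler_pdivrMr// le_max lexx orbT.
Qed.

Lemma sumL_dom_sa d : dom_sa sumL d <-> dom_sa L1 d.1 /\ dom_sa L2 d.2.
Proof.
split; first by move=> [[h1 h2] /= e]; split; split => //; have := e; case: d {e h1 h2} => ? ? [].
by move=> [[h1 e1] [h2 e2]]; split => //=; case: d e1 e2 {h1 h2} => /= ? ? e1 e2; congr pair.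
Qed.

Hypothesis star1 : star_morphism p1.
Hypothesis star2 : star_morphism p2.

Lemma sumL_hermitian : is_hermitian L1 -> is_hermitian L2 -> is_hermitian sumL.
Proof.
move=> H1 H2 a [h1 h2]; have [e1 f1] := H1 _ h1; have [e2 f2] := H2 _ h2.
by split => //=; rewrite f1 f2 star1.2 star2.2 -starB rnorm_star.
Qed.

Lemma sumL_leibniz : is_leibniz L1 -> is_leibniz L2 -> is_leibniz sumL.
Proof.
move=> H1 H2 a b [a1 a2] [b1 b2].
have [d1 l1] := H1 _ _ a1 b1; have [d2 l2] := H2 _ _ a2 b2.
split => //.
have n1 (x : D) : rnorm x.1 <= rnorm x by rewrite rnorm_prod le_max lexx.
have n2 (x : D) : rnorm x.2 <= rnorm x by rewrite rnorm_prod le_max lexx orbT.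
have m1 (x : D) : L1 x.1 <= sumL x by rewrite /= !le_max lexx.
have m2 (x : D) : L2 x.2 <= sumL x by rewrite /= !le_max lexx orbT.
have m3 (x : D) : rnorm (p1 x.1 - p2 x.2) <= delta * sumL x.
  by rewrite mulrC -ler_pdivrMr//= le_max lexx orbT.
have g1 (x : D) : dom L1 x.1 -> 0 <= L1 x.1 by case: S1 => _ _ h _ _; exact: h.
have g2 (x : D) : dom L2 x.2 -> 0 <= L2 x.2 by case: S2 => _ _ h _ _; exact: h.
apply/sumL_le; split.
- by rewrite (le_trans l1)// lerD// ler_pM ?rnorm_ge0 ?g1.
- by rewrite (le_trans l2)// lerD// ler_pM ?rnorm_ge0 ?g2.
- rewrite /= star1.1 star2.1.
  (* One factor is changed at a time; the other is bounded by contractivity of [p1] or [p2]. *)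
  have -> : p1 a.1 ** p1 b.1 - p2 a.2 ** p2 b.2 =
     p1 a.1 ** (p1 b.1 - p2 b.2) + (p1 a.1 - p2 a.2) ** p2 b.2.
    by rewrite cmulBr cmulBl addrA subrK.
  rewrite (le_trans (rnormD _ _))// mulrDr lerD//.
    rewrite (le_trans (rcmul _ _))// mulrCA ler_pM ?rnorm_ge0//.
    by rewrite (le_trans (star_morphism_contractive _ star1)).
  rewrite (le_trans (rcmul _ _))// mulrA ler_pM ?rnorm_ge0//.
  by rewrite (le_trans (star_morphism_contractive _ star2)).
Qed.

Lemma image_unit (C E : cstarAlgebra R) (f : {linear C -> E}) u : star_morphism f ->
  (forall b, exists d, f d = b) -> is_unit u -> is_unit (f u).
Proof.
move=> [fM _] fsurj uu b; have [d <-] := fsurj b.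
by rewrite -!fM !(uu d).1 !(uu d).2.
Qed.

Lemma unit_uniq (C : cstarAlgebra R) (u v : C) : is_unit u -> is_unit v -> u = v.
Proof. by move=> uu uv; rewrite -(uv u).1 (uu v).2. Qed.

Hypothesis surj1 : forall b, exists d, p1 d = b.
Hypothesis surj2 : forall b, exists d, p2 d = b.
Hypothesis Bnz : exists b : B, b != 0.

Lemma unit_neq0 (u : B) : is_unit u -> u != 0.
Proof.
move=> uu; have [b b0] := Bnz; apply: contra b0 => /eqP u0.
by rewrite -(uu b).1 u0 cmul0r.
Qed.

Lemma unit_scale_inj (u : B) (k l : R[i]) : is_unit u -> k *: u = l *: u -> k = l.
Proof.
move=> /unit_neq0 u0 /eqP; rewrite -subr_eq0 -scalerBl scaler_eq0 (negPf u0) orbF subr_eq0.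
by move=> /eqP.
Qed.

(** In the kernel each component is 0 or a multiple of a unit, and the third term forces equal
    images in [B]. As [B] is nonzero, its unit identifies the two multiples, and kills a multiple
    that faces a summand without unit. *)
Lemma sumL_norm_modulo_constants : is_norm_modulo_constants L1 ->
  is_norm_modulo_constants L2 -> is_norm_modulo_constants sumL.
Proof.
move=> [nu1 un1] [nu2 un2].
have L0 d : dom sumL d -> sumL d = 0 -> [/\ L1 d.1 = 0, L2 d.2 = 0 & p1 d.1 = p2 d.2].
  move=> [h1 h2] L0; have [_ _ g1 _ _] := S1; have [_ _ g2 _ _] := S2.
  have /sumL_le[l1 l2 l3] : sumL d <= 0 by rewrite L0.
  split; [by apply/eqP; rewrite eq_le l1 g1|by apply/eqP; rewrite eq_le l2 g2|].
  apply/eqP; rewrite -subr_eq0; apply/eqP/rnorm_eq0/eqP; rewrite eq_le rnorm_ge0 andbT.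
  by rewrite mulr0 in l3.
have k1 u d : is_unit u -> dom L1 d -> L1 d = 0 -> exists k : R[i], d = k *: u.
  by move=> uu dd Ld; have : [set a | dom L1 a /\ L1 a = 0] d by []; rewrite (un1 u uu) => -[k _ <-]; exists k.
have k2 u d : is_unit u -> dom L2 d -> L2 d = 0 -> exists k : R[i], d = k *: u.
  by move=> uu dd Ld; have : [set a | dom L2 a /\ L2 a = 0] d by []; rewrite (un2 u uu) => -[k _ <-]; exists k.
split.
- move=> nuD [d1 d2] dd /(L0 _ dd)[/= h1 h2 h3]; have [/= dd1 dd2] := dd.
  have [[u1 uu1]|nu] := pselect (@unital R D1).
    have [[u2 uu2]|nu'] := pselect (@unital R D2).
      by case: nuD; exists (u1, u2) => -[x y]; split; congr pair; rewrite /= ?(uu1 x).1 ?(uu1 x).2 ?(uu2 y).1 ?(uu2 y).2.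
    have d20 := nu2 nu' _ dd2 h2; have [k kE] := k1 u1 d1 uu1 dd1 h1.
    have v1 := image_unit star1 surj1 uu1.
    move: h3; rewrite d20 kE linear0 linearZ /= => h3.
    have -> : k = 0 by apply: (unit_scale_inj v1); rewrite scale0r.
    by rewrite scale0r.
  have d10 := nu1 nu _ dd1 h1.
  have [[u2 uu2]|nu'] := pselect (@unital R D2); last by rewrite d10 (nu2 nu' _ dd2 h2).
  have [k kE] := k2 u2 d2 uu2 dd2 h2.
  have v2 := image_unit star2 surj2 uu2.
  move: h3; rewrite d10 kE linear0 linearZ /= => h3.
  have -> : k = 0 by apply: (unit_scale_inj v2); rewrite scale0r.
  by rewrite scale0r.
- move=> [u1 u2] uu.
  have uu1 : is_unit u1.
    by move=> x; have [e1 e2] := uu (x, 0); split; [have := congr1 fst e1|have := congr1 fst e2].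
  have uu2 : is_unit u2.
    by move=> x; have [e1 e2] := uu (0, x); split; [have := congr1 snd e1|have := congr1 snd e2].
  have v1 := image_unit star1 surj1 uu1; have v2 := image_unit star2 surj2 uu2.
  have v12 := unit_uniq v1 v2.
  apply/seteqP; split.
    move=> [d1 d2] [dd Ld]; have [/= h1 h2 h3] := L0 (d1, d2) dd Ld.
    have [/= dd1 dd2] := dd.
    have [k kE] := k1 u1 d1 uu1 dd1 h1; have [l lE] := k2 u2 d2 uu2 dd2 h2.
    have kl : k = l.
      by apply: (unit_scale_inj v2); move: h3; rewrite kE lE !linearZ /= v12.
    by exists k => //; rewrite kE lE kl.
  move=> d [k _ <-] /=.
  have m1 : [set a | dom L1 a /\ L1 a = 0] (k *: u1) by rewrite (un1 u1 uu1); exists k.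
  have m2 : [set a | dom L2 a /\ L2 a = 0] (k *: u2) by rewrite (un2 u2 uu2); exists k.
  split; first by split; [exact: m1.1|exact: m2.1].
  have E : p1 (k *: u1) - p2 (k *: u2) = 0.
    by rewrite (linear_scale p1) (linear_scale p2) v12 subrr.
  by rewrite m1.2 m2.2 E rnorm0 mul0r !maxxx.
Qed.

Lemma prod_dense (Y1 : set D1) (Y2 : set D2) : dense Y1 -> dense Y2 -> dense (sumT Y1 Y2).
Proof.
move=> h1 h2; apply: near_dense => a e e0.
have [x Yx ax] := dense_near a.1 h1 e0; have [y Yy ay] := dense_near a.2 h2 e0.
by exists (x, y) => //; rewrite rnorm_prod ge_max /= ax ay.
Qed.

Lemma prod_separable : separable D1 -> separable D2 -> separable D.
Proof.
move=> [Y1 c1 d1] [Y2 c2 d2]; exists (sumT Y1 Y2); last exact: prod_dense.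
have -> : sumT Y1 Y2 = Y1 `*` Y2 by [].
exact: countableX.
Qed.

(** The norms of the two restrictions are lower semicontinuous and add up to 1, so each of them
    converges; [weak_bl_scaled] then treats the summands separately. *)
Lemma sumL_weak_bl : weak_bl L1 -> weak_bl L2 -> weak_bl sumL.
Proof.
move=> w1 w2 phi r phiS r0.
have phipos := phiS.1; have lin := positive_linear phipos.
have phib (psi : functional R D) d : states D psi -> rnorm (psi d) <= 1 * rnorm d.
  by move=> psiS; rewrite mul1r; exact: state_bound.
have [c1 [c2 [c10 c20 n1 n2 n12]]] := norm_split phipos (fun d => phib phi d phiS).
have c12 : c1 + c2 = 1 by move: n12; rewrite phiS.2 => -[].
pose F := within (states D) (nbhs phi).
have FF : Filter F by exact: within_filter.
pose N1 (psi : functional R D) := fine (functional_norm (inl_fun psi)).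
pose N2 (psi : functional R D) := fine (functional_norm (inr_fun psi)).
have NE psi : states D psi -> [/\ functional_norm (inl_fun psi) = (N1 psi)%:E,
    functional_norm (inr_fun psi) = (N2 psi)%:E & N1 psi + N2 psi = 1].
  move=> psiS; have [d1 [d2 [_ _ m1 m2 m12]]] := norm_split psiS.1 (fun d => phib psi d psiS).
  by rewrite /N1 /N2 m1 m2 /=; split => //; move: m12; rewrite psiS.2 => -[].
have FS : F (states D).
  by rewrite /F /within /=; apply: (@filterS _ (nbhs phi) (nbhs_filter phi) setT) => //; exact: filterT.
have Fn a e : 0 < e -> F [set psi | rnorm (psi a - phi a) < e].
  move=> e0; have H := near_functional phi a e0.
  by rewrite /F /within /=; exact: (@filterS _ (nbhs phi) (nbhs_filter phi) _ _ (fun psi h _ => h) H).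
have FI := @filterI _ F FF.
have Nc e : 0 < e -> F [set psi | `|N1 psi - c1| <= e /\ `|N2 psi - c2| <= e].
  move=> e0; have e20 : 0 < e / 2 by rewrite divr_gt0.
  have [a a1 ae] := functional_norm_approx n1 e20.
  have [b b1 be] := functional_norm_approx n2 e20.
  have H := FI _ _ FS (FI _ _ (Fn (a, 0) _ e20) (Fn (0, b) _ e20)).
  apply: (@filterS _ F FF _ _ _ H) => psi /= [psiS [h1 h2]].
  have [m1 m2 m12] := NE psi psiS.
  have k1 : rnorm (inl_fun psi a) <= N1 psi by rewrite -lee_fin -m1; exact: functional_norm_ge.
  have k2 : rnorm (inr_fun psi b) <= N2 psi by rewrite -lee_fin -m2; exact: functional_norm_ge.
  have l1 := rnorm_sub (inl_fun phi a) (inl_fun psi a); rewrite rdistC in l1.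
  have l2 := rnorm_sub (inr_fun phi b) (inr_fun psi b); rewrite rdistC in l2.
  have {}l1 := le_lt_trans l1 h1; have {}l2 := le_lt_trans l2 h2.
  by rewrite !ler_norml; split; apply/andP; split; lra.
have FG1 : F [set psi | positive_functional (inl_fun psi) /\ functional_norm (inl_fun psi) = (N1 psi)%:E].
  apply: (@filterS _ F FF _ _ _ FS) => psi psiS; split; first exact: inl_positive psiS.1.
  by case: (NE psi psiS).
have FG2 : F [set psi | positive_functional (inr_fun psi) /\ functional_norm (inr_fun psi) = (N2 psi)%:E].
  apply: (@filterS _ F FF _ _ _ FS) => psi psiS; split; first exact: inr_positive psiS.1.
  by case: (NE psi psiS).
have Nc1 e : 0 < e -> F [set psi | `|N1 psi - c1| <= e].
  by move=> e0; apply: (@filterS _ F FF _ _ _ (Nc e e0)) => psi [].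
have Nc2 e : 0 < e -> F [set psi | `|N2 psi - c2| <= e].
  by move=> e0; apply: (@filterS _ F FF _ _ _ (Nc e e0)) => psi [].
have r40 : 0 < r / 4 by rewrite divr_gt0.
have H1 := @weak_bl_scaled R D1 L1 w1 _ F FF (@inl_fun R D1 D2) N1
  (inl_fun phi) c1 (inl_positive phipos) n1 c10 FG1
  Nc1
  (fun a e e0 => Fn (a, 0) e e0) _ r40.
have H2 := @weak_bl_scaled R D2 L2 w2 _ F FF (@inr_fun R D1 D2) N2
  (inr_fun phi) c2 (inr_positive phipos) n2 c20 FG2
  Nc2
  (fun a e e0 => Fn (0, a) e e0) _ r40.
have := FI _ _ H1 H2; rewrite /F /within /=.
move=> H; apply: (@filterS _ (nbhs phi) (nbhs_filter phi) _ _ _ H) => psi /= K psiS.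
have {K} [K1 K2] := K psiS.
have ll := positive_linear psiS.1.
apply: (@le_lt_trans _ _ (r / 4 + r / 4)%:E); last by rewrite lte_fin; lra.
apply: gap_le => a [/sumL_dom_sa[da1 da2]].
rewrite /norm_LM ge_max => /andP[na /sumL_le[la1 la2 _]].
rewrite divr1 in na; have := na; rewrite rnorm_prod ge_max => /andP[na1 na2].
rewrite lee_fin rdistC (fun_split a ll) (fun_split a lin) opprD addrACA.
rewrite (le_trans (rnormD _ _))// lerD//.
  by apply: K1; split => //; rewrite /norm_LM divr1 ge_max na1.
by apply: K2; split => //; rewrite /norm_LM divr1 ge_max na2.
Qed.

Lemma sumL_closed :
  (exists2 F : set D1, closed F & [set a | dom_sa L1 a /\ L1 a <= 1] = F `&` selfadjoint D1) ->
  (exists2 F : set D2, closed F & [set a | dom_sa L2 a /\ L2 a <= 1] = F `&` selfadjoint D2) ->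
  exists2 F : set D, closed F & [set a | dom_sa sumL a /\ sumL a <= 1] = F `&` selfadjoint D.
Proof.
move=> [F1 c1 E1] [F2 c2 E2].
exists ((fst @^-1` F1 `&` snd @^-1` F2) `&` [set d : D | rnorm (p1 d.1 - p2 d.2) <= delta]).
  apply: closedI.
    apply: closedI; first by apply: preimage_closed => // x _; exact: cvg_fst.
    by apply: preimage_closed => // x _; exact: cvg_snd.
  apply/closed_rnorm => x H; apply/ler_addgt0Pr => e e0 /=.
  have [s /= sd xs] := H _ (divr_gt0 e0 (ltr0Sn R 1)).
  have -> : p1 x.1 - p2 x.2 = (p1 s.1 - p2 s.2) + (p1 (x.1 - s.1) - p2 (x.2 - s.2)).
    rewrite (linearB p1) (linearB p2) opprB !addrA.
    by rewrite [RHS](ACl ((3*6)*(1*4)*(5*2)))/= !subrr !addr0.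
  rewrite (le_trans (rnormD _ _))// lerD// (le_trans (rnormB _ _))// [leRHS]splitr.
  move: xs; rewrite rnorm_prod ge_max /= => /andP[x1 x2].
  apply: lerD; [rewrite (le_trans (star_morphism_contractive _ star1))//|
                rewrite (le_trans (star_morphism_contractive _ star2))//].
apply/seteqP; split => [d [/sumL_dom_sa[d1 d2] /sumL_le[l1 l2 l3]]|d [[[f1 f2] f3] dsa]].
  have e1 : (F1 `&` selfadjoint D1) d.1 by rewrite -E1.
  have e2 : (F2 `&` selfadjoint D2) d.2 by rewrite -E2.
  split; last by case: d {l1 l2 l3} d1 d2 e1 e2 => x y /= d1 d2 [_ e1] [_ e2]; congr pair.
  by rewrite mulr1 in l3; split; [split; [exact: e1.1|exact: e2.1]|].
have s1 : star d.1 = d.1 by have := congr1 fst dsa.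
have s2 : star d.2 = d.2 by have := congr1 snd dsa.
have [e1 e1'] : [set a | dom_sa L1 a /\ L1 a <= 1] d.1 by rewrite E1.
have [e2 e2'] : [set a | dom_sa L2 a /\ L2 a <= 1] d.2 by rewrite E2.
by split; [exact/sumL_dom_sa|apply/sumL_le; rewrite mulr1; split].
Qed.

End DirectSumSeminorm.

Section DirectSumStates.
Context (R : realType) (D1 D2 : cstarAlgebra R).
Local Notation D := (D1 * D2)%type.

Lemma fst_state (f : functional R D1) : states D1 f ->
  states D (fun d => f d.1 : R[i]).
Proof.
move=> fS; have [[lin pos] fb] := (quasi_statesP f).1 (state_quasi fS).
apply/statesP; split.
  apply/quasi_statesP; split; first by split => [k a b|a] /=; [exact: lin|exact: pos].
  by move=> a; rewrite (le_trans (fb _))// rnorm_prod le_max lexx.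
move=> e e0; have [a a1 ae] := ((statesP f).1 fS).2 e e0.
by exists (a, 0) => //; rewrite rnorm_prod /= rnorm0 ge_max a1 ler01.
Qed.

(* nu1 and nu2 stand in for f1 and f2 when their coefficients vanish. *)
Lemma normalized_split (phi : functional R D) (nu1 : functional R D1) (nu2 : functional R D2) :
  quasi_states D phi -> exists c1 c2 f1 f2,
  [/\ 0 <= c1, 0 <= c2 & functional_norm phi = (c1 + c2)%:E] /\
  [/\ f1 = nu1 \/ states D1 f1, f2 = nu2 \/ states D2 f2 &
      phi = join_fun (fun a => c1%:C%C * f1 a : R[i]) (fun a => c2%:C%C * f2 a : R[i])].
Proof.
move=> phiQ; have [pos phib] := (quasi_statesP _).1 phiQ.
have lin := positive_linear pos.
have [|c1 [c2 [c10 c20 n1 n2 n12]]] := norm_split (c := 1) pos.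
  by move=> d; rewrite mul1r.
have pick (C : cstarAlgebra R) (f nu : functional R C) (c : R) :
    positive_functional f -> functional_norm f = c%:E -> 0 <= c ->
    exists2 g, g = nu \/ states C g & f = (fun a => c%:C%C * g a : R[i]).
  move=> pf nf; rewrite le_eqVlt => /predU1P[c0|c0].
    exists nu; [by left|apply/funext => a; rewrite -c0 mul0r; apply: rnorm_eq0; apply/eqP].
    rewrite eq_le rnorm_ge0 andbT.
    have := @functional_norm_ub _ _ f c a pf; rewrite nf -c0 mul0r; exact.
  exists (fun a => c^-1%:C%C * f a : R[i]); first by right; exact: normalize_state.
  by apply/funext => a; rewrite mulrA -rmorphM mulfV ?gt_eqF// mul1r.
have [g1 g1S E1] := pick _ _ nu1 _ (inl_positive pos) n1 c10.
have [g2 g2S E2] := pick _ _ nu2 _ (inr_positive pos) n2 c20.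
exists c1, c2, g1, g2; split => //; split => //; rewrite -E1 -E2.
by apply/funext => d; rewrite (fun_split d lin).
Qed.

Lemma state_split (phi : functional R D) (nu1 : functional R D1) (nu2 : functional R D2) :
  states D phi -> states D1 nu1 -> states D2 nu2 -> exists c1 c2 f1 f2,
  [/\ 0 <= c1, 0 <= c2 & c1 + c2 = 1] /\ [/\ states D1 f1, states D2 f2 &
      phi = join_fun (fun a => c1%:C%C * f1 a : R[i]) (fun a => c2%:C%C * f2 a : R[i])].
Proof.
move=> phiS s1 s2.
have [c1 [c2 [f1 [f2 [[c10 c20 n12] [q1 q2 E]]]]]] := normalized_split nu1 nu2 (state_quasi phiS).
exists c1, c2, f1, f2; split; first by split => //; move: n12; rewrite phiS.2 => -[].
by split => //; [case: q1 => [->|]|case: q2 => [->|]].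
Qed.

Lemma quasi_split (phi : functional R D) : quasi_states D phi -> exists c1 c2 f1 f2,
  [/\ 0 <= c1, 0 <= c2 & c1 + c2 <= 1] /\ [/\ quasi_states D1 f1, quasi_states D2 f2 &
      phi = join_fun (fun a => c1%:C%C * f1 a : R[i]) (fun a => c2%:C%C * f2 a : R[i])].
Proof.
move=> phiQ; have [c1 [c2 [f1 [f2 [[c10 c20 n12] [q1 q2 E]]]]]] :=
  normalized_split (fun=> 0 : R[i]) (fun=> 0 : R[i]) phiQ.
exists c1, c2, f1, f2; split; first by split => //; have := phiQ.2; rewrite n12 lee_fin.
by split => //; [case: q1 => [->|/state_quasi//]|case: q2 => [->|/state_quasi//]];
  exact: quasi_state0.
Qed.

Lemma scaled_norm (C : cstarAlgebra R) (f : functional R C) (c : R) : states C f ->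
  0 <= c -> functional_norm (fun a => c%:C%C * f a : R[i]) = c%:E.
Proof.
move=> fS; rewrite le_eqVlt => /predU1P[<-|c0].
  apply/eqP; rewrite eq_le; apply/andP; split.
    by apply: functional_norm_le => // a; rewrite !mul0r rnorm0.
  apply: le_trans (@functional_norm_ge _ _ _ 0 _); last by rewrite rnorm0.
  by rewrite lee_fin rnorm_ge0.
apply/eqP; rewrite eq_le; apply/andP; split.
  apply: functional_norm_le; first exact: ltW.
  by move=> a; rewrite rnormM_C rnormC gtr0_norm// ler_wpM2l ?(ltW c0)// state_bound.
apply/lee_addgt0Pr => e e0; have [a a1 ae] := ((statesP f).1 fS).2 _ (divr_gt0 e0 c0).
rewrite -leeBlDr// (le_trans _ (functional_norm_ge _ a1))// -EFinB lee_fin.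
rewrite rnormM_C rnormC gtr0_norm//.
have := ler_wpM2l (ltW c0) ae; rewrite mulrBr mulr1 mulrCA mulfV ?gt_eqF// mulr1 //.
Qed.

Lemma join_state (f1 : functional R D1) (f2 : functional R D2) (c1 c2 : R) :
  0 <= c1 -> 0 <= c2 -> c1 + c2 = 1 -> states D1 f1 -> states D2 f2 ->
  states D (join_fun (fun a => c1%:C%C * f1 a : R[i]) (fun a => c2%:C%C * f2 a : R[i])).
Proof.
move=> c10 c20 c12 s1 s2.
have p1 := positive_scale c10 s1.1; have p2 := positive_scale c20 s2.1.
split; first exact: join_positive.
by rewrite (join_norm p1 p2 (scaled_norm s1 c10) (scaled_norm s2 c20)) c12.
Qed.

End DirectSumStates.

Section DirectSumSpace.
Context (R : realType) (D1 D2 B : cstarAlgebra R).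
Variables (L1 : seminorm_data D1) (L2 : seminorm_data D2).
Variables (T1 : set D1) (T2 : set D2) (TB : set B) (muB : functional R B).
Variables (p1 : {linear D1 -> B}) (p2 : {linear D2 -> B}) (delta : R).
Local Notation D := (D1 * D2)%type.
Local Notation sumL := (sumL L1 L2 p1 p2 delta).
Hypothesis delta0 : 0 < delta.
Hypothesis sq1 : is_sqlcms L1.
Hypothesis sq2 : is_sqlcms L2.
Hypothesis top1 : is_topography L1 T1.
Hypothesis top2 : is_topography L2 T2.
Hypothesis star1 : star_morphism p1.
Hypothesis star2 : star_morphism p2.
Hypothesis surj1 : forall b, exists d, p1 d = b.
Hypothesis surj2 : forall b, exists d, p2 d = b.
Hypothesis pT1 : forall d, T1 d -> TB (p1 d).
Hypothesis pT2 : forall d, T2 d -> TB (p2 d).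
Hypothesis muBS : states B muB.
Hypothesis muBchar : restricts_to_character TB muB.

Let semi1 : is_seminorm L1. Proof. by case: sq1 => -[]. Qed.
Let semi2 : is_seminorm L2. Proof. by case: sq2 => -[]. Qed.
Let sep1 : separable D1. Proof. by case: sq1 => -[]. Qed.
Let sep2 : separable D2. Proof. by case: sq2 => -[]. Qed.

(** Each topography comes with its own base state; [repin] replaces it by one pulled back from [B],
    a reference common to both summands. [h] lies in the multiplicative domain of that state because
    [p] maps [T] into [TB]. *)
Lemma topography_pinned (C : cstarAlgebra R) (L : seminorm_data C) (T : set C)
    (p : {linear C -> B}) : separable C -> is_topography L T -> star_morphism p ->
  (forall b, exists d, p d = b) -> (forall d, T d -> TB (p d)) ->
  exists h, [/\ T h, dom L h, strictly_positive h & bounded_set (pinned_ball L h (muB \o p))].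
Proof.
move=> sep [_ _ [h [nu [[Th Lh hpos nuS] [_ bnd]]]]] st surj pT.
have muS := state_pullback st sep surj muBS.
exists h; split => //; apply: (repin sep nuS muS hpos.1) bnd.
  by rewrite /= st.1; apply: muBchar.1; exact: pT.
by rewrite gt_eqF//; exact: hpos.2 _ muS.
Qed.

(** The constant [t] is fixed by the first component. For the second it is off by at most [delta],
    since the images of the two components in [B] are within [delta]. *)
Lemma sum_pinned (h1 : D1) (h2 : D2) :
  bounded_set (pinned_ball L1 h1 (muB \o p1)) -> bounded_set (pinned_ball L2 h2 (muB \o p2)) ->
  bounded_set (pinned_ball sumL ((h1, h2) : D) (fun d => muB (p1 d.1) : R[i])).
Proof.
move=> /bounded_rnorm[C1 H1] /bounded_rnorm[C2 H2]; apply/bounded_rnorm.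
exists (Num.max C1 (C2 + delta * rnorm (h2 ** h2))) => x [b [t [bd Lb bt ->]]].
have [b1 b2] := (sumL_dom_sa _ _ _ _ _ _).1 bd.
have [l1 l2 l3] := (sumL_le L1 L2 p1 p2 delta0 b 1).1 Lb.
have x1 : rnorm (h1 ** b.1 ** h1 + t%:C%C *: (h1 ** h1)) <= C1.
  by apply: H1; exists b.1, t; split.
have mu2S := state_pullback star2 sep2 surj2 muBS.
have bE := quasi_state_real sep2 (state_quasi mu2S) b2.2.
set s := complex.Re _ in bE.
have x2 : rnorm (h2 ** b.2 ** h2 + (- s)%:C%C *: (h2 ** h2)) <= C2.
  by apply: H2; exists b.2, (- s); split => //; rewrite opprK.
have ts : `|t + s| <= delta.
  have := state_bound (p1 b.1 - p2 b.2) muBS.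
  rewrite (funB (positive_linear muBS.1)) bt.
  have -> : muB (p2 b.2) = s%:C%C by exact: bE.
  rewrite -rmorphB rnormC -opprD normrN => h; rewrite (le_trans h)//.
  by rewrite mulr1 in l3.
rewrite rnorm_prod ge_max; apply/andP; split.
  by rewrite le_max; apply/orP; left.
rewrite le_max; apply/orP; right.
have -> : (((h1, h2) : D) ** b ** (h1, h2) + t%:C%C *: (((h1, h2) : D) ** (h1, h2))).2 =
   (h2 ** b.2 ** h2 + (- s)%:C%C *: (h2 ** h2)) + (t + s)%:C%C *: (h2 ** h2).
  rewrite rmorphD rmorphN scalerDl scaleNr /=.
  by rewrite !addrA addrAC subrK.
rewrite (le_trans (rnormD _ _))// lerD// rnormZC ler_wpM2r ?rnorm_ge0//.
Qed.

Lemma sum_strictly_positive (h1 : D1) (h2 : D2) : strictly_positive h1 ->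
  strictly_positive h2 -> strictly_positive ((h1, h2) : D).
Proof.
move=> [s1 q1] [s2 q2]; split.
  by rewrite /selfadjoint /=; congr pair.
move=> phi phiS.
have mu1 := state_pullback star1 sep1 surj1 muBS.
have mu2 := state_pullback star2 sep2 surj2 muBS.
have [c1 [c2 [f1 [f2 [[c10 c20 c12] [S1 S2 ->]]]]]] := state_split phiS mu1 mu2.
rewrite /join_fun /=; have := q1 _ S1; have := q2 _ S2.
move: c10; rewrite le_eqVlt => /predU1P[c0|c0] h2' h1'.
  by rewrite -c0 mul0r add0r; move: c12; rewrite -c0 add0r => ->; rewrite mul1r.
apply: ltr_wpDr; first by rewrite mulr_ge0 ?ler0c// ltW.
by rewrite mulr_gt0// ltcR.
Qed.

Lemma sum_topography : is_topography sumL (sumT T1 T2).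
Proof.
have [h1 [Th1 Lh1 q1 b1]] := topography_pinned sep1 top1 star1 surj1 pT1.
have [h2 [Th2 Lh2 q2 b2]] := topography_pinned sep2 top2 star2 surj2 pT2.
have [[cl1 z1 lin1 mul1 st1] ab1 _] := top1; have [[cl2 z2 lin2 mul2 st2] ab2 _] := top2.
split.
- split.
  + apply/closed_rnorm => x H; split.
      apply: (closed_rnorm _).1 cl1 _ _ => e /H[s [s1 _] xs]; exists s.1 => //.
      by apply: le_trans xs; rewrite rnorm_prod le_max lexx.
    apply: (closed_rnorm _).1 cl2 _ _ => e /H[s [_ s2] xs]; exists s.2 => //.
    by apply: le_trans xs; rewrite rnorm_prod le_max lexx orbT.
  + by split.
  + by move=> k a b [? ?] [? ?]; split; [exact: lin1|exact: lin2].
  + by move=> a b [? ?] [? ?]; split; [exact: mul1|exact: mul2].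
  + by move=> a [? ?]; split; [exact: st1|exact: st2].
- move=> a b [a1 a2] [b1' b2']; congr pair; [exact: ab1|exact: ab2].
- exists ((h1, h2) : D), (fun d => muB (p1 d.1) : R[i]); split; last split.
  + split => //; first exact: sum_strictly_positive.
    by apply: (@fst_state _ _ _ (muB \o p1)); exact: state_pullback.
  + split; first by move=> a b [a1 _] [b1' _] /=; rewrite star1.1; apply: muBchar.1; exact: pT1.
    exists (h1, h2) => //=; rewrite gt_eqF//.
    exact: q1.2 _ (state_pullback star1 sep1 surj1 muBS).
  + exact: sum_pinned.
Qed.

Lemma sum_sqlcms : is_sqlcms sumL.
Proof.
have [h1 [Th1 Lh1 q1 b1]] := topography_pinned sep1 top1 star1 surj1 pT1.
have [h2 [Th2 Lh2 q2 b2]] := topography_pinned sep2 top2 star2 surj2 pT2.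
have [[_ _ her1 lei1 nm1] den1 ind1 clo1 _] := sq1.
have [[_ _ her2 lei2 nm2] den2 ind2 clo2 _] := sq2.
have Bnz : exists b : B, b != 0.
  have [b _ bn] := muBchar.2; exists b; apply: contra bn => /eqP ->.
  by rewrite (fun0 (positive_linear muBS.1)).
have mu1 := state_pullback star1 sep1 surj1 muBS.
have semi := @sumL_seminorm R D1 D2 B L1 L2 p1 p2 delta delta0 semi1 semi2.
have her : is_hermitian sumL by exact: sumL_hermitian.
have den : dense (dom sumL) by exact: prod_dense.
split => //.
- split => //; first exact: prod_separable.
    exact: sumL_leibniz.
  exact: sumL_norm_modulo_constants.
- apply/induces_weak_bl => //.
  by apply: sumL_weak_bl => //; apply/induces_weak_bl.
- exact: sumL_closed.
have muh : 0 < muB (p1 h1) by exact: q1.2 _ mu1.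
have muhE := ge0_rnorm (ltW muh); set m := rnorm _ in muhE.
have m0 : 0 < m by rewrite -ltcR -muhE.
have muS := fst_state D2 mu1.
have [hs hp] := sum_strictly_positive q1 q2.
(* The scaling makes the base state take the value 1 at this element. *)
exists ((m^-1)%:C%C *: ((h1, h2) : D)), (fun d => muB (p1 d.1) : R[i]); split => //.
- split; first by rewrite /selfadjoint /= starZC hs.
  move=> phi phiS; rewrite (funZ (positive_linear phiS.1)) mulr_gt0 ?hp// ltcR invr_gt0//.
- have -> : muB (p1 ((m^-1)%:C%C *: ((h1, h2) : D)).1) = (m^-1)%:C%C * muB (p1 h1).
    by rewrite -(funZ (positive_linear muBS.1)) -(linear_scale p1).
  by rewrite muhE -rmorphM mulVf ?gt_eqF.
- have /bounded_rnorm[C CP] := sum_pinned b1 b2.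
  apply/bounded_rnorm; exists ((m^-1) ^+ 2 * C) => x [b [t [bd Lb bt ->]]].
  set h : D := (h1, h2).
  have -> : (m^-1)%:C%C *: h ** b ** ((m^-1)%:C%C *: h) +
      t%:C%C *: ((m^-1)%:C%C *: h ** ((m^-1)%:C%C *: h)) =
      ((m^-1) ^+ 2)%:C%C *: (h ** b ** h + t%:C%C *: (h ** h)).
    rewrite !(cmulZl, cmulZr, scalerA) scalerDr !scalerA -!rmorphM /= -expr2.
    congr (_ + _%:C%C *: _); ring.
  rewrite rnormZC ger0_norm ?sqr_ge0// ler_wpM2l ?sqr_ge0// CP//.
  by exists b, t; split.
Qed.

Lemma sum_mk (nu1 : functional R D1) (nu2 : functional R D2) (C1 C2 : R) :
  (mk L1 nu1 (muB \o p1) <= C1%:E)%E -> (mk L2 (muB \o p2) nu2 <= C2%:E)%E ->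
  (mk sumL (fun d => nu1 d.1 : R[i]) (fun d => nu2 d.2 : R[i]) <= (C1 + C2 + delta)%:E)%E.
Proof.
move=> h1 h2; apply: gap_le => a [/sumL_dom_sa[a1 a2] /(sumL_le L1 L2 p1 p2 delta0)[l1 l2 l3]].
have k1 : rnorm (nu1 a.1 - muB (p1 a.1)) <= C1.
  by rewrite -lee_fin; apply: le_trans h1; exact: (@gap_ge _ _ (mk_ball L1) nu1 (muB \o p1)).
have k2 : rnorm (muB (p2 a.2) - nu2 a.2) <= C2.
  by rewrite -lee_fin; apply: le_trans h2; exact: (@gap_ge _ _ (mk_ball L2) (muB \o p2) nu2).
have k3 : rnorm (muB (p1 a.1) - muB (p2 a.2)) <= delta.
  rewrite -(funB (positive_linear muBS.1)) (le_trans (state_bound _ muBS))//.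
  by rewrite mulr1 in l3.
rewrite lee_fin.
have := rdistD (nu1 a.1) (muB (p1 a.1)) (nu2 a.2).
have := rdistD (muB (p1 a.1)) (muB (p2 a.2)) (nu2 a.2).
lra.
Qed.

(** A state of the sum is a convex combination of states of the summands. Each is approximated by
    states at finite distance from its own pin, and the last hypothesis links the two pins. *)
Lemma sum_pin (nu1 : functional R D1) (nu2 : functional R D2) (C : R) :
  is_pin L1 nu1 -> is_pin L2 nu2 ->
  (mk sumL (fun d => nu1 d.1 : R[i]) (fun d => nu2 d.2 : R[i]) <= C%:E)%E ->
  is_pin sumL (fun d => nu1 d.1 : R[i]).
Proof.
move=> [n1S d1] [n2S d2] nC; split; first exact: fst_state.
move=> phi phiS.
have [c1 [c2 [f1 [f2 [[c10 c20 c12] [S1 S2 phiE]]]]]] := state_split phiS n1S n2S.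
pose J (x : functional R D1 * functional R D2) : functional R D :=
  join_fun (fun a => c1%:C%C * x.1 a : R[i]) (fun a => c2%:C%C * x.2 a : R[i]).
have c1le : c1 <= 1 by rewrite -c12 lerDl.
have c2le : c2 <= 1 by rewrite -c12 lerDr.
pose F := filter_prod (nbhs f1) (nbhs f2).
have FF : Filter F by exact: filter_prod_filter.
have Jc : J @ F --> (phi : functional R D).
  apply: cvg_functional => a e e0.
  have e20 : 0 < e / 2 by rewrite divr_gt0.
  exists ([set g | rnorm (g a.1 - f1 a.1) < e / 2], [set g | rnorm (g a.2 - f2 a.2) < e / 2]).
    by split; exact: near_functional.
  move=> [g1 g2] [/= h1 h2]; rewrite phiE /J /join_fun /= opprD addrACA -!mulrBr.
  rewrite (le_lt_trans (rnormD _ _))// !rnormM_C !rnormC !ger0_norm//.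
  have k1 : c1 * rnorm (g1 a.1 - f1 a.1) <= rnorm (g1 a.1 - f1 a.1) by rewrite ler_piMl ?rnorm_ge0.
  have k2 : c2 * rnorm (g2 a.2 - f2 a.2) <= rnorm (g2 a.2 - f2 a.2) by rewrite ler_piMl ?rnorm_ge0.
  lra.
move=> W /Jc[[P Q] [/= nP nQ] PQW].
have [g1 [[g1S m1] Pg1]] := d1 _ S1 _ nP; have [g2 [[g2S m2] Qg2]] := d2 _ S2 _ nQ.
exists (J (g1, g2)); split; last exact: (PQW (g1, g2)).
split; first exact: join_state.
have fin (C0 : cstarAlgebra R) (L : seminorm_data C0) f g : is_seminorm L -> (mk L f g < +oo)%E ->
    exists K : R, mk L f g = K%:E.
  move=> sL h; exists (fine (mk L f g)); rewrite fineK// ge0_fin_numE//.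
  exact: gap_ge0 (mk_ball0 sL).
have [K1 E1] := fin _ _ _ _ semi1 m1; have [K2 E2] := fin _ _ _ _ semi2 m2.
apply: (@le_lt_trans _ _ (c1 * K1 + c2 * (K2 + C))%:E); last exact: ltry.
apply: gap_le => a ab; have [/sumL_dom_sa[a1 a2] /(sumL_le L1 L2 p1 p2 delta0)[l1 l2 l3]] := ab.
have k1 : rnorm (g1 a.1 - nu1 a.1) <= K1.
  by rewrite -lee_fin -E1; exact: (@gap_ge _ _ (mk_ball L1)).
have k2 : rnorm (g2 a.2 - nu2 a.2) <= K2.
  by rewrite -lee_fin -E2; exact: (@gap_ge _ _ (mk_ball L2)).
have k3 : rnorm (nu2 a.2 - nu1 a.1) <= C.
  by rewrite rdistC -lee_fin; apply: le_trans nC; exact: (gap_ge _ _ ab).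
have -> : J (g1, g2) a - nu1 a.1 =
   c1%:C%C * (g1 a.1 - nu1 a.1) + c2%:C%C * (g2 a.2 - nu1 a.1).
  have c12' : c1%:C%C + c2%:C%C = 1 :> R[i] by rewrite -rmorphD c12.
  rewrite /J /join_fun /= -[X in _ - X]mul1r -c12'; ring.
rewrite lee_fin (le_trans (rnormD _ _))// !rnormM_C !rnormC !ger0_norm//.
apply: lerD; apply: ler_wpM2l => //.
by rewrite (le_trans (rdistD _ (nu2 a.2) _))// lerD.
Qed.

End DirectSumSpace.

(** * Isometries from the direct sum *)

Section Proper.
Context (R : realType) (D A : cstarAlgebra R) (f : {linear D -> A}).

Lemma separable_proper : separable D -> star_morphism f ->
  (forall a, exists d, f d = a) -> proper_morphism f.
Proof.
move=> sep st surj; have [u [au usa u1]] := separable_approximate_unit sep.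
exists nat, (fun i j => is_true (i <= j)%N), u; split => //.
have [dir pos mono app] := au.
have fpos a : positive_element a -> positive_element (f a).
  by move=> [b ->]; exists (f b); rewrite st.1 st.2.
split => //=.
- move=> i; split; first by apply: fpos; case: (pos i).
  by rewrite (le_trans (star_morphism_contractive _ st))//; case: (pos i).
- by move=> i j ij; rewrite -linearB; apply: fpos; exact: mono.
- move=> a e e0; have [d <-] := surj a; have [i iP] := app d e e0.
  exists i => j ij; have [h1 h2] := iP j ij.
  by split; rewrite -st.1 -linearB (le_trans (star_morphism_contractive _ st)).
Qed.

End Proper.

Section IsometryLemmas.
Context (R : realType) (D A : cstarAlgebra R) (LD : seminorm_data D) (LA : seminorm_data A).
Variables (M : R) (f : {linear D -> A}).
Hypothesis iso : quantum_isometry LD LA M f.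

Lemma isometry_norm_le d : dom_sa LD d -> dom_sa LA (f d) /\ norm_LM LA M (f d) <= norm_LM LD M d.
Proof.
case: iso => [[st surj] pr im inf le] dd.
have fd : dom_sa LA (f d).
  split; first by rewrite -im; exists d => //; case: dd.
  by rewrite /selfadjoint /= -st.2; case: dd => _ ->.
split => //; rewrite -lee_fin (inf _ fd); apply: ereal_inf_lbound.
by exists d.
Qed.

Lemma isometry_lift a (e : R) : dom_sa LA a -> 0 < e ->
  exists d, [/\ dom_sa LD d, f d = a & norm_LM LD M d <= norm_LM LA M a + e].
Proof.
case: iso => [[st surj] pr im inf le] da e0.
have : (ereal_inf [set (norm_LM LD M d)%:E | d in [set d | dom_sa LD d /\ f d = a]] <
   (norm_LM LA M a + e)%:E)%E by rewrite -inf// lte_fin ltrDl.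
move=> /ereal_inf_lt[_ [d [dd fd] <-]]; rewrite lte_fin => /ltW h.
by exists d.
Qed.

End IsometryLemmas.

(* D stands for the direct sum of X1 and X2 in either order: q1 projects onto X1
   and pr forms pairs. *)
Section ProjectionIsometry.
Context (R : realType) (D X1 X2 B A : cstarAlgebra R).
Variables (LD : seminorm_data D) (L1 : seminorm_data X1) (L2 : seminorm_data X2).
Variables (LB : seminorm_data B) (LA : seminorm_data A).
Variables (TD : set D) (T1 : set X1) (T2 : set X2) (TB : set B) (TA : set A).
Variables (p1 : {linear X1 -> B}) (p2 : {linear X2 -> B}) (f : {linear X1 -> A}).
Variables (q1 : {linear D -> X1}) (pr : X1 -> X2 -> D) (M : R).
Hypothesis M0 : 0 < M.
Hypothesis Dsep : separable D.
Hypothesis q1star : star_morphism q1.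
Hypothesis q1pr : forall x y, q1 (pr x y) = x.
Hypothesis q1dom : forall d, dom LD d -> dom L1 (q1 d).
Hypothesis prdom : forall x y, dom L1 x -> dom L2 y -> dom LD (pr x y).
Hypothesis prdom_sa : forall x y, dom_sa L1 x -> dom_sa L2 y -> dom_sa LD (pr x y).
Hypothesis prnorm : forall x y, rnorm (pr x y) = Num.max (rnorm x) (rnorm y).
Hypothesis prL : forall x y r, p1 x = p2 y -> 0 <= r -> L1 x <= r -> L2 y <= r ->
  LD (pr x y) <= r.
Hypothesis q1L : forall d, L1 (q1 d) <= LD d.
Hypothesis q1T : forall d, TD d -> T1 (q1 d).
Hypothesis prT : forall x y, T1 x -> T2 y -> TD (pr x y).
Hypothesis iso1 : quantum_isometry L1 LB M p1.
Hypothesis iso2 : quantum_isometry L2 LB M p2.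
Hypothesis isof : quantum_isometry L1 LA M f.
Hypothesis topo1 : topographic L1 LB T1 TB p1.
Hypothesis topo2 : topographic L2 LB T2 TB p2.
Hypothesis topof : topographic L1 LA T1 TA f.
Hypothesis L1ge0 : forall x, dom L1 x -> 0 <= L1 x.

(** An element of [A] is lifted to [x] in [X1], and then [p1 x] to [y] in [X2]. The images in [B]
    agree, so [pr x y] has no mismatch term; each lift costs [e / 2]. *)
Lemma projection_isometry : quantum_isometry LD LA M (f \o q1 : {linear D -> A}).
Proof.
have [[stf surjf] prf imf inff lef] := isof.
have [[st1 surj1] pr1 im1 inf1 le1] := iso1.
have [[st2 surj2] pr2 im2 inf2 le2] := iso2.
have gst : star_morphism (f \o q1 : {linear D -> A}).
  by split => [a b|a] /=; rewrite ?q1star.1 ?stf.1 ?q1star.2 ?stf.2.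
have gsurj a : exists d, (f \o q1 : {linear D -> A}) d = a.
  by have [x <-] := surjf a; exists (pr x 0) => /=; rewrite q1pr.
have q1sa d : dom_sa LD d -> dom_sa L1 (q1 d).
  move=> [dd dsa]; split; first exact: q1dom.
  by rewrite /selfadjoint /= -q1star.2 dsa.
split => //.
- exact: separable_proper.
- apply/seteqP; split.
    by move=> _ [d dd <-]; rewrite -imf; exists (q1 d) => //; exact: q1dom.
  move=> a; rewrite -imf => -[x dx <-].
  have : dom LB (p1 x) by rewrite -im1; exists x.
  rewrite -im2 => -[y dy pxy].
  by exists (pr x y); [exact: prdom|rewrite /= q1pr].
- move=> a da; apply/eqP; rewrite eq_le; apply/andP; split.
    apply: le_ereal_inf_tmp => _ [d [dd /= fd] <-]; rewrite lee_fin.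
    have dq := q1sa _ dd.
    have [_] := isometry_norm_le isof dq; rewrite fd => /le_trans; apply.
    rewrite /norm_LM ge_max !le_max; apply/andP; split; apply/orP; [left|right; exact: q1L].
    by rewrite ler_pM2r ?invr_gt0// star_morphism_contractive.
  apply/lee_addgt0Pr => e e0; have e20 : 0 < e / 2 by rewrite divr_gt0.
  have [x [dx fx nx]] := isometry_lift isof da e20.
  have [dpx npx] := isometry_norm_le iso1 dx.
  have [y [dy py ny]] := isometry_lift iso2 dpx e20.
  apply: ge_ereal_inf; exists (norm_LM LD M (pr x y))%:E.
    by exists (pr x y) => //; split; [exact: prdom_sa|rewrite /= q1pr].
  rewrite -EFinD lee_fin.
  have n0 : 0 <= norm_LM L1 M x by rewrite le_max divr_ge0 ?rnorm_ge0 ?(ltW M0).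
  have k1 : norm_LM L1 M x <= norm_LM LA M a + e by lra.
  have k2 : norm_LM L2 M y <= norm_LM LA M a + e by lra.
  move: k1 k2; set nA := norm_LM LA M a.
  rewrite /norm_LM !ge_max => /andP[k1 k1'] /andP[k2 k2']; apply/andP; split.
    by rewrite prnorm ler_pdivrMr// ge_max -!ler_pdivrMr// k1 k2.
  by apply: prL => //; rewrite (le_trans _ k1')// L1ge0//; case: dx.
- by move=> d /q1sa dd /=; rewrite (le_trans (lef _ dd)).
Qed.

Lemma projection_topographic : topographic LD LA TD TA (f \o q1 : {linear D -> A}).
Proof.
split; first by move=> d /q1T /topof.1.
(* Two successive lifts, each at the cost of a factor [expR (e / 2)]. *)
move=> a e da Ta e0; have e20 : 0 < e / 2 by rewrite divr_gt0.
have [x [Tx dx fx nx Lx]] := topof.2 _ _ da Ta e20.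
have [dpx _] := isometry_norm_le iso1 dx.
have [y [Ty dy py ny Ly]] := topo2.2 _ _ dpx (topo1.1 _ Tx) e20.
have [[st1 _] _ _ _ le1] := iso1.
have e1 : 1 <= expR (e / 2) by rewrite ltW// expR_gt1.
have ee : expR e = expR (e / 2) * expR (e / 2) by rewrite -expRD -splitr.
have p0 : 0 <= expR (e / 2) by exact: expR_ge0.
have nx' : rnorm x <= expR e * rnorm a.
  rewrite (le_trans nx)// ee ler_wpM2r ?rnorm_ge0// ler_peMl//.
have ny' : rnorm y <= expR e * rnorm a.
  rewrite (le_trans ny)// ee -mulrA ler_wpM2l// (le_trans _ nx)//.
  exact: star_morphism_contractive.
have La0 : 0 <= LA a.
  have h := L1ge0 dx.1; have := le_trans h Lx; rewrite pmulr_rge0// expR_gt0//.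
have Lx' : L1 x <= expR e * LA a.
  by rewrite (le_trans Lx)// ee ler_wpM2r// ler_peMl.
have Ly' : L2 y <= expR e * LA a.
  by rewrite (le_trans Ly)// ee -mulrA ler_wpM2l// (le_trans _ Lx)// le1.
exists (pr x y); split => //=.
- exact: prT.
- exact: prdom_sa.
- by rewrite q1pr.
- by rewrite prnorm ge_max nx'.
- by apply: prL => //; rewrite mulr_ge0// expR_ge0.
Qed.

End ProjectionIsometry.

Section SumIsometries.
Context (R : realType) (D1 D2 B A C : cstarAlgebra R).
Variables (L1 : seminorm_data D1) (L2 : seminorm_data D2).
Variables (LB : seminorm_data B) (LA : seminorm_data A) (LC : seminorm_data C).
Variables (T1 : set D1) (T2 : set D2) (TB : set B) (TA : set A) (TC : set C).
Variables (p1 : {linear D1 -> B}) (p2 : {linear D2 -> B}).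
Variables (f : {linear D1 -> A}) (g : {linear D2 -> C}).
Variables (M delta : R).
Local Notation D := (D1 * D2)%type.
Local Notation sumL := (sumL L1 L2 p1 p2 delta).
Hypothesis M0 : 0 < M.
Hypothesis delta0 : 0 < delta.
Hypothesis sq1 : is_sqlcms L1.
Hypothesis sq2 : is_sqlcms L2.
Hypothesis iso1 : quantum_isometry L1 LB M p1.
Hypothesis iso2 : quantum_isometry L2 LB M p2.
Hypothesis topo1 : topographic L1 LB T1 TB p1.
Hypothesis topo2 : topographic L2 LB T2 TB p2.

Let semi1 : is_seminorm L1. Proof. by case: sq1 => -[]. Qed.
Let semi2 : is_seminorm L2. Proof. by case: sq2 => -[]. Qed.
Let sepD : separable D.
Proof. by apply: prod_separable; [case: sq1 => -[]|case: sq2 => -[]]. Qed.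

Let sumL_pr (x : D1) (y : D2) r : p1 x = p2 y -> 0 <= r -> L1 x <= r -> L2 y <= r ->
  sumL (x, y) <= r.
Proof.
move=> xy r0 h1 h2; apply/(sumL_le L1 L2 p1 p2 delta0); split => //=.
by rewrite xy subrr rnorm0 mulr_ge0// ltW.
Qed.

Lemma sum_isometry_fst : quantum_isometry L1 LA M f -> topographic L1 LA T1 TA f ->
  quantum_isometry sumL LA M (f \o fst : {linear D -> A}) /\
  topographic sumL LA (sumT T1 T2) TA (f \o fst : {linear D -> A}).
Proof.
move=> isof topof; split.
- apply: (@projection_isometry R D D1 D2 B A sumL L1 L2 LB LA p1 p2 f fst (fun x y => (x, y)) M) => //.
  + by move=> d [].
  + by move=> x y dx dy; apply/sumL_dom_sa.
  + by move=> x y; rewrite rnorm_prod.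
  + by move=> d; rewrite !le_max lexx.
  + by move=> x dx; exact: lip_ge0.
- apply: (@projection_topographic R D D1 D2 B A sumL L1 L2 LB LA (sumT T1 T2) T1 T2 TB TA p1 p2 f fst (fun x y => (x, y)) M) => //.
  + by move=> x y dx dy; apply/sumL_dom_sa.
  + by move=> x y; rewrite rnorm_prod.
  + by move=> d [].
  + by move=> x dx; exact: lip_ge0.
Qed.

Lemma sum_isometry_snd : quantum_isometry L2 LC M g -> topographic L2 LC T2 TC g ->
  quantum_isometry sumL LC M (g \o snd : {linear D -> C}) /\
  topographic sumL LC (sumT T1 T2) TC (g \o snd : {linear D -> C}).
Proof.
move=> isog topog; split.
- apply: (@projection_isometry R D D2 D1 B C sumL L2 L1 LB LC p2 p1 g snd (fun x y => (y, x)) M) => //.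
  + by move=> d [].
  + by move=> x y dx dy; apply/sumL_dom_sa.
  + by move=> x y; rewrite rnorm_prod maxC.
  + by move=> x y r xy r0 h1 h2; apply: sumL_pr.
  + by move=> d; rewrite !le_max lexx orbT.
  + by move=> x dx; exact: lip_ge0.
- apply: (@projection_topographic R D D2 D1 B C sumL L2 L1 LB LC (sumT T1 T2) T2 T1 TB TC p2 p1 g snd (fun x y => (y, x)) M) => //.
  + by move=> x y dx dy; apply/sumL_dom_sa.
  + by move=> x y; rewrite rnorm_prod maxC.
  + by move=> x y r xy r0 h1 h2; apply: sumL_pr.
  + by move=> d [].
  + by move=> x dx; exact: lip_ge0.
Qed.

End SumIsometries.

(** * Composition of tunnels *)

Section Inclusions.
Context (R : realType).

Definition compressed_near (D A : cstarAlgebra R) (L : seminorm_data D) (M : R)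
    (f : {linear D -> A}) (e : D) (x : R) : Prop :=
  forall phi, quasi_states D phi -> exists2 psi, quasi_states A psi &
    (bl L M (fun d => phi (e ** d ** e)) (psi \o f) <= x%:E)%E.

(* Tests the inclusion on a state that attains the norm of e ** e, at e ** e. *)
Lemma compressed_norm_bound (D A : cstarAlgebra R) (L : seminorm_data D) (M x : R)
    (f : {linear D -> A}) (e : D) :
  is_seminorm L -> is_leibniz L -> star_morphism f -> dom_sa L e -> 1 <= M -> 0 < x <= 1 ->
  2 * M * L e <= x -> compressed_near L M f e x -> rnorm e ^+ 2 <= 1 + x / M.
Proof.
move=> semi leib st de M1 /andP[x0 x1] Le near.
have M0 : 0 < M by apply: lt_le_trans M1.
have [N1|N1] := leP (rnorm e) 1.
  rewrite (@le_trans _ _ 1)//; first by rewrite expr_le1 ?rnorm_ge0.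
  by rewrite lerDl divr_ge0 ?ltW.
set N := rnorm e in N1 *; have N0 : 0 < N by apply: lt_trans N1.
have esa := de.2; have eesa : star (e ** e) = e ** e by rewrite starM esa.
have nee : rnorm (e ** e) = N ^+ 2 by rewrite rnorm_sa_sq.
have ee0 : e ** e != 0.
  by apply/eqP => E; move: nee; rewrite E rnorm0 => /esym/eqP; rewrite sqrf_eq0 gt_eqF.
have [phi phiS phiE] := exists_state eesa ee0.
have [psi psiQ blx] := near phi (state_quasi phiS).
have [dee Lee] := leib e e de.1 de.1.
have t0 : 0 < N ^+ 2 / M by rewrite divr_gt0// exprn_gt0.
(* [L (e ** e) <= 2 N L e <= N x / M] and [x <= 1 < N], so the Lipschitz part of [norm_LM] at
   [e ** e] does not exceed the norm part. *)
have LeN : L (e ** e) <= N ^+ 2 / M.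
  rewrite (le_trans Lee)// -/N ler_pdivlMr//.
  have -> : (N * L e + L e * N) * M = N * (2 * M * L e) by ring.
  by rewrite expr2 ler_pM2l// (le_trans Le)// (le_trans x1)// ltW.
have lphi : GRing.linear_for *%R (fun d => phi (e ** d ** e) : R[i]).
  exact: (positive_compress esa phiS.1).1.
have psifQ := quasi_state_pullback st psiQ.
have lpsi := positive_linear psifQ.1.
have := bl_scale (phi := fun d => phi (e ** d ** e) : R[i]) semi lphi lpsi blx (conj dee eesa : dom_sa L _) t0.
rewrite /norm_LM nee ge_max lexx LeN => /(_ isT).
have -> : e ** (e ** e) ** e = (e ** e) ** (e ** e) by rewrite !cmulA.
have -> : phi (e ** e ** (e ** e)) = (N ^+ 4)%:C%C.
  by rewrite phiE rnorm_sa_sq// nee -exprM.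
have h1 : rnorm (psi (f (e ** e))) <= N ^+ 2.
  rewrite -nee; exact: ((quasi_statesP _).1 psifQ).2.
have := rnorm_sub ((N ^+ 4)%:C%C : R[i]) (psi (f (e ** e))).
rewrite rnormC ger0_norm ?exprn_ge0 ?(ltW N0)// => h2 h3.
(* The inclusion gives [N^4 - N^2 <= x N^2 / M], which is then divided by [N^2]. *)
have h4 : N ^+ 2 * N ^+ 2 <= N ^+ 2 * (1 + x / M).
  have -> : N ^+ 2 * N ^+ 2 = N ^+ 4 by rewrite -exprD.
  rewrite mulrDr mulr1.
  have -> : N ^+ 2 * (x / M) = x * (N ^+ 2 / M) by ring.
  move: h1 h2 h3; rewrite /=; lra.
by rewrite -(ler_pM2l (exprn_gt0 2 N0)).
Qed.

(* Compressing by a product costs the norms of the extra factor g, up to the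
   scaling back into the unit ball. *)
Lemma compressed_product (D A : cstarAlgebra R) (L : seminorm_data D) (M x G : R)
    (f : {linear D -> A}) (e g : D) :
  0 < M -> 0 <= x -> star e = e -> star g = g -> e ** g = g ** e -> star_morphism f ->
  rnorm g ^+ 2 <= G -> 1 <= G -> compressed_near L M f e x ->
  forall phi, quasi_states D phi -> exists2 psi, quasi_states A psi &
    forall d, bl_ball L M d ->
      rnorm (phi ((e ** g) ** d ** (e ** g)) - psi (f d)) <= G * x + (G - 1) * M.
Proof.
move=> M0 x0 esa gsa eg st gG G1 near phi phiQ.
have G0 : 0 < G by apply: lt_le_trans G1.
have [pos phib] := (quasi_statesP _).1 phiQ.
(* [G] bounds the square of the norm of [g], so this multiple of the compression by [g] is a
   quasi-state. *)
pose phi' : functional R D := fun d => (G^-1)%:C%C * phi (g ** d ** g) : R[i].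
have phi'Q : quasi_states D phi'.
  apply/quasi_statesP; split.
    apply: (@positive_scale _ _ _ (fun d => phi (g ** d ** g) : R[i])).
      by rewrite invr_ge0 ltW.
    exact: positive_compress.
  move=> d; rewrite rnormM_C rnormC ger0_norm ?invr_ge0 ?(ltW G0)// mulrC ler_pdivrMr//.
  rewrite (le_trans (phib _))// (le_trans (rnorm_cmul3 _ _ _))//.
  by rewrite mulrAC -expr2 mulrC ler_wpM2l ?rnorm_ge0.
have [psi psiQ blx] := near phi' phi'Q; exists psi => // d db.
have h1 : rnorm (phi' (e ** d ** e) - psi (f d)) <= x.
  rewrite -lee_fin; apply: le_trans blx.
  exact: (gap_ge (fun d => phi' (e ** d ** e)) (psi \o f) db).
have h2 : rnorm (psi (f d)) <= M.
  have := ((quasi_statesP _).1 (quasi_state_pullback st psiQ)).2 d => /le_trans; apply.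
  exact: bl_ball_norm db.
have E : phi (e ** g ** d ** (e ** g)) = G%:C%C * phi' (e ** d ** e).
  rewrite /phi' mulrA -rmorphM mulfV ?gt_eqF// mul1r; congr phi.
  by rewrite {1}eg !cmulA.
have -> : phi (e ** g ** d ** (e ** g)) - psi (f d) =
    G%:C%C * (phi' (e ** d ** e) - psi (f d)) + (G - 1)%:C%C * psi (f d).
  by rewrite E rmorphB rmorph1; ring.
rewrite (le_trans (rnormD _ _))// (rnormM_C G%:C%C) (rnormM_C (G - 1)%:C%C) !rnormC.
rewrite gtr0_norm// ger0_norm ?subr_ge0// lerD//.
  by rewrite ler_wpM2l// ltW.
by rewrite ler_wpM2l// subr_ge0.
Qed.

(* Passes from D2 to A through B and D1, where g1 in D2 and e1 in D1 have the
   same image in B. *)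
Lemma compressed_transport (D1 D2 B A : cstarAlgebra R) (L1 : seminorm_data D1)
    (L2 : seminorm_data D2) (M x y c delta : R) (f : {linear D1 -> A})
    (p1 : {linear D1 -> B}) (p2 : {linear D2 -> B}) (e1 : D1) (e2 g1 : D2) :
  is_seminorm L2 -> is_leibniz L2 -> 0 < M ->
  star_morphism p1 -> star_morphism p2 -> dom_sa L2 g1 -> star e2 = e2 -> star e1 = e1 ->
  g1 ** e2 = e2 ** g1 -> p1 e1 = p2 g1 -> 0 < c -> 0 <= y ->
  rnorm g1 ^+ 2 + 2 * M * rnorm g1 * L2 g1 <= c ->
  compressed_near L1 M f e1 x -> compressed_near L2 M p2 e2 y ->
  forall phi, quasi_states D2 phi -> exists2 psi, quasi_states A psi &
    forall d1 d2, bl_ball L1 M d1 -> bl_ball L2 M d2 -> rnorm (p1 d1 - p2 d2) <= delta ->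
      rnorm (phi ((g1 ** e2) ** d2 ** (g1 ** e2)) - psi (f d1)) <=
        y * c + rnorm e1 ^+ 2 * delta + x.
Proof.
move=> semi2 leib2 M0 st1 st2 dg e2sa e1sa ge pe c0 y0 gc near1 near2 phi phiQ.
have [pos phib] := (quasi_statesP _).1 phiQ; have gsa := dg.2.
have [chi chiQ bly] := near2 phi phiQ.
have chi1Q := quasi_state_pullback st1 chiQ.
have chi2Q := quasi_state_pullback st2 chiQ.
have [psi psiQ blx] := near1 _ chi1Q; exists psi => // d1 d2 d1b d2b dd.
have lchi := positive_linear chiQ.1; have chib := ((quasi_statesP _).1 chiQ).2.
have Lg0 : 0 <= L2 g1 by case: dg => dg _; exact: lip_ge0 dg.
have G0 := rnorm_ge0 g1.
have [dd2 nd2] := d2b; have d2M := bl_ball_norm M0 d2b.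
have Ld2 : L2 d2 <= 1 by move: nd2; rewrite /norm_LM ge_max => /andP[].
have [dgd Lgd] := leib2 g1 d2 dg.1 dd2.1.
have [dgdg Lgdg] := leib2 (g1 ** d2) g1 dgd dg.1.
have Ld20 : 0 <= L2 d2 by exact: lip_ge0 dd2.1.
(* The Leibniz rule is applied twice, with [L2 d2 <= 1] and [rnorm d2 <= M]. *)
have ngdg : norm_LM L2 M (g1 ** d2 ** g1) <= c.
  rewrite /norm_LM ge_max; apply/andP; split.
    rewrite ler_pdivrMr// (le_trans (rnorm_cmul3 _ _ _))//.
    apply: (@le_trans _ _ (rnorm g1 ^+ 2 * M)).
      by rewrite mulrAC -expr2 ler_wpM2l ?sqr_ge0.
    rewrite ler_wpM2r ?(ltW M0)// (le_trans _ gc)// lerDl.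
    by rewrite !mulr_ge0 ?(ltW M0).
  rewrite (le_trans Lgdg)// (le_trans _ gc)//.
  have k1 := rcmul g1 d2.
  apply: (@le_trans _ _ (rnorm g1 * M * L2 g1 + (rnorm g1 * 1 + L2 g1 * M) * rnorm g1)).
    apply: lerD.
      by rewrite ler_wpM2r// (le_trans k1)// ler_wpM2l.
    rewrite ler_wpM2r// (le_trans Lgd)// lerD// ler_wpM2l//.
  rewrite le_eqVlt; apply/orP; left; apply/eqP; ring.
have dsa : dom_sa L2 (g1 ** d2 ** g1).
  by split => //; rewrite /selfadjoint /= !starM gsa dd2.2 cmulA.
have lphi : GRing.linear_for *%R (fun d => phi (e2 ** d ** e2) : R[i]).
  exact: (positive_compress e2sa phiQ.1).1.
have h1 := bl_scale (phi := fun d => phi (e2 ** d ** e2) : R[i]) semi2 lphi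
  (positive_linear chi2Q.1) bly dsa c0 ngdg.
have E : phi (g1 ** e2 ** d2 ** (g1 ** e2)) = phi (e2 ** (g1 ** d2 ** g1) ** e2).
  by congr phi; rewrite {1}ge !cmulA.
(* As [p2 g1 = p1 e1], the two elements of [B] are the compressions of [p2 d2] and [p1 d1] by the
   same element. *)
have h2 : rnorm (chi (p2 (g1 ** d2 ** g1)) - chi (p1 (e1 ** d1 ** e1))) <= rnorm e1 ^+ 2 * delta.
  rewrite -(funB lchi) (le_trans (chib _))//.
  rewrite !st2.1 !st1.1 -pe -cmulBl -cmulBr (le_trans (rnorm_cmul3 _ _ _))//.
  rewrite mulrAC -expr2; apply: ler_pM; rewrite ?sqr_ge0 ?rnorm_ge0//.
    by rewrite lerXn2r ?nnegrE ?rnorm_ge0 ?star_morphism_contractive.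
  by rewrite rdistC.
have h3 : rnorm (chi (p1 (e1 ** d1 ** e1)) - psi (f d1)) <= x.
  rewrite -lee_fin; apply: le_trans blx.
  exact: (gap_ge (fun d => (chi \o p1) (e1 ** d ** e1)) (psi \o f) d1b).
rewrite E (le_trans (rdistD _ (chi (p1 (e1 ** d1 ** e1))) _))// lerD//.
by rewrite (le_trans (rdistD _ (chi (p2 (g1 ** d2 ** g1))) _))// lerD.
Qed.

(** A quasi-state of the sum combines quasi-states of the summands with coefficients of sum at most
    1, and the same combination of the witnesses is a quasi-state of [A]. *)
Lemma sum_compressed_near (D1 D2 A : cstarAlgebra R) (L : seminorm_data (D1 * D2)%type)
    (M E : R) (q : {linear (D1 * D2)%type -> A}) (u1 : D1) (u2 : D2) :
  0 <= E ->
  (forall phi, quasi_states D1 phi -> exists2 psi, quasi_states A psi &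
    forall d : (D1 * D2)%type, bl_ball L M d -> rnorm (phi (u1 ** d.1 ** u1) - psi (q d)) <= E) ->
  (forall phi, quasi_states D2 phi -> exists2 psi, quasi_states A psi &
    forall d : (D1 * D2)%type, bl_ball L M d -> rnorm (phi (u2 ** d.2 ** u2) - psi (q d)) <= E) ->
  compressed_near L M q ((u1, u2) : (D1 * D2)%type) E.
Proof.
move=> E0 H1 H2 phi /quasi_split[c1 [c2 [f1 [f2 [[c10 c20 c12] [Q1 Q2 ->]]]]]].
have [psi1 psi1Q h1] := H1 _ Q1; have [psi2 psi2Q h2] := H2 _ Q2.
exists (fun a => c1%:C%C * psi1 a + c2%:C%C * psi2 a : R[i]).
  exact: quasi_state_convex.
apply: gap_le => d db; rewrite lee_fin /join_fun /=.
rewrite opprD addrACA -!mulrBr (le_trans (rnormD _ _))//.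
rewrite (rnormM_C c1%:C%C) (rnormM_C c2%:C%C) !rnormC !ger0_norm//.
have k1 := ler_wpM2l c10 (h1 d db); have k2 := ler_wpM2l c20 (h2 d db).
apply: (@le_trans _ _ ((c1 + c2) * E)); first by rewrite mulrDl lerD.
by rewrite ler_piMl.
Qed.

End Inclusions.

Section Extent.
Context (R : realType) (M : R) (A B : pointed_proper R).
Implicit Types (t : tunnel M A B) (x : R).

(** The extent with infima replaced by witnesses: a strict bound on the extent implies it, and it
    implies a weak one. *)
Definition extent_bound t x : Prop :=
  [/\ compressed_near (tn_lip t) M (tn_piA t) (tn_e t) x,
      compressed_near (tn_lip t) M (tn_piB t) (tn_e t) x,
      (mk (tn_lip t) (pp_pin A \o tn_piA t) (pp_pin B \o tn_piB t) <= x%:E)%E &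
      [/\ 2 * M * tn_lip t (tn_e t) <= x,
          rnorm (1 - pp_pin A (tn_piA t (tn_e t))) <= x &
          rnorm (1 - pp_pin B (tn_piB t (tn_e t))) <= x]].

Lemma almost_included_near (D C : cstarAlgebra R) (L : seminorm_data D) (f : {linear D -> C})
    (e : D) (eps x : R) : eps < x ->
  almost_included (bl L M) eps (compressed_quasi_states e) (pullback_quasi_states f) ->
  compressed_near L M f e x.
Proof.
move=> ex inc phi phiQ.
have := inc (fun d => phi (e ** d ** e)) (ex_intro2 _ _ phi phiQ erefl).
move=> /le_lt_trans/(_ (_ : (eps%:E < x%:E)%E)); rewrite lte_fin => /(_ ex).
by move=> /ereal_inf_lt[_ [_ [psi psiQ ->] <-]] /ltW h; exists psi.
Qed.

Lemma near_almost_included (D C : cstarAlgebra R) (L : seminorm_data D) (f : {linear D -> C})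
    (e : D) (x : R) : compressed_near L M f e x ->
  almost_included (bl L M) x (compressed_quasi_states e) (pullback_quasi_states f).
Proof.
move=> near _ [phi phiQ ->]; have [psi psiQ h] := near phi phiQ.
apply: ge_ereal_inf; exists (bl L M (fun d => phi (e ** d ** e)) (psi \o f)) => //.
by exists (psi \o f) => //; exists psi.
Qed.

Lemma extent_ltP t x : (extent t < x%:E)%E -> extent_bound t x.
Proof.
rewrite /extent !gt_max => /andP[/ereal_inf_lt[_ [eps [e0 h1 h2] <-]]].
rewrite lte_fin => ex /andP[/ltW h3]; rewrite lte_fin !gt_max => /andP[h4 /andP[h5 h6]].
split; [exact: almost_included_near ex h1|exact: almost_included_near ex h2|exact: h3|].
by split; exact: ltW.
Qed.

Lemma extent_le t x : 0 < x -> extent_bound t x -> (extent t <= x%:E)%E.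
Proof.
move=> x0 [h1 h2 h3 [h4 h5 h6]]; rewrite /extent !ge_max h3 /= lee_fin !ge_max h4 h5 h6 !andbT.
apply: ge_ereal_inf; exists x%:E => //; exists x => //.
by split => //; exact: near_almost_included.
Qed.

End Extent.

Section PointedProperFacts.
Context (R : realType) (A : pointed_proper R).

Lemma pp_sqlcms : is_sqlcms (pp_lip A). Proof. by case: (pp_axiom A). Qed.
Lemma pp_is_pin : is_pin (pp_lip A) (pp_pin A). Proof. by case: (pp_axiom A). Qed.
Lemma pp_state : states (pp_alg A) (pp_pin A). Proof. by case: pp_is_pin. Qed.
Lemma pp_char : restricts_to_character (pp_top A) (pp_pin A).
Proof. by case: (pp_axiom A). Qed.

End PointedProperFacts.

Section Composition.
Context (R : realType) (M : R) (A B C : pointed_proper R).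
Variables (t1 : tunnel M A B) (t2 : tunnel M B C) (x y : R).
Hypothesis M1 : 1 <= M.
Hypothesis x01 : 0 < x <= 1.
Hypothesis y01 : 0 < y <= 1.
Hypothesis b1 : extent_bound t1 x.
Hypothesis b2 : extent_bound t2 y.

Local Notation L1 := (tn_lip t1).
Local Notation L2 := (tn_lip t2).
Local Notation e1 := (tn_e t1).
Local Notation e2 := (tn_e t2).
Local Notation T1 := (@tn_top _ _ _ _ t1).
Local Notation T2 := (@tn_top _ _ _ _ t2).
Local Notation muA := (pp_pin A).
Local Notation muB := (pp_pin B).
Local Notation muC := (pp_pin C).
Local Notation fA := (tn_piA t1).
Local Notation p1 := (tn_piB t1).
Local Notation p2 := (tn_piA t2).
Local Notation fC := (tn_piB t2).

(* The slack in the choice of lifts, small enough to be absorbed in 5 x y. *)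
Let eta := x * y / (32 * M).
Let delta := x * y / 2.

Let x0 : 0 < x. Proof. by case/andP: x01. Qed.
Let y0 : 0 < y. Proof. by case/andP: y01. Qed.
Let x1 : x <= 1. Proof. by case/andP: x01. Qed.
Let y1 : y <= 1. Proof. by case/andP: y01. Qed.
Let M0 : 0 < M. Proof. exact: lt_le_trans M1. Qed.
Let xy0 : 0 < x * y. Proof. exact: mulr_gt0. Qed.
Let delta0 : 0 < delta. Proof. by rewrite divr_gt0. Qed.
Let eta0 : 0 < eta. Proof. by rewrite divr_gt0// mulr_gt0. Qed.
Let etaM : 32 * (eta * M) = x * y.
Proof. by rewrite /eta; field; rewrite gt_eqF. Qed.
Let eta_xy : 32 * eta <= x * y.
Proof. by rewrite -etaM ler_wpM2l// ler_peMr// ltW. Qed.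

Let eta1 : eta <= 1.
Proof.
have : x * y <= 1 by rewrite mulr_ile1 ?(ltW x0) ?(ltW y0).
by have := eta_xy; lra.
Qed.

Let sq1 := tn_sqlcms t1.
Let sq2 := tn_sqlcms t2.
Let semi1 : is_seminorm L1. Proof. by case: sq1 => -[]. Qed.
Let semi2 : is_seminorm L2. Proof. by case: sq2 => -[]. Qed.
Let leib1 : is_leibniz L1. Proof. by case: sq1 => -[]. Qed.
Let leib2 : is_leibniz L2. Proof. by case: sq2 => -[]. Qed.
Let iso_star (D E : cstarAlgebra R) (L : seminorm_data D) (L' : seminorm_data E)
  (f : {linear D -> E}) : quantum_isometry L L' M f -> star_morphism f.
Proof. by case=> -[]. Qed.
Let iso_surj (D E : cstarAlgebra R) (L : seminorm_data D) (L' : seminorm_data E)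
  (f : {linear D -> E}) : quantum_isometry L L' M f -> forall a, exists d, f d = a.
Proof. by case=> -[]. Qed.
Let iso_lip (D E : cstarAlgebra R) (L : seminorm_data D) (L' : seminorm_data E)
  (f : {linear D -> E}) : quantum_isometry L L' M f -> forall d, dom_sa L d -> L' (f d) <= L d.
Proof. by case. Qed.

(** An element of one space is carried to the other through the middle space, staying in the
    topographies and losing only a factor [1 + eta]. *)
Let lift_e (D E Z : cstarAlgebra R) (L : seminorm_data D) (L' : seminorm_data E)
    (LZ : seminorm_data Z) (T : set D) (T' : set E) (TZ : set Z)
    (p : {linear D -> Z}) (p' : {linear E -> Z}) e :
  quantum_isometry L LZ M p -> quantum_isometry L' LZ M p' ->
  topographic L LZ T TZ p -> topographic L' LZ T' TZ p' -> is_seminorm L ->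
  dom_sa L e -> T e -> exists g,
  [/\ T' g, dom_sa L' g, p' g = p e, rnorm g <= (1 + eta) * rnorm e & L' g <= (1 + eta) * L e].
Proof.
move=> iso iso' topo topo' semi de Te.
have [dp _] := isometry_norm_le iso de.
have [s sE] : exists s, expR s = 1 + eta by apply: expR_total; rewrite addr_gt0.
have s0 : 0 < s by rewrite -expR_gt1 sE ltrDl.
have [g [Tg dg pg ng Lg]] := topo'.2 _ _ dp (topo.1 _ Te) s0.
have p0 : 0 <= 1 + eta by rewrite ltW// addr_gt0.
exists g; split => //; rewrite sE in ng Lg.
  by rewrite (le_trans ng)// ler_wpM2l// (star_morphism_contractive _ (iso_star iso)).
by rewrite (le_trans Lg)// ler_wpM2l// (iso_lip iso).
Qed.

(** [(1 + z / 2)^2 >= 1 + z >= 1 + z / M]. *)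
Let N_bound (N z : R) : 0 <= N -> 0 < z <= 1 -> N ^+ 2 <= 1 + z / M -> N <= 1 + z / 2.
Proof.
move=> N0 /andP[z0 z1] h; have p0 : 0 <= 1 + z / 2 by rewrite addr_ge0// divr_ge0// ltW.
rewrite -(ler_pXn2r (ltn0Sn 1)) ?nnegrE// (le_trans h)//.
have : z / M <= z by rewrite ler_piMr ?(ltW z0)// invf_le1.
nra.
Qed.

(** Arithmetic for the summand handled by [compressed_product]. The term [(G - 1) M] is only [w] up
    to slack, because the square of the norm is bounded by [1 + w / M] and not merely by [1 + w];
    [(G - 1) z] contributes one [z w]. *)
Let product_const (z w G : R) : 0 < z <= 1 -> 0 < w <= 1 -> z * w = x * y ->
  G = (1 + eta) ^+ 2 * (1 + w / M) -> G * z + (G - 1) * M <= z + w + 5 * (x * y).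
Proof.
move=> /andP[z0 z1] /andP[w0 w1] zw ->.
have wM : w / M <= w by rewrite ler_piMr ?(ltW w0)// invf_le1.
have wM0 : 0 <= w / M by rewrite divr_ge0 ?ltW.
have wMM : w / M * M = w by rewrite divfK ?gt_eqF.
have e3 : (1 + eta) ^+ 2 <= 1 + 3 * eta by have := eta1; have := ltW eta0; nra.
have Gle : (1 + eta) ^+ 2 * (1 + w / M) <= 1 + w / M + 6 * eta.
  apply: (@le_trans _ _ ((1 + 3 * eta) * (1 + w / M))).
    by rewrite ler_wpM2r// addr_ge0.
  have := eta1; have := ltW eta0; nra.
set G' := _ * (1 + w / M) in Gle *.
apply: (@le_trans _ _ ((1 + w / M + 6 * eta) * z + (w / M + 6 * eta) * M)).
  by apply: lerD; rewrite ler_wpM2r ?(ltW z0) ?(ltW M0)//; lra.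
have -> : (w / M + 6 * eta) * M = w + 6 * (eta * M) by rewrite mulrDl wMM; ring.
have h : (1 + w / M + 6 * eta) * z <= z + z * w + 6 * eta.
  have k1 : w / M * z <= w * z by rewrite ler_wpM2r ?(ltW z0).
  have k2 : eta * z <= eta by rewrite ler_piMr ?(ltW eta0).
  nra.
rewrite zw in h; have := etaM; have := eta_xy; have := xy0; lra.
Qed.

(** Arithmetic for the summand handled by [compressed_transport], which fixes the coefficient 5:
    [3 z w] from the factor [1 + 3 z], at most [x y] from [delta] since [N^2 <= 2], and less than
    [x y] of slack. *)
Let transport_const (z w N : R) : 0 < z <= 1 -> 0 < w <= 1 -> z * w = x * y ->
  0 <= N -> N ^+ 2 <= 1 + z / M ->
  w * ((1 + eta) ^+ 2 * (1 + 3 * z)) + N ^+ 2 * delta + z <= z + w + 5 * (x * y).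
Proof.
move=> /andP[z0 z1] /andP[w0 w1] zw N0 NM.
have zM : z / M <= z by rewrite ler_piMr ?(ltW z0)// invf_le1.
have N2 : N ^+ 2 <= 2 by lra.
have e3 : (1 + eta) ^+ 2 <= 1 + 3 * eta by have := eta1; have := ltW eta0; nra.
have k1 : N ^+ 2 * delta <= x * y.
  by rewrite /delta; have := xy0; nra.
have k2 : (1 + eta) ^+ 2 * (1 + 3 * z) <= 1 + 3 * z + 12 * eta.
  apply: (@le_trans _ _ ((1 + 3 * eta) * (1 + 3 * z))).
    by rewrite ler_wpM2r// addr_ge0// mulr_ge0// ltW.
  have := eta1; have := ltW eta0; nra.
have k3 : w * ((1 + eta) ^+ 2 * (1 + 3 * z)) <= w * (1 + 3 * z + 12 * eta).
  by rewrite ler_wpM2l// ltW.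
have k4 : w * eta <= eta by rewrite ler_piMl ?(ltW eta0).
have := eta_xy; nra.
Qed.

(** [b g] is within [w] of 1, and [a g] is at most [z w] further away because [L g <= w].
    Multiplicativity of [a] then gives at most [z + w + 3 z w]. *)
Let pin_const (D : cstarAlgebra R) (L : seminorm_data D) (a b : functional R D) (e g : D) (z w : R) :
  0 < z <= 1 -> 0 < w <= 1 -> z * w = x * y -> is_seminorm L ->
  GRing.linear_for *%R a -> GRing.linear_for *%R b -> (mk L a b <= z%:E)%E ->
  dom_sa L g -> L g <= w -> a (e ** g) = a e * a g -> rnorm (1 - a e) <= z ->
  rnorm (1 - b g) <= w -> rnorm (1 - a (e ** g)) <= z + w + 5 * (x * y).
Proof.
move=> /andP[z0 z1] /andP[w0 w1] zw semi la lb mkz dg Lg -> ae bg.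
have h := mk_scale semi la lb mkz dg w0 Lg.
have ag : rnorm (1 - a g) <= w + z * w.
  rewrite (le_trans (rdistD _ (b g) _))// lerD// rdistC//.
have ae1 : rnorm (a e) <= 2.
  have := rnorm_sub (a e) 1; rewrite rdistC rnorm1; lra.
have -> : 1 - a e * a g = (1 - a g) + (1 - a e) * (a g - 1) + (1 - a e) by ring.
rewrite (le_trans (rnormD _ _))// (le_trans (lerD (rnormD _ _) (lexx _)))//.
rewrite rnormM_C (rdistC (a g)) -zw.
have := rnorm_ge0 (1 - a g); have := rnorm_ge0 (1 - a e).
have k : rnorm (1 - a e) * rnorm (1 - a g) <= z * (w + z * w) by rewrite ler_pM ?rnorm_ge0.
have k2 : z * (z * w) <= z * w by rewrite ler_piMl// mulr_ge0// ltW.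
have k3 : 0 <= z * w by rewrite mulr_ge0// ltW.
rewrite mulrDr in k; lra.
Qed.

Let small_lip (L' L'' w : R) : 0 < w <= 1 -> 2 * M * L'' <= w -> L' <= (1 + eta) * L'' -> 0 <= L'' ->
  2 * M * L' <= (1 + eta) * w /\ L' <= w.
Proof.
move=> /andP[w0 w1] h h' L0.
have e0 := ltW eta0.
have k : 2 * M * L' <= (1 + eta) * w.
  apply: (@le_trans _ _ ((1 + eta) * (2 * M * L''))).
    by rewrite mulrCA ler_pM2l// mulr_gt0.
  by rewrite ler_wpM2l// addr_ge0.
split => //.
have [L'0|L'0] := leP L' 0; first by rewrite (le_trans L'0)// ltW.
have : 2 * L' <= 2 * M * L' by rewrite -mulrA ler_pM2l// ler_peMl// ltW.
have : (1 + eta) * w <= 2 * w by rewrite ler_wpM2r ?(ltW w0)//; have := eta1; lra.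
lra.
Qed.

(** Bounds the Leibniz estimate of a product of an original and a lifted element by
    [(1 + eta) (z + w + z w)]. *)
Let lip_product (N N' l l' z w : R) : 0 < z <= 1 -> 0 < w <= 1 -> z * w = x * y ->
  0 <= N -> 0 <= N' -> N ^+ 2 <= 1 + z / M -> N' ^+ 2 <= 1 + w / M ->
  2 * M * l <= z -> 2 * M * l' <= (1 + eta) * w -> 0 <= l -> 0 <= l' ->
  2 * M * (N * l' + l * ((1 + eta) * N')) <= z + w + 5 * (x * y).
Proof.
move=> z01 w01 zw N0 N'0 Nz N'w hl hl' l0 l'0.
have Nb := N_bound N0 z01 Nz; have N'b := N_bound N'0 w01 N'w.
have /andP[z0 z1] := z01; have /andP[w0 w1] := w01; have e0 := ltW eta0.
have -> : 2 * M * (N * l' + l * ((1 + eta) * N')) =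
   N * (2 * M * l') + (2 * M * l) * ((1 + eta) * N') by ring.
have M2l : 0 <= 2 * M * l by rewrite !mulr_ge0 ?(ltW M0).
have M2l' : 0 <= 2 * M * l' by rewrite !mulr_ge0 ?(ltW M0).
have k1 : N * (2 * M * l') <= (1 + z / 2) * ((1 + eta) * w) by rewrite ler_pM.
have k2 : (2 * M * l) * ((1 + eta) * N') <= z * ((1 + eta) * (1 + w / 2)).
  by rewrite ler_pM// ?mulr_ge0 ?addr_ge0// ler_wpM2l ?addr_ge0.
apply: (@le_trans _ _ ((1 + eta) * (z + w + z * w))); first by lra.
have : z + w + z * w <= 3 by nra.
have := eta_xy; rewrite zw; nra.
Qed.

Let p0 : 0 <= 1 + eta. Proof. exact/addr_ge0/ltW/eta0. Qed.

Let sqle (n N z : R) : 0 <= n -> 0 <= N -> n <= (1 + eta) * N -> N ^+ 2 <= 1 + z / M ->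
  n ^+ 2 <= (1 + eta) ^+ 2 * (1 + z / M).
Proof.
move=> n0 N0 nN Nz; apply: (@le_trans _ _ (((1 + eta) * N) ^+ 2)).
  by rewrite lerXn2r ?nnegrE ?mulr_ge0.
by rewrite exprMn ler_wpM2l ?sqr_ge0.
Qed.

Let one_le (z : R) : 0 <= z -> 1 <= (1 + eta) ^+ 2 * (1 + z / M).
Proof.
move=> z0; have zM : 0 <= z / M by rewrite divr_ge0 ?(ltW M0).
have h : 1 <= (1 + eta) ^+ 2 by rewrite expr_ge1// lerDl (ltW eta0).
by rewrite (le_trans h)// ler_peMr ?lerDl// (le_trans _ h).
Qed.

(** The square is at most [(1 + eta)^2 (1 + z)] and the Leibniz term at most [2 (1 + eta)^2 z];
    together they give the factor [1 + 3 z]. *)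
Let transport_c (n N l z : R) : 0 <= n -> 0 <= N -> n <= (1 + eta) * N -> 0 < z <= 1 ->
  N ^+ 2 <= 1 + z / M -> 2 * M * l <= (1 + eta) * z -> 0 <= l ->
  n ^+ 2 + 2 * M * n * l <= (1 + eta) ^+ 2 * (1 + 3 * z).
Proof.
move=> n0 N0 nN z01 Nz lz l0; have /andP[z0 z1] := z01.
have zM : z / M <= z by rewrite ler_piMr ?(ltW z0)// invf_le1.
have Nb := N_bound N0 z01 Nz.
have h1 : n ^+ 2 <= (1 + eta) ^+ 2 * (1 + z).
  by rewrite (le_trans (sqle n0 N0 nN Nz))// ler_wpM2l ?sqr_ge0// lerD2l.
have h2 : 2 * M * n * l <= ((1 + eta) * 2) * ((1 + eta) * z).
  have -> : 2 * M * n * l = n * (2 * M * l) by ring.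
  apply: ler_pM => //; first by rewrite !mulr_ge0// ltW.
  by rewrite (le_trans nN)// ler_wpM2l//; lra.
apply: (le_trans (lerD h1 h2)); rewrite le_eqVlt; apply/orP; left; apply/eqP; ring.
Qed.

Let delta_le : x + y + delta <= x + y + 5 * (x * y).
Proof. by rewrite /delta lerD2l; have := xy0; lra. Qed.

Let cpos (z : R) : 0 < z -> 0 < (1 + eta) ^+ 2 * (1 + 3 * z).
Proof.
move=> z0; apply: mulr_gt0; first exact/exprn_gt0/addr_gt0.
by rewrite addr_gt0// mulr_gt0.
Qed.

Lemma compose_tunnels : exists t3 : tunnel M A C, (extent t3 <= (x + y + 5 * (x * y))%:E)%E.
Proof.
have [I1A I1B mk1 [l1 uA1 uB1]] := b1; have [I2B I2C mk2 [l2 uB2 uC2]] := b2.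
have iA := tn_isoA t1; have iB1 := tn_isoB t1; have iB2 := tn_isoA t2; have iC := tn_isoB t2.
have tA := tn_topoA t1; have tB1 := tn_topoB t1; have tB2 := tn_topoA t2; have tC := tn_topoB t2.
have de1 := tn_e_dom t1; have de2 := tn_e_dom t2.
have Te1 := tn_e_top t1; have Te2 := tn_e_top t2.
have NB1 := compressed_norm_bound semi1 leib1 (iso_star iA) de1 M1 x01 l1 I1A.
have NB2 := compressed_norm_bound semi2 leib2 (iso_star iB2) de2 M1 y01 l2 I2B.
have [g1 [Tg1 dg1 pg1 ng1 Lg1]] := lift_e iB1 iB2 tB1 tB2 semi1 de1 Te1.
have [g2 [Tg2 dg2 pg2 ng2 Lg2]] := lift_e iB2 iB1 tB2 tB1 semi2 de2 Te2.
have top1 := tn_topography t1; have top2 := tn_topography t2.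
have [cst1 ab1 _] := top1; have [cst2 ab2 _] := top2.
(* Both factors lie in the Abelian topography [T1]; this makes the product self-adjoint. *)
have eg1 : e1 ** g2 = g2 ** e1 by exact: ab1.
have eg2 : g1 ** e2 = e2 ** g1 by exact: ab2.
have muBS := pp_state B; have muBc := pp_char B.
have sB1 := iso_star iB1; have sB2 := iso_star iB2; have sA := iso_star iA; have sC := iso_star iC.
have jB1 := iso_surj iB1; have jB2 := iso_surj iB2.
have sqD := sum_sqlcms delta0 sq1 sq2 top1 top2 sB1 sB2 jB1 jB2 tB1.1 tB2.1 muBS muBc.
have topD := sum_topography delta0 sq1 sq2 top1 top2 sB1 sB2 jB1 jB2 tB1.1 tB2.1 muBS muBc.
have [isoDA topoDA] := sum_isometry_fst M0 delta0 sq1 sq2 iB1 iB2 tB1 tB2 iA tA.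
have [isoDC topoDC] := sum_isometry_snd M0 delta0 sq1 sq2 iB1 iB2 tB1 tB2 iC tC.
have mkD := sum_mk delta0 muBS mk1 mk2.
have mkB : (mk L2 (muB \o p2) (muB \o p2) <= 0%:E)%E by exact: gap_refl.
(* With distance 0 in the second space, [sum_mk] links the pulled-back [muA] to [muB \o p2], which
   is the pin supplied by [t2]. *)
have pinD := sum_pin delta0 sq1 sq2 (tn_is_pin t1) (tn_is_pin t2) (sum_mk delta0 muBS mk1 mkB).
have L1e0 : 0 <= L1 e1 by exact: lip_ge0 de1.1.
have L2e0 : 0 <= L2 e2 by exact: lip_ge0 de2.1.
have L1g0 : 0 <= L1 g2 by exact: lip_ge0 dg2.1.
have L2g0 : 0 <= L2 g1 by exact: lip_ge0 dg1.1.
have [Mg2 g2y] := small_lip y01 l2 Lg2 L2e0.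
have [Mg1 g1x] := small_lip x01 l1 Lg1 L1e0.
have [du1 Lu1] := leib1 de1.1 dg2.1; have [du2 Lu2] := leib2 dg1.1 de2.1.
have usa1 : star (e1 ** g2) = e1 ** g2 by rewrite starM de1.2 dg2.2 eg1.
have usa2 : star (g1 ** e2) = g1 ** e2 by rewrite starM de2.2 dg1.2 eg2.
set D := (tn_alg t1 * tn_alg t2)%type.
set LD : seminorm_data D := sumL L1 L2 p1 p2 delta.
(* Each component has one original and one lifted factor, so both have the image [p1 e1 ** p2 e2] in
   [B], and the mismatch term of [LD u] vanishes. *)
pose u : D := (e1 ** g2, g1 ** e2).
have du : dom_sa LD u by apply/sumL_dom_sa; split.
have Tu : sumT T1 T2 u.
  have [_ _ _ mul1 _] := cst1; have [_ _ _ mul2 _] := cst2.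
  by split; [exact: mul1|exact: mul2].
pose t3 : tunnel M A C := Tunnel sqD topD du Tu isoDA topoDA isoDC topoDC pinD.
exists t3.
pose K := x + y + 5 * (x * y).
have K0 : 0 < K by rewrite !addr_gt0// mulr_gt0.
have yx : y * x = x * y by rewrite mulrC.
have nn1 := rnorm_ge0 e1; have nn2 := rnorm_ge0 e2.
have ball1 d : bl_ball LD M d -> bl_ball L1 M d.1.
  move=> [/sumL_dom_sa[h _]]; rewrite /norm_LM ge_max => /andP[h1 /(sumL_le L1 L2 p1 p2 delta0)[h2 _ _]].
  split => //; rewrite /norm_LM ge_max h2 andbT (le_trans _ h1)// ler_pM2r ?invr_gt0//.
  by rewrite rnorm_prod le_max lexx.
have ball2 d : bl_ball LD M d -> bl_ball L2 M d.2.
  move=> [/sumL_dom_sa[_ h]]; rewrite /norm_LM ge_max => /andP[h1 /(sumL_le L1 L2 p1 p2 delta0)[_ h2 _]].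
  split => //; rewrite /norm_LM ge_max h2 andbT (le_trans _ h1)// ler_pM2r ?invr_gt0//.
  by rewrite rnorm_prod le_max lexx orbT.
have balld d : bl_ball LD M d -> rnorm (p1 d.1 - p2 d.2) <= delta.
  move=> [_]; rewrite /norm_LM ge_max => /andP[_ /(sumL_le L1 L2 p1 p2 delta0)[_ _]].
  by rewrite mulr1.
have nA : compressed_near LD M (fA \o fst : {linear D -> pp_alg A}) u K.
  apply: sum_compressed_near; first exact: ltW.
  - move=> phi phiQ.
    have [psi psiQ H] := compressed_product M0 (ltW x0) de1.2 dg2.2 eg1 sA
      (sqle (rnorm_ge0 g2) nn2 ng2 NB2) (one_le (ltW y0)) I1A phiQ.
    exists psi => // d /ball1 /H /le_trans; apply.
    by apply: product_const.
  - move=> phi phiQ.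
    have [psi psiQ H] := compressed_transport delta semi2 leib2 M0 sB1 sB2 dg1 de2.2 de1.2
      eg2 (esym pg1) (cpos x0) (ltW y0) (transport_c (rnorm_ge0 g1) nn1 ng1 x01 NB1 Mg1 L2g0)
      I1A I2B phiQ.
    exists psi => // d db; apply: le_trans (H _ _ (ball1 _ db) (ball2 _ db) (balld _ db)) _.
    by apply: transport_const.
have nC : compressed_near LD M (fC \o snd : {linear D -> pp_alg C}) u K.
  (* The estimates for [C] are those for [A] with the two tunnels exchanged. *)
  have -> : K = y + x + 5 * (x * y) by rewrite /K (addrC y).
  apply: sum_compressed_near; first by rewrite (addrC y) ltW.
  - move=> phi phiQ.
    have [psi psiQ H] := compressed_transport delta semi1 leib1 M0 sB2 sB1 dg2 de1.2 de2.2
      (esym eg1) (esym pg2) (cpos y0) (ltW x0) (transport_c (rnorm_ge0 g2) nn2 ng2 y01 NB2 Mg2 L1g0)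
      I2C I1B phiQ.
    rewrite -eg1 in H.
    exists psi => // d db; apply: le_trans (H _ _ (ball2 _ db) (ball1 _ db) _) _.
      by rewrite rdistC; exact: balld.
    by apply: transport_const.
  - move=> phi phiQ.
    have [psi psiQ H] := compressed_product M0 (ltW y0) de2.2 dg1.2 (esym eg2) sC
      (sqle (rnorm_ge0 g1) nn1 ng1 NB1) (one_le (ltW x0)) I2C phiQ.
    rewrite -eg2 in H.
    exists psi => // d /ball2 /H /le_trans; apply.
    by apply: product_const.
apply: extent_le => //; split => //.
- by apply: (le_trans mkD); rewrite lee_fin delta_le.
- split.
  + have M20 : 0 < 2 * M by rewrite mulr_gt0.
    rewrite mulrC -ler_pdivlMr//; apply/(sumL_le L1 L2 p1 p2 delta0); split => /=.
    * rewrite ler_pdivlMr// mulrC (le_trans (ler_wpM2l (ltW M20) Lu1))//.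
      apply: le_trans (lip_product x01 y01 erefl nn1 nn2 NB1 NB2 l1 Mg2 L1e0 L1g0).
      by rewrite ler_wpM2l ?(ltW M20)// lerD2l ler_wpM2l.
    * rewrite ler_pdivlMr// mulrC (le_trans (ler_wpM2l (ltW M20) Lu2))//.
      rewrite /K (addrC x).
      apply: le_trans (lip_product y01 x01 yx nn2 nn1 NB2 NB1 l2 Mg1 L2e0 L2g0).
      rewrite ler_wpM2l ?(ltW M20)// [leRHS]addrC (mulrC (rnorm e2)) lerD2r.
      by rewrite mulrC ler_wpM2l.
    * by rewrite sB1.1 sB2.1 pg1 pg2 subrr rnorm0 mulr_ge0 ?(ltW delta0)// divr_ge0 ?(ltW K0) ?(ltW M20).
  + have : rnorm (1 - (muA \o fA) (e1 ** g2)) <= K.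
      apply: (@pin_const _ L1 (muA \o fA) (muB \o p1) _ _ _ _ x01 y01 erefl semi1 _ _ mk1 dg2 g2y _ uA1).
      * exact: (positive_linear (quasi_state_pullback sA (state_quasi (pp_state A))).1).
      * exact: (positive_linear (quasi_state_pullback sB1 (state_quasi (pp_state B))).1).
      * rewrite /= sA.1; apply: (pp_char A).1; first exact: tA.1.
        exact: tA.1.
      * by rewrite /= pg2.
    exact.
  + have mk2' : (mk L2 (muC \o fC) (muB \o p2) <= y%:E)%E by rewrite mkE gapC.
    have : rnorm (1 - (muC \o fC) (e2 ** g1)) <= K.
      rewrite /K (addrC x).
      apply: (@pin_const _ L2 (muC \o fC) (muB \o p2) _ _ _ _ y01 x01 yx semi2 _ _ mk2' dg1 g1x _ uC2).
      * exact: (positive_linear (quasi_state_pullback sC (state_quasi (pp_state C))).1).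
      * exact: (positive_linear (quasi_state_pullback sB2 (state_quasi (pp_state B))).1).
      * rewrite /= sC.1; apply: (pp_char C).1; exact: tC.1.
      * by rewrite /= pg1.
    by rewrite -eg2.
Qed.

End Composition.

(** * Triangle inequality, symmetry and reflexivity of the local metametrics *)

Section Tunnels.
Context (R : realType).
Implicit Types (A B C : pointed_proper R) (M x y : R).

Lemma extent_ge0 M A B (t : tunnel M A B) : (0 <= extent t)%E.
Proof. by rewrite /extent !le_max lee_fin !le_max rnorm_ge0 !orbT. Qed.

Lemma local_metametric_ge0 M A B : (0 <= local_metametric M A B)%E.
Proof. by apply: le_ereal_inf_tmp => _ [t ->]; exact: extent_ge0. Qed.

Lemma local_metametric_triangle M A B C x y : 1 <= M -> 0 < x <= 1 -> 0 < y <= 1 ->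
  (local_metametric M A B < x%:E)%E -> (local_metametric M B C < y%:E)%E ->
  (local_metametric M A C <= (x + y + 5 * (x * y))%:E)%E.
Proof.
move=> M1 x01 y01 /ereal_inf_lt[_ [t1 ->] /extent_ltP b1].
move=> /ereal_inf_lt[_ [t2 ->] /extent_ltP b2].
have [t3 t3le] := compose_tunnels M1 x01 y01 b1 b2.
by apply: le_trans t3le; apply: ereal_inf_lbound; exists t3.
Qed.

Lemma is_pin_finite (D : cstarAlgebra R) (L : seminorm_data D) (mu nu : functional R D) :
  is_pin L mu -> states D nu -> (mk L mu nu < +oo)%E -> is_pin L nu.
Proof.
move=> [_ dn] nuS fin; split => // phi /dn; apply: closureS => psi [psiS h]; split => //.
have bounded (z : \bar R) : (z < +oo)%E -> exists r : R, (z <= r%:E)%E.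
  case: z => [r _|//|_]; first by exists r.
  by exists 0; rewrite leNye.
have [r hr] := bounded _ h; have [s hs] := bounded _ fin.
apply: (@le_lt_trans _ _ (r + s)%:E); last exact: ltry.
exact: (@gap_triangle _ _ _ psi mu nu).
Qed.

(** Only [pp_pin A] is required to pull back to a pin. A finite extent bounds the [mk] distance
    between the two pulled-back states, which makes the other one a pin as well. *)
Lemma reverse_tunnel M A B (t : tunnel M A B) : (extent t < +oo)%E ->
  exists t' : tunnel M B A, extent t' = extent t.
Proof.
move=> fin.
have [[starB surjB] _ _ _ _] := tn_isoB t.
have [[sep _ _ _ _] _ _ _ _] := tn_sqlcms t.
have pinB : is_pin (tn_lip t) (pp_pin B \o tn_piB t).
  apply: (is_pin_finite (tn_is_pin t)).
    exact: (state_pullback starB sep surjB (pp_state B)).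
  by move: fin; rewrite /extent !gt_max => /andP[_ /andP[]].
exists (Tunnel (tn_sqlcms t) (tn_topography t) (tn_e_dom t) (tn_e_top t)
  (tn_isoB t) (tn_topoB t) (tn_isoA t) (tn_topoA t) pinB).
rewrite /extent /= mkE gapC; congr Order.max.
  by congr (ereal_inf (image _ _)); apply/seteqP; split => r [].
by congr (Order.max _ _%:E); rewrite [in LHS](maxC (rnorm _)).
Qed.

Lemma local_metametricC M A B : local_metametric M A B = local_metametric M B A.
Proof.
have le A' B' : (local_metametric M A' B' <= local_metametric M B' A')%E.
  apply: le_ereal_inf_tmp => _ [t ->]; have [->|fin] := eqVneq (extent t) +oo%E.
    exact: leey.
  have [|t' <-] := @reverse_tunnel _ _ _ t; first by rewrite ltey.
  by apply: ereal_inf_lbound; exists t'.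
by apply/eqP; rewrite eq_le !le.
Qed.

(** The norms in an exhaustive sequence tend to 1 but may exceed it. Division by the maximum of 1
    and the norm gives a contraction and costs another [eps / 2] at the pin. *)
Lemma normalized_exhaustive A eps : 0 < eps -> exists e, [/\ dom_sa (pp_lip A) e, pp_top A e,
  rnorm e <= 1, pp_lip A e <= eps & rnorm (1 - pp_pin A e) <= eps].
Proof.
move=> eps0; have e2 : 0 < eps / 2 by rewrite divr_gt0.
have [_ _ [[_ _ Tlin _ _] _ _] _ [h [[hd hL hmu hN] hT]]] := pp_axiom A.
have [[_ semi _ _ _] _ _ _ _] := pp_sqlcms A.
have T0 : pp_top A 0 by have [_ _ [[]]] := pp_axiom A.
have mulin := positive_linear (state_quasi (pp_state A)).1.
have H1 : \forall n \near \oo, rnorm (pp_pin A (h n) - 1) < eps / 2.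
  exact: (hmu _ (nbhs_rnorm (1 : R[i]^o) e2)).
have H2 : \forall n \near \oo, `|1 - rnorm (h n)| < eps / 2 by move/cvgrPdist_lt: hN => /(_ _ e2).
have H3 : \forall n \near \oo, `|0 - pp_lip A (h n)| < eps by move/cvgrPdist_lt: hL => /(_ _ eps0).
have [n [n1 [n2 n3]]] := filter_ex (filterI H1 (filterI H2 H3)).
pose m := Num.max 1 (rnorm (h n)); have m1 : 1 <= m by rewrite le_max lexx.
have m0 : 0 < m by exact: lt_le_trans m1.
have mi1 : m^-1 <= 1 by rewrite invf_le1.
have mle : m - 1 <= eps / 2.
  rewrite lerBlDl ge_max lerDl (ltW e2) /= -lerBlDl.
  by move: n2; rewrite distrC => /ltW; apply: le_trans; exact: ler_norm.
exists (m^-1%:C%C *: h n); split.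
- exact: dom_saZ.
- by rewrite -[_ *: _]addr0; exact: Tlin.
- by rewrite rnormZC gtr0_norm ?invr_gt0// ler_pdivrMl// mulr1 le_max lexx orbT.
- rewrite lipZ// gtr0_norm ?invr_gt0//.
  have L0 : 0 <= pp_lip A (h n) by apply: lip_ge0 => //; case: (hd n).
  rewrite (le_trans (ler_piMl L0 mi1))//.
  by move: n3; rewrite sub0r normrN => /ltW; apply: le_trans; exact: ler_norm.
- rewrite funZ//.
  have -> : 1 - m^-1%:C%C * pp_pin A (h n) = m^-1%:C%C * (m%:C%C - pp_pin A (h n)) :> R[i].
    by rewrite mulrBr -rmorphM /= mulVf ?gt_eqF.
  rewrite rnormM_C rnormC gtr0_norm ?invr_gt0// (le_trans (ler_piMl (rnorm_ge0 _) mi1))//.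
  rewrite (le_trans (rdistD _ (1 : R[i]) _))// -[1 in X in rnorm X + _](rmorph1 (real_complex R)).
  rewrite -rmorphB rnormC ger0_norm ?subr_ge0//; move: n1; rewrite rdistC; lra.
Qed.

(** For a contraction [e] the compression of a quasi-state is itself a quasi-state, so the
    inclusions hold with error 0. The tolerance [eps / (2 * M)] anticipates the term [2 * M * L e]
    of the extent. *)
Lemma identity_tunnel M A eps : 1 <= M -> 0 < eps ->
  exists t : tunnel M A A, (extent t <= eps%:E)%E.
Proof.
move=> M1 eps0; have M0 : 0 < M by exact: lt_le_trans M1.
have eM : 0 < eps / (2 * M) by rewrite divr_gt0// mulr_gt0.
have [e [de Te e1 Le mue]] := normalized_exhaustive A eM.
have sq := pp_sqlcms A; have [[sep semi _ _ _] _ _ _ _] := sq.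
have [_ pin top _ _] := pp_axiom A.
have st : star_morphism (idfun : {linear pp_alg A -> pp_alg A}) by split.
have surj (a : pp_alg A) : exists d, (idfun : {linear pp_alg A -> pp_alg A}) d = a by exists a.
have iso : quantum_isometry (pp_lip A) (pp_lip A) M idfun.
  split => //.
  - exact: separable_proper.
  - by rewrite image_id.
  - move=> a da; rewrite (_ : [set _ | _ in _] = [set (norm_LM (pp_lip A) M a)%:E]) ?ereal_inf1//.
    by apply/seteqP; split => [_ [d [_ <-]] <-//|_ ->]; exists a.
have topo : topographic (pp_lip A) (pp_lip A) (pp_top A) (pp_top A) idfun.
  split => // a s da Ta s0; have s1 : 1 <= expR s by rewrite ltW// expR_gt1.
  by exists a; split => //; rewrite ler_peMl ?rnorm_ge0// lip_ge0//; case: da.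
pose t : tunnel M A A := Tunnel sq top de Te iso topo iso topo pin.
have near : compressed_near (pp_lip A) M idfun e eps.
  move=> phi phiQ; exists (fun a => phi (e ** a ** e)).
    by apply: quasi_state_compress => //; exact: de.2.
  apply: (@le_trans _ _ 0%:E); first exact: gap_refl.
  by rewrite lee_fin ltW.
have mue' : rnorm (1 - pp_pin A e) <= eps.
  rewrite (le_trans mue)// ler_pdivrMr ?mulr_gt0// ler_peMr ?(ltW eps0)//.
  by rewrite mulr_ege1// ler1n.
exists t; apply: extent_le => //; split => //.
  apply: (@le_trans _ _ 0%:E); first exact: gap_refl.
  by rewrite lee_fin ltW.
by split => //=; rewrite -ler_pdivlMl ?mulr_gt0// mulrC.
Qed.

Lemma local_metametric_refl M A : 1 <= M -> local_metametric M A A = 0%E.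
Proof.
move=> M1; apply/eqP; rewrite eq_le local_metametric_ge0 andbT.
apply/lee_addgt0Pr => eps eps0; rewrite add0e.
have [t tle] := identity_tunnel A M1 eps0.
by apply: le_trans tle; apply: ereal_inf_lbound; exists t.
Qed.

End Tunnels.

(** * The metametric and its topology *)

Section Metametric.
Context (R : realType).
Implicit Types (A B C : pointed_proper R) (x y : R).

Definition admissible A B x : Prop := 0 < x /\ (sup_local_metametric A B x < x%:E)%E.

(** A larger [x] shortens the range of the parameter. *)
Lemma admissible_le A B x y : admissible A B x -> x <= y -> admissible A B y.
Proof.
move=> [x0 h] xy; have y0 := lt_le_trans x0 xy; split => //.
apply: (@lt_le_trans _ _ x%:E); last by rewrite lee_fin.
apply: le_lt_trans h; apply: ereal_sup_le => z [->|[r /andP[r1 ry] <-]]; first by left.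
right; exists r => //; rewrite /= r1 (le_trans ry)// ler_pM2l//.
by rewrite lef_pV2.
Qed.

(* The range [1, 1 / x] is empty. *)
Lemma admissible_gt1 A B x : 1 < x -> admissible A B x.
Proof.
move=> x1; have x0 : 0 < x by exact: lt_trans x1.
split => //; apply: (@le_lt_trans _ _ 0%E); last by rewrite lte_fin.
apply: ge_ereal_sup => _ [->|[r /andP[r1 rx] <-]].
  by [].
by have := le_trans r1 rx; rewrite div1r invf_ge1// leNgt x1.
Qed.

Lemma admissible_refl A x : 0 < x -> admissible A A x.
Proof.
move=> x0; split => //; apply: (@le_lt_trans _ _ 0%E); last by rewrite lte_fin.
apply: ge_ereal_sup => _ [->|[r /andP[r1 _] <-]].
  by [].
by rewrite local_metametric_refl.
Qed.

Lemma sup_local_metametricC A B x : sup_local_metametric A B x = sup_local_metametric B A x.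
Proof.
by rewrite /sup_local_metametric; congr (ereal_sup (_ `|` _)); apply: eq_imagel => r _;
  exact: local_metametricC.
Qed.

(** [z] exceeds both [x] and [y], so every parameter up to [1 / z] lies in the ranges of both
    hypotheses. *)
Lemma admissible_comp A B C x y z : x <= 1 -> y <= 1 -> admissible A B x ->
  admissible B C y -> x + y + 5 * (x * y) < z -> admissible A C z.
Proof.
move=> x1 y1 [x0 hx] [y0 hy] xyz; have xy0 : 0 < x * y by rewrite mulr_gt0.
have z0 : 0 < z by lra.
split => //; apply: (@le_lt_trans _ _ (x + y + 5 * (x * y))%:E); last by rewrite lte_fin.
apply: ge_ereal_sup => _ [->|[r /andP[r1 rz] <-]]; first by rewrite lee_fin; lra.
have rw w : 0 < w -> w <= z -> 1 <= r <= 1 / w.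
  by move=> w0 wz; rewrite r1 (le_trans rz)// ler_pM2l// lef_pV2.
apply: local_metametric_triangle; rewrite ?x0 ?y0//.
  apply: le_lt_trans hx; apply: ereal_sup_ubound; right; exists r => //.
  by apply: rw => //; lra.
apply: le_lt_trans hy; apply: ereal_sup_ubound; right; exists r => //.
by apply: rw => //; lra.
Qed.

Definition local_dist A B : R := inf [set x | admissible A B x].

Let adm_ne A B : [set x | admissible A B x] !=set0.
Proof. by exists 2; apply: admissible_gt1; rewrite ltr1n. Qed.

Let adm_lb A B : has_lbound [set x | admissible A B x].
Proof. by exists 0 => x [/ltW]. Qed.

Lemma local_dist_ge0 A B : 0 <= local_dist A B.
Proof. by apply: lb_le_inf => // x [/ltW]. Qed.

Lemma local_dist_le A B x : admissible A B x -> local_dist A B <= x.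
Proof. by move=> h; apply: ge_inf. Qed.

Lemma local_dist_le1 A B : local_dist A B <= 1.
Proof.
apply/ler_addgt0Pr => e e0; apply: local_dist_le; apply: admissible_gt1.
by rewrite ltrDl.
Qed.

Lemma local_dist_lt A B x : local_dist A B < x -> admissible A B x.
Proof.
by move=> /inf_lt[]// y adm /ltW; exact: admissible_le.
Qed.

Lemma local_distC A B : local_dist A B = local_dist B A.
Proof.
congr inf; apply/seteqP.
by split => x [x0]; rewrite sup_local_metametricC.
Qed.

Lemma local_dist_refl A : local_dist A A = 0.
Proof.
apply/eqP; rewrite eq_le local_dist_ge0 andbT; apply/ler_addgt0Pr => e e0.
by rewrite add0r; exact/local_dist_le/admissible_refl.
Qed.

Lemma local_dist_triangle A B C :
  local_dist A C <= local_dist A B + local_dist B C + 5 * (local_dist A B * local_dist B C).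
Proof.
set a := local_dist A B; set b := local_dist B C.
have a0 : 0 <= a := local_dist_ge0 A B; have a1 : a <= 1 := local_dist_le1 A B.
have b0 : 0 <= b := local_dist_ge0 B C; have b1 : b <= 1 := local_dist_le1 B C.
apply/ler_addgt0Pr => e e0.
(* Replacing [a] and [b] by [a + s] and [b + s] adds at most [17 s], as [a], [b] and [s] are at most
   1. *)
pose s := Num.min 1 (e / 20); have s0 : 0 < s by rewrite lt_min ltr01 divr_gt0.
have s1 : s <= 1 by rewrite ge_min lexx.
have se : 20 * s <= e by rewrite -ler_pdivlMl// mulrC ge_min lexx orbT.
(* [admissible_comp] asks for bounds at most 1; beyond 1 the claim follows from [local_dist_le1]. *)
have [xs1|xs1] := leP (a + s) 1; last first.
  by rewrite (le_trans (local_dist_le1 _ _))//; nra.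
have [ys1|ys1] := leP (b + s) 1; last first.
  by rewrite (le_trans (local_dist_le1 _ _))//; nra.
apply: local_dist_le; apply: (@admissible_comp A B C (a + s) (b + s)) => //.
- by apply: local_dist_lt; rewrite ltrDl.
- by apply: local_dist_lt; rewrite ltrDl.
- nra.
Qed.

Lemma qdiam_ge0 A : (0 <= qdiam (pp_lip A))%E.
Proof.
have [[_ semi _ _ _] _ _ _ _] := pp_sqlcms A.
have S := pp_state A; apply: ereal_sup_ge.
exists (mk (pp_lip A) (pp_pin A) (pp_pin A)); first by exists (pp_pin A), (pp_pin A).
by apply: gap_ge0; exact: mk_ball0.
Qed.

Definition qdiam_exp A : R := fine (expeR (- qdiam (pp_lip A))).

Lemma qdiam_expE A : expeR (- qdiam (pp_lip A)) = (qdiam_exp A)%:E.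
Proof. by rewrite /qdiam_exp; have := qdiam_ge0 A; case: (qdiam _). Qed.

Lemma qdiam_exp_itv A : 0 <= qdiam_exp A <= 1.
Proof.
rewrite -!lee_fin -qdiam_expE; have := qdiam_ge0 A.
case: (qdiam _) => [r|_|//] /=; rewrite !lee_fin.
  by move=> r0; rewrite expR_ge0 /= -[leRHS]expR0 ler_expR oppr_le0.
by rewrite lexx ler01.
Qed.

Definition pp_dist A B : R := Num.max (local_dist A B) `|qdiam_exp A - qdiam_exp B|.

Lemma metametricE A B : metametric A B = (pp_dist A B)%:E.
Proof.
rewrite /metametric !qdiam_expE -EFinB abse_EFin EFin_max; congr Order.max.
exact: (ereal_inf_EFin (adm_lb A B) (adm_ne A B)).
Qed.

Lemma pp_dist_ge0 A B : 0 <= pp_dist A B.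
Proof. by rewrite le_max local_dist_ge0. Qed.

Lemma pp_dist_le1 A B : pp_dist A B <= 1.
Proof.
rewrite ge_max local_dist_le1 /= ler_norml.
have := qdiam_exp_itv A; have := qdiam_exp_itv B; lra.
Qed.

Lemma pp_distC A B : pp_dist A B = pp_dist B A.
Proof. by rewrite /pp_dist local_distC distrC. Qed.

Lemma pp_dist_refl A : pp_dist A A = 0.
Proof. by rewrite /pp_dist local_dist_refl subrr normr0 maxxx. Qed.

Lemma pp_dist_triangle A B C : pp_dist A C <= pp_dist A B + pp_dist B C + 5 * (pp_dist A B * pp_dist B C).
Proof.
have x0 := pp_dist_ge0 A B; have y0 := pp_dist_ge0 B C.
rewrite ge_max; apply/andP; split.
  rewrite (le_trans (local_dist_triangle A B C))//.
  have h1 : local_dist A B <= pp_dist A B by rewrite le_max lexx.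
  have h2 : local_dist B C <= pp_dist B C by rewrite le_max lexx.
  by rewrite !lerD// ler_wpM2l// ler_pM// local_dist_ge0.
rewrite (le_trans (ler_distD (qdiam_exp B) _ _))//.
have h1 : `|qdiam_exp A - qdiam_exp B| <= pp_dist A B by rewrite le_max lexx orbT.
have h2 : `|qdiam_exp B - qdiam_exp C| <= pp_dist B C by rewrite le_max lexx orbT.
by rewrite ler_wpDr ?mulr_ge0// lerD.
Qed.

End Metametric.

(** * Topology of a bounded distance with a relaxed triangle inequality *)

Section QuasiTriangle.
Context (R : realType) (X : Type) (D : X -> X -> R).
Hypothesis D_ge0 : forall x y, 0 <= D x y.
Hypothesis D_le1 : forall x y, D x y <= 1.
Hypothesis DC : forall x y, D x y = D y x.
Hypothesis D_refl : forall x, D x x = 0.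
Hypothesis D_triangle : forall x y z, D x z <= D x y + D y z + 5 * (D x y * D y z).
Implicit Types (x y z : X) (r e : R) (U : X -> Prop).

Definition dist_open U : Prop :=
  forall x, U x -> exists2 r, 0 < r & forall y, D x y < r -> U y.

(** The uniform distance between the images of [x] and [y] under the Kuratowski map, which sends [x]
    to [D x]. *)
Definition sup_dist x y : R := sup [set r | exists z, r = `|D x z - D y z|].

(** Boundedness by 1 turns the product term into five times a single distance, whence 6. *)
Let dist_lip x y z : `|D x z - D y z| <= 6 * D x y.
Proof.
have lip u v w : D u w <= D v w + 6 * D u v.
  have := D_triangle u v w; have := D_ge0 u v; have := D_le1 v w; nra.
by rewrite ler_norml; have := lip x y z; have := lip y x z; rewrite (DC y x); lra.
Qed.

Let has_sup_dist x y : has_sup [set r | exists z, r = `|D x z - D y z|].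
Proof.
split; first by exists `|D x x - D y x|, x.
by exists (6 * D x y) => _ [z ->]; exact: dist_lip.
Qed.

Lemma sup_dist_ge x y z : `|D x z - D y z| <= sup_dist x y.
Proof. by apply: ub_le_sup; [case: (has_sup_dist x y)|exists z]. Qed.

Lemma sup_dist_le x y r : (forall z, `|D x z - D y z| <= r) -> sup_dist x y <= r.
Proof.
by move=> h; apply: ge_sup; [case: (has_sup_dist x y)|move=> _ [z ->]].
Qed.

Lemma sup_dist_upper x y : sup_dist x y <= 6 * D x y.
Proof. exact: sup_dist_le (dist_lip x y). Qed.

Lemma sup_dist_lower x y : D x y <= sup_dist x y.
Proof. by rewrite (le_trans _ (sup_dist_ge x y y))// D_refl subr0 ler_norm. Qed.

Lemma sup_distC x y : sup_dist x y = sup_dist y x.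
Proof.
have le u v : sup_dist u v <= sup_dist v u.
  by apply: sup_dist_le => z; rewrite distrC; exact: sup_dist_ge.
by apply/eqP; rewrite eq_le !le.
Qed.

Lemma sup_dist_triangle x y z : sup_dist x z <= sup_dist x y + sup_dist y z.
Proof.
apply: sup_dist_le => w; rewrite (le_trans (ler_distD (D y w) _ _))//.
by rewrite lerD// sup_dist_ge.
Qed.

Lemma dist_lipschitz x y x' y' : `|D x y - D x' y'| <= 6 * (D x x' + D y y').
Proof.
rewrite (le_trans (ler_distD (D x' y) _ _))// mulrDr lerD//.
by rewrite DC (DC x').
Qed.

Lemma dist_open_sup U : dist_open U <->
  forall x, U x -> exists2 r, 0 < r & forall y, sup_dist x y < r -> U y.
Proof.
split=> h x /h[r r0 H].
  by exists r => // y; move=> /(le_lt_trans (sup_dist_lower x y)); exact: H.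
exists (r / 6); first by rewrite divr_gt0.
by move=> y; rewrite ltr_pdivlMr// mulrC => /(le_lt_trans (sup_dist_upper x y)); exact: H.
Qed.

(** In place of the exact triangle inequality, the room left in the ball is divided by the Lipschitz
    constant 6. *)
Lemma dist_open_ball x r : dist_open (fun y => D x y < r).
Proof.
move=> y xy; exists ((r - D x y) / 6); first by rewrite divr_gt0// subr_gt0.
move=> z; rewrite ltr_pdivlMr// => yz.
have := dist_lipschitz x z x y; rewrite D_refl add0r (DC z) => /(le_trans (ler_norm _)); lra.
Qed.

Lemma dist_open_topology : is_topology dist_open.
Proof.
split.
- by move=> x _; exists 1.
- move=> U V hU hV x [/hU[r r0 Hr] /hV[s s0 Hs]].
  exists (Num.min r s); first by rewrite lt_min r0.
  by move=> y; rewrite lt_min => /andP[/Hr ? /Hs].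
- move=> F hF x [U FU Ux]; have [r r0 H] := hF U FU x Ux.
  by exists r => // y /H Uy; exists U.
Qed.

Lemma dist_open_closure S x : top_closure dist_open S x <->
  forall r, 0 < r -> exists2 y, D x y < r & S y.
Proof.
split=> [h r r0|h U Uo Ux]; last first.
  by have [r r0 H] := Uo x Ux; have [y /H Uy Sy] := h r r0; exists y.
by apply: (h (fun y => D x y < r)); [exact: dist_open_ball|rewrite D_refl].
Qed.

Lemma dist_open_metrizable : (forall x y, D x y = 0 -> x = y) -> is_metrizable R dist_open.
Proof.
move=> D_eq0; exists sup_dist; split.
- move=> x y; split=> [d0|->].
    by apply: D_eq0; apply/eqP; rewrite eq_le D_ge0 andbT -d0 sup_dist_lower.
  apply/eqP; rewrite eq_le (le_trans _ (sup_dist_lower y y)) ?D_ge0// andbT.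
  by rewrite (le_trans (sup_dist_upper y y))// D_refl mulr0.
- exact: sup_distC.
- exact: sup_dist_triangle.
- exact: dist_open_sup.
Qed.

Lemma dist_open_basis : is_basis dist_open
  (fun U => exists x r, 0 < r /\ U = fun y => D x y < r).
Proof.
split=> [U [x [r [r0 ->]]]|U x Uo Ux]; first exact: dist_open_ball.
have [r r0 H] := Uo x Ux.
by exists (fun y => D x y < r); split => //; [exists x, r|rewrite D_refl].
Qed.

Lemma dist_open_converges (u : nat -> X) x : top_converges dist_open u x <->
  D (u n) x @[n --> \oo] --> (0 : R).
Proof.
split=> [h|h U Uo Ux].
  apply/cvgrPdist_lt => e e0.
  have := h (fun y => D x y < e) (@dist_open_ball x e); rewrite D_refl => /(_ e0).
  by apply: filterS => n; rewrite sub0r normrN ger0_norm// DC.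
have [r r0 H] := Uo x Ux; move/cvgrPdist_lt: h => /(_ r r0).
by apply: filterS => n; rewrite sub0r normrN ger0_norm// DC => /H.
Qed.

Lemma dist_open_continuous2 (E : X -> X -> \bar R) : (forall x y, E x y = (D x y)%:E) ->
  continuous2 dist_open E.
Proof.
move=> ED x y W; rewrite ED => /nbhs_EFin/nbhs_ballP[e /= e0 eW].
(* [dist_lipschitz] yields [6 (e / 12 + e / 12) = e]. *)
have e12 : 0 < e / 12 by rewrite divr_gt0.
exists (fun z => D x z < e / 12), (fun z => D y z < e / 12); split.
- exact: dist_open_ball.
- exact: dist_open_ball.
- by rewrite D_refl.
- by rewrite D_refl.
move=> x' y' xx' yy'; rewrite ED; apply: eW; rewrite /ball /=.
by rewrite (le_lt_trans (dist_lipschitz x y x' y'))//; lra.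
Qed.

(** Continuity at the diagonal point [(x, x)], where [D] vanishes, gives a neighbourhood of [x] in
    [op] inside the ball of radius [r]. So [U] is a union of members of [op]. *)
Lemma dist_open_minimal (E : X -> X -> \bar R) op : (forall x y, E x y = (D x y)%:E) ->
  is_topology op -> continuous2 op E -> forall U, dist_open U -> op U.
Proof.
move=> ED [_ _ opU] cont U Uo.
have -> : U = fun x => exists2 V, op V /\ (forall y, V y -> U y) & V x.
  apply/funext => x; apply/propext; split=> [Ux|[V [_ VU] /VU//]].
  have [r r0 H] := Uo x Ux.
  have nW : nbhs (E x x) [set w : \bar R | (w < r%:E)%E].
    by rewrite ED D_refl; apply/nbhs_EFin; exact: (lt_nbhsl r0).
  have [V1 [V2 [_ oV2 V1x V2x V12]]] := cont x x _ nW.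
  exists V2 => //; split => // y V2y; apply: H.
  by have := V12 x y V1x V2y; rewrite /= ED lte_fin.
by apply: opU => V [].
Qed.

End QuasiTriangle.

(** * Equivalence classes and the hypertopology *)

Section Hyperspace.
Context (R : realType).
Implicit Types (A B C : pointed_proper R) (x y : hyperspace R).

Lemma metametric_eq0 A B : metametric A B = 0%E <-> pp_dist A B = 0.
Proof. by rewrite metametricE; split=> [[]|->]. Qed.

(** At distance 0 the product term vanishes, and the relaxed triangle inequality becomes exact. *)
Lemma pp_dist_congr A A' B : pp_dist A A' = 0 -> pp_dist A B = pp_dist A' B.
Proof.
have le C C' : pp_dist C C' = 0 -> pp_dist C B <= pp_dist C' B.
  by move=> h; have := pp_dist_triangle C C' B; rewrite h mul0r mulr0 addr0 add0r.
by move=> h; apply/eqP; rewrite eq_le !le// pp_distC.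
Qed.

Lemma hclassP x : exists A, x = hclass A.
Proof.
case: x => m; case => A e; exists A; subst m.
by rewrite /hclass; congr Hyperspace; exact: Prop_irrelevance.
Qed.

Lemma hclass_eq A B : hclass A = hclass B <-> pp_dist A B = 0.
Proof.
split=> [e|h].
  have : members (hclass B) B by apply/metametric_eq0/pp_dist_refl.
  by rewrite -e => /metametric_eq0.
have e : members (hclass A) = members (hclass B).
  by apply/funext => C /=; rewrite !metametricE (pp_dist_congr _ h).
rewrite /hclass; move: e => /= e.
move: (ex_intro _ A _) (ex_intro _ B _); rewrite e => p q.
by congr Hyperspace; exact: Prop_irrelevance.
Qed.

Lemma hdistE A B : hdist (hclass A) (hclass B) = (pp_dist A B)%:E.
Proof.
rewrite /hdist (_ : [set _ | _] = [set (pp_dist A B)%:E]) ?ereal_inf1//.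
apply/seteqP; split=> [_ [A' [B' [/metametric_eq0 a /metametric_eq0 b ->]]]|_ ->].
  by rewrite metametricE (pp_dist_congr _ a) pp_distC (pp_dist_congr _ b) pp_distC.
exists A, B; split; [| |by rewrite metametricE].
- exact/metametric_eq0/pp_dist_refl.
- exact/metametric_eq0/pp_dist_refl.
Qed.

Definition rdist x y : R := fine (hdist x y).

Lemma rdistE x y : hdist x y = (rdist x y)%:E.
Proof.
have [A ->] := hclassP x; have [B ->] := hclassP y.
by rewrite /rdist hdistE.
Qed.

Lemma rdist_class A B : rdist (hclass A) (hclass B) = pp_dist A B.
Proof. by rewrite /rdist hdistE. Qed.

Lemma hclosureP (S : hyperspace R -> Prop) x : hclosure S x <->
  forall r, 0 < r -> exists2 y, rdist x y < r & S y.
Proof.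
split=> [[_ h] r r0|h].
  have : (ereal_inf [set r : \bar R | exists2 y, S y & r = hdist x y] < r%:E)%E by rewrite h.
  by move=> /ereal_inf_lt[_ [y Sy ->]]; rewrite rdistE lte_fin; exists y.
split; first by have [y _ Sy] := h 1 ltr01; exists y.
apply/eqP; rewrite eq_le; apply/andP; split.
  apply/lee_addgt0Pr => e e0; have [y xy Sy] := h e e0; rewrite add0e.
  apply: (@le_trans _ _ (hdist x y)); first by apply: ereal_inf_lbound; exists y.
  by rewrite rdistE lee_fin ltW.
apply: le_ereal_inf_tmp => _ [y _ ->].
have [A ->] := hclassP x; have [B ->] := hclassP y.
by rewrite hdistE lee_fin pp_dist_ge0.
Qed.

Lemma rdist_refl x : rdist x x = 0.
Proof. by have [A ->] := hclassP x; rewrite rdist_class pp_dist_refl. Qed.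

(** [hopen] says that the complement is its own [hclosure]; by [hclosureP], a point outside that
    closure is one with a ball inside [U]. *)
Lemma hopenP : @hopen R = dist_open rdist.
Proof.
apply/funext => U; apply/propext; split=> [h x Ux|h x].
  apply: contrapT => /forall2NP H; apply: (proj1 (h x)) => //.
  apply/hclosureP => r r0; apply: contrapT => /forall2NP K.
  have [//|] := H r; apply => y xy; apply: contrapT => Uy.
  by have [] := K y.
split=> [/hclosureP K Ux|Ux]; last first.
  by apply/hclosureP => r r0; exists x => //; rewrite rdist_refl.
by have [r r0 H] := h x Ux; have [y /H] := K r r0.
Qed.

End Hyperspace.

Theorem mainTheorem4 (R : realType) :
  (* metametric A B = 0 is an equivalence relation, compatible with metametric *)
  (forall A B : pointed_proper R,
     (hclass A = hclass B <-> metametric A B = 0%E) /\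
     hdist (hclass A) (hclass B) = metametric A B) /\
  (* the hypertopology is the topology with closure operator hclosure *)
  (is_topology (@hopen R) /\
   forall (S : hyperspace R -> Prop) (x : hyperspace R),
     top_closure (@hopen R) S x <-> hclosure S x) /\
  is_metrizable R (@hopen R) /\
  is_basis (@hopen R)
    (fun U => exists (x : hyperspace R) (r : R), 0 < r /\ U = hball x r) /\
  (forall (u : nat -> hyperspace R) (x : hyperspace R),
     top_converges (@hopen R) u x <->
     hdist (u n) x @[n --> \oo] --> 0%E) /\
  continuous2 (@hopen R) (@hdist R) /\
  (forall op : (hyperspace R -> Prop) -> Prop,
     is_topology op -> continuous2 op (@hdist R) ->
     forall U, hopen U -> op U).
Proof.
have ge0 (x y : hyperspace R) : 0 <= rdist x y.
  have [A ->] := hclassP x; have [B ->] := hclassP y.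
  by rewrite rdist_class pp_dist_ge0.
have le1 (x y : hyperspace R) : rdist x y <= 1.
  have [A ->] := hclassP x; have [B ->] := hclassP y.
  by rewrite rdist_class pp_dist_le1.
have rC (x y : hyperspace R) : rdist x y = rdist y x.
  have [A ->] := hclassP x; have [B ->] := hclassP y.
  by rewrite !rdist_class pp_distC.
have r0 := @rdist_refl R.
have tri (x y z : hyperspace R) :
    rdist x z <= rdist x y + rdist y z + 5 * (rdist x y * rdist y z).
  have [A ->] := hclassP x; have [B ->] := hclassP y; have [C ->] := hclassP z.
  by rewrite !rdist_class pp_dist_triangle.
have eq0 (x y : hyperspace R) : rdist x y = 0 -> x = y.
  have [A ->] := hclassP x; have [B ->] := hclassP y.
  by rewrite rdist_class => /hclass_eq.
have ballE (x : hyperspace R) (r : R) : hball x r = fun y => rdist x y < r.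
  by apply/funext => y; rewrite /hball rdistE lte_fin.
rewrite hopenP; split.
  move=> A B; split; last by rewrite hdistE metametricE.
  by rewrite hclass_eq metametric_eq0.
split.
  split; first exact: dist_open_topology.
  by move=> S x; rewrite hclosureP; exact: dist_open_closure.
split; first exact: dist_open_metrizable.
split.
  have [b1 b2] := dist_open_basis ge0 le1 rC r0 tri; split=> [U [x [r [rp ->]]]|U x Uo Ux].
    by apply: b1; exists x, r; rewrite ballE.
  have [V [[y [r [rp ->]]] Vx VU]] := b2 U x Uo Ux.
  by exists (fun z => rdist y z < r); split => //; exists y, r; rewrite ballE.
split.
  move=> u x; rewrite dist_open_converges//.
  (* [hdist] takes finite values, so convergence to 0 in the extended reals is convergence of
     [rdist] in [R]. *)
  under [X in _ <-> (X @ _ --> _)]funext do rewrite rdistE.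
  split=> [h|/fine_cvg//]; apply: cvg_EFin => //; exact: nearW.
split; first by apply: dist_open_continuous2 => //; exact: rdistE.
by move=> op top cont U; exact: (dist_open_minimal r0 (@rdistE R) top cont).
Qed.
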